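(* Let $k$ be a field of characteristic $0$ and let $P(x,y)$ be the free Poisson field over $k$ in two variables $x,y$. Then every automorphism of the Poisson algebra $P(x,y)$ over $k$ is an automorphism of the field of rational functions $k(x,y)\subset P(x,y)$ (that is, it restricts to a $k$-automorphism of the subfield $k(x,y)$), i.e., $$\mathrm{Aut}\,P(x,y)\cong \mathrm{Aut}_k\,k(x,y)=\mathrm{Cr}_2(k)$$ as groups.
   Context: A Poisson algebra over $k$ is a $k$-vector space $P$ with two bilinear operations $x\cdot y$ and $\{x,y\}$ such that $P$ is a commutative associative algebra under $\cdot$, a Lie algebra under $\{\cdot,\cdot\}$, and $\{x,y\cdot z\}=\{x,y\}\cdot z+y\cdot\{x,z\}$ for all $x,y,z\in P$. Let $g=\mathrm{Lie}\langle x,y\rangle$ be the free Lie algebra over $k$ on $x,y$ with a linear basis $e_1,e_2,\ldots$ containing $x,y$ and consisting of multihomogeneous elements. The free Poisson algebra $P\langle x,y\rangle$ is the polynomial algebra $k[e_1,e_2,\ldots]$ with the unique Poisson bracket satisfying $\{e_i,e_j\}=[e_i,e_j]$ (the Lie product in $g$). The free Poisson field $P(x,y)$ is the field of fractions of the commutative algebra $P\langle x,y\rangle$ with the unique extension of the Poisson bracket. The field of rational functions $k(x,y)$ is the subfield of $P(x,y)$ generated over $k$ by $x$ and $y$. $\mathrm{Aut}\,P(x,y)$ is the group of $k$-linear bijections of $P(x,y)$ preserving both the product and the Poisson bracket. $\mathrm{Aut}_k\,k(x,y)$ is the group of field automorphisms of $k(x,y)$ that are identical on $k$; it is identified with the Cremona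 group $\mathrm{Cr}_2(k)$ of birational automorphisms of $\mathbb{P}^2_k$. *)

(* Defs.v *)
From HB Require Import structures.
From mathcomp Require Import all_boot all_order all_algebra.
From mathcomp Require Import finmap boolp monalg mpoly.

Set Implicit Arguments.
Unset Strict Implicit.
Unset Printing Implicit Defensive.

Import GRing.Theory.
Local Open Scope ring_scope.

(* Both monalg and mpoly declare this notation; finitely many variables are   *)
(* meant in the sense of mpoly, countably many in the sense of monalg.        *)
Notation "{ 'mpoly' T [ n ] }" := (mpoly n T) : type_scope.

(* -------------------------------------------------------------------- *)
Section LieAlgebras.
Variable k : fieldType.

Record is_lie_bracket (V : lmodType k) (br : V -> V -> V) : Prop := {
  lie_linearl : forall a u v w, br (a *: u + v) w = a *: br u w + br v w;
  lie_linearr : forall a u v w, br w (a *: u + v) = a *: br w u + br w v;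
  lie_alt : forall u, br u u = 0;
  lie_jacobi : forall u v w, br u (br v w) + br v (br w u) + br w (br u v) = 0
}.

Definition is_lie_morphism (V W : lmodType k) (brV : V -> V -> V)
    (brW : W -> W -> W) (f : V -> W) : Prop :=
  (forall a u v, f (a *: u + v) = a *: f u + f v) /\
  (forall u v, f (brV u v) = brW (f u) (f v)).

Definition is_free_lie (g : lmodType k) (br : g -> g -> g) (x y : g) : Prop :=
  is_lie_bracket br /\
  forall (W : lmodType k) (brW : W -> W -> W), is_lie_bracket brW ->
  forall a b : W, exists f : g -> W,
    [/\ is_lie_morphism br brW f, f x = a, f y = b &
        forall f' : g -> W, is_lie_morphism br brW f' -> f' x = a -> f' y = b ->
          f' =1 f].

(* The homogeneous component of bidegree (m, n), where x has bidegree (1, 0)  *)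
(* and y has bidegree (0, 1): the span of the Lie monomials having m factors  *)
(* x and n factors y.                                                         *)
Inductive multihomogeneous (V : lmodType k) (br : V -> V -> V) (x y : V) :
    nat -> nat -> V -> Prop :=
| multihomogeneous_x : multihomogeneous br x y 1 0 x
| multihomogeneous_y : multihomogeneous br x y 0 1 y
| multihomogeneous_br m n m' n' u v :
    multihomogeneous br x y m n u -> multihomogeneous br x y m' n' v ->
    multihomogeneous br x y (m + m') (n + n') (br u v)
| multihomogeneous_0 m n : multihomogeneous br x y m n 0
| multihomogeneous_lin m n a u v :
    multihomogeneous br x y m n u -> multihomogeneous br x y m n v ->
    multihomogeneous br x y m n (a *: u + v).

Definition is_linear_basis (V : lmodType k) (e : nat -> V) : Prop :=
  (forall v, exists n (c : nat -> k), v = \sum_(l < n) c l *: e l) /\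
  (forall n (c : nat -> k), \sum_(l < n) c l *: e l = 0 ->
     forall l, (l < n)%N -> c l = 0).

Record is_poisson_bracket (A : comAlgType k) (br : A -> A -> A) : Prop := {
  poisson_lie : is_lie_bracket br;
  poisson_leibniz : forall a b c, br a (b * c) = br a b * c + b * br a c
}.

End LieAlgebras.

(* -------------------------------------------------------------------- *)
(* The polynomial algebra k[e_0, e_1, ...] in countably many variables. To    *)
(* form its field of fractions it has to be shown to be a domain: a nonzero   *)
(* polynomial stays nonzero when all but finitely many variables are set to 1.*)
Definition polyN (k : fieldType) : Type := {malg k[{cmonom nat}]}.
HB.instance Definition _ (k : fieldType) := GRing.ComAlgebra.on (polyN k).

Section PolyNDomain.
Variable k : fieldType.

Definition cm_trunc n (m : {cmonom nat}) : 'X_{1..n} := [multinom m i | i < n].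

Definition cm_mon n (m : {cmonom nat}) : {mpoly k[n]} := 'X_[cm_trunc n m].

Fact cm_mon_is_multiplicative n : monalg.mmorphism (cm_mon n).
Proof.
split=> [m1 m2|]; rewrite /cm_mon.
  by rewrite -mpolyXD; congr mpolyX; apply/mnmP=> i; rewrite mnmDE !mnmE cmM.
by rewrite -(mpolyX0 n k); congr mpolyX; apply/mnmP=> i; rewrite mnmE mnm0E cm1.
Qed.

HB.instance Definition _ n :=
  monalg.isMultiplicative.Build {cmonom nat} {mpoly k[n]} (cm_mon n)
    (cm_mon_is_multiplicative n).

Definition polyN_trunc n : {rmorphism {malg k[{cmonom nat}]} -> {mpoly k[n]}} :=
  monalg.mmap (@mpolyC n k) (cm_mon n).

Lemma polyN_trunc_neq0 (p : {malg k[{cmonom nat}]}) : p != 0 ->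
  exists n0, forall n, (n0 <= n)%N -> polyN_trunc n p != 0.
Proof.
move=> p0; have [m mp] : exists m, m \in monalg.msupp p.
  by apply/fset0Pn; rewrite monalg.msupp_eq0.
pose b (m : {cmonom nat}) := (\max_(i <- finsupp m) i.+1)%N.
have bP m' i : (b m' <= i)%N -> m' i = 0%N.
  move=> le; apply/eqP; rewrite cmE_eq0; apply/negP => im.
  have : (i < b m')%N by rewrite /b (big_fsetD1 i) //= leq_maxl.
  by rewrite ltnNge le.
pose n0 := (\max_(m' <- monalg.msupp p) b m')%N.
have n0P m' : m' \in monalg.msupp p -> (b m' <= n0)%N.
  by move=> mp'; rewrite /n0 (big_fsetD1 m') //= leq_maxl.
exists n0 => n len; apply/negP => /eqP.
move/(congr1 (fun q => q@_(cm_trunc n m))); rewrite mcoeff0 /polyN_trunc /=.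
rewrite monalg.mmapE raddf_sum /= (big_fsetD1 m) //= mcoeffCM mcoeffX eqxx mulr1.
rewrite big_seq big1 ?addr0; last first.
  move=> m' /fsetD1P[ne mp']; rewrite mcoeffCM mcoeffX.
  case: eqP => [E|]; last by rewrite mulr0.
  case/eqP: ne; apply/eqP/cmP => i; case: (ltnP i n) => lin.
    by move/mnmP/(_ (Ordinal lin)): E; rewrite !mnmE.
  by rewrite !bP // (leq_trans (n0P _ _)) // (leq_trans len).
by apply/eqP; rewrite monalg.mcoeff_neq0.
Qed.

Fact polyN_integral : GRing.integral_domain_axiom (polyN k).
Proof.
move=> p q pq0; apply/orP; case: (eqVneq p 0) => [|p0]; first by left.
case: (eqVneq q 0) => [|q0]; first by right.
have [n1 h1] := polyN_trunc_neq0 p0; have [n2 h2] := polyN_trunc_neq0 q0.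
have: polyN_trunc (maxn n1 n2) (p * q) != 0.
  by rewrite rmorphM mulf_neq0 ?h1 ?h2 ?leq_maxl ?leq_maxr.
by rewrite pq0 rmorph0 eqxx.
Qed.

End PolyNDomain.

Section PolyNUnits.
Variable k : fieldType.
Implicit Types p q : polyN k.

Definition polyN_unit : pred (polyN k) := fun p => `[< exists q, q * p = 1 >].

Definition polyN_inv p : polyN k :=
  if pselect (exists q, q * p = 1) is left H then projT1 (cid H) else p.

Fact polyN_mulVp : {in polyN_unit, left_inverse 1 polyN_inv *%R}.
Proof.
move=> p /asboolP pU; rewrite /polyN_inv.
by case: pselect => // H; case: cid.
Qed.

Fact polyN_unitP p q : q * p = 1 -> polyN_unit p.
Proof. by move=> qp; apply/asboolP; exists q. Qed.

Fact polyN_inv_out : {in [predC polyN_unit], polyN_inv =1 id}.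
Proof. by move=> p /asboolP pU; rewrite /polyN_inv; case: pselect. Qed.

HB.instance Definition _ := GRing.ComNzRing_hasMulInverse.Build (polyN k)
  polyN_mulVp polyN_unitP polyN_inv_out.
HB.instance Definition _ := GRing.ComUnitRing_isIntegral.Build (polyN k)
  (@polyN_integral k).

End PolyNUnits.

(* -------------------------------------------------------------------- *)
#[short(type="fieldAlgType")]
HB.structure Definition FieldAlg (k : fieldType) :=
  {F of GRing.Field F & GRing.ComUnitAlgebra k F}.

(* -------------------------------------------------------------------- *)
Section ScaleAlong.
Variables (k L : fieldType) (f : {rmorphism k -> L}).

Definition scale_along (a : k) (u : L) : L := f a * u.

Fact scale_alongA a b u :
  scale_along a (scale_along b u) = scale_along (a * b) u.
Proof. by rewrite /scale_along mulrA -rmorphM. Qed.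

Fact scale_along1 : left_id 1 scale_along.
Proof. by move=> u; rewrite /scale_along rmorph1 mul1r. Qed.

Fact scale_alongDr : right_distributive scale_along +%R.
Proof. by move=> a u v; rewrite /scale_along mulrDr. Qed.

Fact scale_alongDl u : {morph scale_along^~ u : a b / a + b}.
Proof. by move=> a b; rewrite /scale_along rmorphD mulrDl. Qed.

Fact scale_alongAl a u v : scale_along a (u * v) = scale_along a u * v.
Proof. exact: mulrA. Qed.

End ScaleAlong.

Definition fracN (k : fieldType) : Type := {fraction (polyN k)}.
HB.instance Definition _ (k : fieldType) := GRing.Field.on (fracN k).

HB.lock Definition polyN_frac (k : fieldType) (p : polyN k) : fracN k :=
  @tofrac (polyN k) p.

Section FracN.
Variable k : fieldType.

Fact polyN_frac_zmod_morphism : zmod_morphism (@polyN_frac k).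
Proof. by rewrite unlock; exact: tofrac_is_zmod_morphism. Qed.

Fact polyN_frac_monoid_morphism : monoid_morphism (@polyN_frac k).
Proof. by rewrite unlock; exact: tofrac_is_monoid_morphism. Qed.

HB.instance Definition _ := GRing.isZmodMorphism.Build (polyN k) (fracN k)
  (@polyN_frac k) polyN_frac_zmod_morphism.
HB.instance Definition _ := GRing.isMonoidMorphism.Build (polyN k) (fracN k)
  (@polyN_frac k) polyN_frac_monoid_morphism.

Definition fracN_const : k -> fracN k := @polyN_frac k \o in_alg (polyN k).
HB.instance Definition _ := GRing.RMorphism.on fracN_const.

HB.instance Definition _ := GRing.Zmodule_isLmodule.Build k (fracN k)
  (@scale_alongA _ _ fracN_const) (@scale_along1 _ _ fracN_const)
  (@scale_alongDr _ _ fracN_const) (@scale_alongDl _ _ fracN_const).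
HB.instance Definition _ := GRing.Lmodule_isLalgebra.Build k (fracN k)
  (@scale_alongAl _ _ fracN_const).
HB.instance Definition _ := GRing.Lalgebra_isComAlgebra.Build k (fracN k).

HB.instance Definition _ := FieldAlg.copy (fracN k) (fracN k).

Definition fracN_var (i : nat) : fracN k := polyN_frac << ucm i >>.

End FracN.

(* -------------------------------------------------------------------- *)
Section GeneratedSubfield.
Variables (k : fieldType) (F : fieldAlgType k) (u v : F).

(* The intersection of all subfields of F containing k, u and v.              *)
Definition gen_subfield : {pred F} := fun z =>
  `[< forall S : {pred F}, GRing.divring_closed S ->
        (forall a : k, a%:A \in S) -> u \in S -> v \in S -> z \in S >].

Fact gen_subfield_divalg_closed : GRing.divalg_closed gen_subfield.
Proof.
have H z : z \in gen_subfield <-> forall S : {pred F},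
    GRing.divring_closed S -> (forall a : k, a%:A \in S) ->
    u \in S -> v \in S -> z \in S.
  by split=> [/asboolP|h]; last exact/asboolP.
split=> [|a z t /H zS /H tS|z t /H zS /H tS]; apply/H => S dS aS uS vS.
- by case: dS.
- have [S1 SB SV] := dS.
  have SN w : w \in S -> - w \in S.
    by move=> wS; rewrite -sub0r SB // -(subrr 1) SB.
  rewrite -[t]opprK SB ?SN ?tS // -mulr_algl -[z]invrK SV // -[z^-1]mul1r.
  by rewrite SV ?zS.
- by have [_ _ SV] := dS; rewrite SV ?zS ?tS.
Qed.

HB.instance Definition _ := GRing.isDivalgClosed.Build k F gen_subfield
  gen_subfield_divalg_closed.

Definition subfield_of : Type := {z : F | z \in gen_subfield}.
HB.instance Definition _ := SubChoice.on subfield_of.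
HB.instance Definition _ := [SubChoice_isSubComUnitRing of subfield_of by <:].
HB.instance Definition _ :=
  [SubComUnitRing_isSubIntegralDomain of subfield_of by <:].
HB.instance Definition _ := [SubIntegralDomain_isSubField of subfield_of by <:].
HB.instance Definition _ := [SubZmodule_isSubLmodule of subfield_of by <:].
HB.instance Definition _ :=
  [SubNzRing_SubLmodule_isSubLalgebra of subfield_of by <:].
HB.instance Definition _ := [SubLalgebra_isSubAlgebra of subfield_of by <:].
HB.instance Definition _ := FieldAlg.copy subfield_of subfield_of.

End GeneratedSubfield.

(* -------------------------------------------------------------------- *)
(* The group of all bijections of T, the product of s and t being s \o t.     *)
Section Symmetries.
Variable T : Type.

Record sym := Sym {
  sym_fun :> T -> T;
  sym_inv : T -> T;
  _ : cancel sym_fun sym_inv;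
  _ : cancel sym_inv sym_fun
}.

Lemma symK (s : sym) : cancel s (sym_inv s). Proof. by case: s. Qed.
Lemma symVK (s : sym) : cancel (sym_inv s) s. Proof. by case: s. Qed.

Lemma sym_eqP (s t : sym) : s =1 t -> s = t.
Proof.
case: s t => [f f' fK f'K] [g g' gK g'K] /= /funext fg; subst g.
have e : f' = g' by apply/funext => x; rewrite -[in LHS](g'K x) fK.
by subst g'; congr Sym; exact: Prop_irrelevance.
Qed.

HB.instance Definition _ := gen_eqMixin sym.
HB.instance Definition _ := gen_choiceMixin sym.

Definition sym1 : sym := @Sym id id (fun=> erefl) (fun=> erefl).
Definition symV (s : sym) : sym := Sym (symVK s) (symK s).
Definition symM (s t : sym) : sym :=
  Sym (can_comp (symK s) (symK t)) (can_comp (symVK t) (symVK s)).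

Fact symMA : associative symM. Proof. by move=> *; exact: sym_eqP. Qed.
Fact sym1M : left_id sym1 symM. Proof. by move=> *; exact: sym_eqP. Qed.
Fact symM1 : right_id sym1 symM. Proof. by move=> *; exact: sym_eqP. Qed.
Fact symVM : left_inverse sym1 symV symM.
Proof. by move=> s; apply: sym_eqP => x /=; exact: symK. Qed.
Fact symMV : right_inverse sym1 symV symM.
Proof. by move=> s; apply: sym_eqP => x /=; exact: symVK. Qed.

HB.instance Definition _ := isGroup.Build sym symMA sym1M symM1 symVM symMV.

End Symmetries.

Section Automorphisms.
Variable k : fieldType.

Definition is_field_aut (L : fieldAlgType k) (s : sym L) : Prop :=
  [/\ forall u v, s (u + v) = s u + s v,
      forall u v, s (u * v) = s u * s v &
      forall a : k, s a%:A = a%:A].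

Definition is_poisson_aut (P : fieldAlgType k) (br : P -> P -> P) (s : sym P) :
    Prop :=
  [/\ forall (a : k) u v, s (a *: u + v) = a *: s u + s v,
      forall u v, s (u * v) = s u * s v &
      forall u v, s (br u v) = br (s u) (s v)].

Definition field_aut_pred (L : fieldAlgType k) : pred (sym L) :=
  fun s => `[< is_field_aut s >].

Definition poisson_aut_pred (P : fieldAlgType k) (br : P -> P -> P) :
    pred (sym P) :=
  fun s => `[< is_poisson_aut br s >].

Fact field_aut_group_closed (L : fieldAlgType k) :
  group_closed (@field_aut_pred L).
Proof.
split=> [|s t /asboolP[sD sM sC] /asboolP[tD tM tC]]; apply/asboolP=> //.
have tI := can_inj (symK t); split=> [u v|u v|a] /=.
- by rewrite -sD; congr (s _); apply: tI; rewrite tD !symVK.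
- by rewrite -sM; congr (s _); apply: tI; rewrite tM !symVK.
- by rewrite -[RHS]sC; congr (s _); apply: tI; rewrite tC symVK.
Qed.

Fact poisson_aut_group_closed (P : fieldAlgType k) (br : P -> P -> P) :
  group_closed (poisson_aut_pred br).
Proof.
split=> [|s t /asboolP[sD sM sB] /asboolP[tD tM tB]]; apply/asboolP=> //.
have tI := can_inj (symK t); split=> [a u v|u v|u v] /=.
- by rewrite -sD; congr (s _); apply: tI; rewrite tD !symVK.
- by rewrite -sM; congr (s _); apply: tI; rewrite tM !symVK.
- by rewrite -sB; congr (s _); apply: tI; rewrite tB !symVK.
Qed.

Definition field_aut (L : fieldAlgType k) : Type :=
  {s : sym L | field_aut_pred s}.
HB.instance Definition _ (L : fieldAlgType k) := SubChoice.on (field_aut L).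
HB.instance Definition _ (L : fieldAlgType k) :=
  SubChoice_isSubGroup.Build (sym L) (@field_aut_pred L) (field_aut L)
    (field_aut_group_closed L).

Definition poisson_aut (P : fieldAlgType k) (br : P -> P -> P) : Type :=
  {s : sym P | poisson_aut_pred br s}.
HB.instance Definition _ (P : fieldAlgType k) (br : P -> P -> P) :=
  SubChoice.on (poisson_aut br).
HB.instance Definition _ (P : fieldAlgType k) (br : P -> P -> P) :=
  SubChoice_isSubGroup.Build (sym P) (poisson_aut_pred br) (poisson_aut br)
    (poisson_aut_group_closed br).

End Automorphisms.

(* -------------------------------------------------------------------- *)
(* A rational map from the projective plane to itself is given by three forms *)
(* of the same degree, not all zero, up to proportionality; [f] and [g] below *)
(* are representatives, compared by [ratmap_eq].                              *)
Section Cremona.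
Variable k : fieldType.
Implicit Types f g : 3.-tuple {mpoly k[3]}.

Definition is_ratmap f : Prop :=
  (exists d : nat, forall i, tnth f i \is d.-homog) /\
  (exists i, tnth f i != 0).

Definition ratmap_eq f g : Prop :=
  forall i j, tnth f i * tnth g j = tnth f j * tnth g i.

Definition ratmap_id : 3.-tuple {mpoly k[3]} := [tuple 'X_i | i < 3].

Definition ratmap_comp f g : 3.-tuple {mpoly k[3]} :=
  [tuple tnth f i \mPo g | i < 3].

Definition is_birational f : Prop :=
  is_ratmap f /\
  exists g, [/\ is_ratmap g,
    is_ratmap (ratmap_comp f g), ratmap_eq (ratmap_comp f g) ratmap_id,
    is_ratmap (ratmap_comp g f) & ratmap_eq (ratmap_comp g f) ratmap_id].

(* [b] induces an isomorphism from the group G onto the group Cr_2(k) of      *)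
(* classes of birational maps.                                                *)
Definition is_cremona_isomorphism (G : groupType)
    (b : G -> 3.-tuple {mpoly k[3]}) : Prop :=
  [/\ forall s, is_birational (b s),
      forall s t, ratmap_eq (b (s * t)%g) (ratmap_comp (b s) (b t)),
      forall s t, ratmap_eq (b s) (b t) -> s = t &
      forall f, is_birational f -> exists s, ratmap_eq (b s) f].

End Cremona.

(* -------------------------------------------------------------------- *)
(* The i-th variable of [fracN k] stands for the basis vector [e i] of the    *)
(* free Lie algebra. By bilinearity and the Leibniz rules, on a polynomial    *)
(* algebra and then on its field of fractions, there is exactly one such [br].*)
Definition is_free_poisson_bracket (k : fieldType) (g : lmodType k)
    (lie : g -> g -> g) (e : nat -> g) (br : fracN k -> fracN k -> fracN k) :
    Prop :=
  is_poisson_bracket br /\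
  forall i j n (c : nat -> k), lie (e i) (e j) = \sum_(l < n) c l *: e l ->
    br (fracN_var k i) (fracN_var k j) = \sum_(l < n) c l *: fracN_var k l.

(* Main.v *)
Require Import Defs.
From HB Require Import structures.
From mathcomp Require Import all_boot all_order all_algebra.
From mathcomp Require Import finmap boolp monalg mpoly.
From mathcomp Require Import zify ring.

(** Write F for the free Poisson field P(x, y), g for the free Lie algebra on x
    and y, and K for k(x, y).

    Restriction to K. The Kaehler differentials of F are F (x) g. Embedding g in
    the free associative algebra turns the universal derivation of F into a
    derivation [delta] from F to noncommutative series over F, for which [delta x]
    and [delta y] are the two letters. Adding multiplication by [delta f] to the
    bracket with [f] on coefficients gives operators [ham f] on series, which
    represent the Poisson algebra F and satisfy
    [delta {f, h} = ham f (delta h) - ham h (delta f)] (lemmas [ham_br] and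
    [delta_br]). Let [u] and [v] be the images of x and y under a Poisson
    automorphism. They generate F as a Poisson field, so that the two letters lie
    in the smallest F-subspace of series that contains [delta u] and [delta v] and
    is stable under [ham u] and [ham v] (lemma [span_delta]).

    This is possible only if [delta u] and [delta v] have degree 1 (lemma
    [twist_span_degree]). Indeed, after a change of basis of the F-space that they
    span, their leading forms are linearly independent Lie elements. Two such
    elements are left independent in the free associative algebra (lemma
    [left_indep]), because a Lie element is never the product of a nonconstant
    factor and a nonzero Lie element of smaller degree (lemma
    [prim_no_factor]). Hence leading terms never cancel, and both letters can be
    reached only if both leading forms have degree 1. By Dynkin's identity (lemma
    [dynkin]) the images of the basis of g in the free associative algebra are
    independent over F; thus [u] has zero derivative with respect to every basis
    element other than x and y, and in characteristic 0 this means that [u] is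
    in K (lemma [pd_kernel]). The same holds for [v].

    Extension to F. Let [s] be an automorphism of K. Freeness of g extends
    [x |-> s x] and [y |-> s y] to a Lie morphism from g to F, and then to a
    morphism from the polynomial algebra to F. This morphism is injective, because
    the partial substitution attached to the inverse of [s] undoes it, so it
    extends to F (lemma [exists_extension]). The extension is unique, since x and
    y generate F as a Poisson field (lemma [poisson_endo_id]).

    The Cremona group. An automorphism of K is determined by the images of x and
    y, which are the affine coordinates of a rational map of the plane, given by
    three forms of the same degree. Composition of rational maps corresponds to
    composition of automorphisms in the opposite order, so the isomorphism sends
    [s] to the map with coordinates the images of x and y under the inverse of [s]
    (lemma [cremona_iso]). *)

Set Implicit Arguments.
Unset Strict Implicit.
Unset Printing Implicit Defensive.

Import GRing.Theory.
Local Open Scope ring_scope.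

(** * Noncommutative power series in two letters *)

(** A series is its coefficient function on words, [true] being the letter X and
    [false] the letter Y. Series rather than polynomials are used because left
    division by a letter, partial derivatives of coefficients and shuffles are
    then defined coefficient by coefficient; bounds on the degree are carried by
    hypotheses. *)
Definition ncs (R : Type) : Type := seq bool -> R.

Section Series.
Variable R : comNzRingType.
Implicit Types (a b c m : ncs R) (w z : seq bool).

HB.instance Definition _ := gen_eqMixin (ncs R).
HB.instance Definition _ := gen_choiceMixin (ncs R).

Definition ncs_add a b : ncs R := fun w => a w + b w.
Definition ncs_opp a : ncs R := fun w => - a w.
Definition ncs_zero : ncs R := fun=> 0.

Fact ncs_addA : associative ncs_add.
Proof. by move=> a b c; apply/funext => w; rewrite /ncs_add addrA. Qed.
Fact ncs_addC : commutative ncs_add.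
Proof. by move=> a b; apply/funext => w; rewrite /ncs_add addrC. Qed.
Fact ncs_add0 : left_id ncs_zero ncs_add.
Proof. by move=> a; apply/funext => w; rewrite /ncs_add add0r. Qed.
Fact ncs_addN : left_inverse ncs_zero ncs_opp ncs_add.
Proof. by move=> a; apply/funext => w; rewrite /ncs_add addNr. Qed.

HB.instance Definition _ := GRing.isZmodule.Build (ncs R)
  ncs_addA ncs_addC ncs_add0 ncs_addN.

(** Left division by the letter [x]. A series is its constant term together with
    its two strips, which is how most identities below are proved. *)
Definition strip (x : bool) a : ncs R := fun w => a (x :: w).

(** The recursion encodes [strip x (a * b) = strip x a * b + a_0 *: strip x b],
    where [a_0] is the constant term. *)
Fixpoint ncs_mul a b w : R :=
  if w is x :: w' then ncs_mul (strip x a) b w' + a [::] * b w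
  else a [::] * b [::].

Definition ncs_one : ncs R := fun w => (w == [::])%:R.

Lemma ncsE a b w : (a + b) w = a w + b w. Proof. by []. Qed.
Lemma ncsN a w : (- a) w = - a w. Proof. by []. Qed.
Lemma ncs0 w : (0 : ncs R) w = 0. Proof. by []. Qed.

Lemma stripD x a b : strip x (a + b) = strip x a + strip x b.
Proof. by []. Qed.

Fact ncs_mul0l b w : ncs_mul 0 b w = 0.
Proof.
elim: w => [|x w IH] /=; first by rewrite ncs0 mul0r.
by rewrite (_ : strip x 0 = 0) // IH ncs0 mul0r addr0.
Qed.

Fact ncs_mulDl : left_distributive ncs_mul +%R.
Proof.
move=> a b c; apply/funext => w; rewrite ncsE.
elim: w a b => [|x w IH] a b /=; first by rewrite ncsE mulrDl.
by rewrite stripD IH ncsE mulrDl addrACA.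
Qed.

Fact ncs_mulDr : right_distributive ncs_mul +%R.
Proof.
move=> c a b; apply/funext => w; rewrite ncsE.
elim: w c => [|x w IH] c /=; first by rewrite ncsE mulrDr.
by rewrite IH ncsE mulrDr addrACA.
Qed.

Fact ncs_mulA : associative ncs_mul.
Proof.
move=> a b c; apply/funext => w.
elim: w a b c => [|x w IH] a b c /=; first by rewrite mulrA.
have -> : strip x (ncs_mul a b) = (ncs_mul (strip x a) b : ncs R) +
    ((fun w' => a [::] * strip x b w') : ncs R) by [].
rewrite IH ncs_mulDl ncsE mulrDr !mulrA !addrA; congr (_ + _ + _).
move: (a [::]) (strip x b) => r d {IH a b x}.
elim: w d => [|x w IH] d /=; first by rewrite mulrA.
by rewrite mulrDr -(IH (strip x d)) mulrA.
Qed.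

Fact ncs_mul1l : left_id ncs_one ncs_mul.
Proof.
move=> a; apply/funext => -[|x w] /=; rewrite /ncs_one eqxx mul1r //.
by rewrite (_ : strip x _ = 0) ?ncs_mul0l ?add0r //; apply/funext.
Qed.

Fact ncs_mul1r : right_id ncs_one ncs_mul.
Proof.
move=> a; apply/funext => w; elim: w a => [|x w IH] a /=.
  by rewrite /ncs_one eqxx mulr1.
by rewrite IH /ncs_one /= mulr0 addr0.
Qed.

Fact ncs_one_neq0 : ncs_one != 0.
Proof.
by apply/negP => /eqP/(congr1 (fun m => m [::])); apply/eqP; exact: oner_neq0.
Qed.

HB.instance Definition _ := GRing.Zmodule_isNzRing.Build (ncs R)
  ncs_mulA ncs_mul1l ncs_mul1r ncs_mulDl ncs_mulDr ncs_one_neq0.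

Definition ncs_scale (r : R) a : ncs R := fun w => r * a w.

Fact ncs_scaleA r s a : ncs_scale r (ncs_scale s a) = ncs_scale (r * s) a.
Proof. by apply/funext => w; rewrite /ncs_scale mulrA. Qed.
Fact ncs_scale1 : left_id 1 ncs_scale.
Proof. by move=> a; apply/funext => w; rewrite /ncs_scale mul1r. Qed.
Fact ncs_scaleDr : right_distributive ncs_scale +%R.
Proof. by move=> r a b; apply/funext => w; rewrite /ncs_scale mulrDr. Qed.
Fact ncs_scaleDl a : {morph ncs_scale^~ a : r s / r + s}.
Proof. by move=> r s; apply/funext => w; rewrite /ncs_scale mulrDl. Qed.

HB.instance Definition _ := GRing.Zmodule_isLmodule.Build R (ncs R)
  ncs_scaleA ncs_scale1 ncs_scaleDr ncs_scaleDl.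

Lemma ncs1 w : (1 : ncs R) w = (w == [::])%:R. Proof. by []. Qed.
Lemma ncsZ r a w : (r *: a) w = r * a w. Proof. by []. Qed.
Lemma ncsM0 a b : (a * b) [::] = a [::] * b [::]. Proof. by []. Qed.

Lemma ncsMS a b x w :
  (a * b) (x :: w) = (strip x a * b) w + a [::] * b (x :: w).
Proof. by []. Qed.

Lemma stripM x a b : strip x (a * b) = strip x a * b + a [::] *: strip x b.
Proof. by []. Qed.

Fact ncs_scaleAl r a b : r *: (a * b) = (r *: a) * b.
Proof.
apply/funext => w; elim: w a => [|x w IH] a; first by rewrite ncsZ !ncsM0 mulrA.
rewrite ncsZ !ncsMS mulrDr.
by rewrite -[r * _ w]/((r *: (strip x a * b)) w) IH ncsZ mulrA.
Qed.

Fact ncs_scaleAr r a b : r *: (a * b) = a * (r *: b).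
Proof.
apply/funext => w; elim: w a => [|x w IH] a.
  by rewrite ncsZ !ncsM0 ncsZ mulrCA.
rewrite ncsZ !ncsMS mulrDr.
by rewrite -[r * _ w]/((r *: (strip x a * b)) w) IH !ncsZ; congr (_ + _);
  rewrite mulrCA.
Qed.

HB.instance Definition _ :=
  GRing.Lmodule_isLalgebra.Build R (ncs R) ncs_scaleAl.
HB.instance Definition _ :=
  GRing.Lalgebra_isAlgebra.Build R (ncs R) ncs_scaleAr.

Lemma ncs_sum (I : Type) (s : seq I) (P : pred I) (G : I -> ncs R) w :
  (\sum_(i <- s | P i) G i) w = \sum_(i <- s | P i) G i w.
Proof. by elim/big_rec2: _ => // i y1 y2 _ <-. Qed.

Definition letter (x : bool) : ncs R := fun w => (w == [:: x])%:R.

End Series.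

(** * The shuffle coproduct and primitive series *)
Section Coproduct.
Variable R : comNzRingType.
Implicit Types (a b m t : ncs R) (w z : seq bool).

(** [cop z m w] is the sum of the coefficients of [m] over all shuffles of [z]
    and [w]: the coefficient at (z, w) of the image of [m] under the algebra
    morphism sending each letter [x] to [x (x) 1 + 1 (x) x]. For fixed [z] it is
    a linear operator on series that lowers degrees by the size of [z]. *)
Fixpoint cop z : ncs R -> ncs R :=
  if z is x :: z' then
    fix copz m w : R :=
      if w is y :: w' then cop z' (strip x m) w + copz (strip y m) w'
      else cop z' (strip x m) [::]
  else id.

Lemma cop_nilr z m : cop z m [::] = m z.
Proof. by elim: z m => [|x z IH] m //=; rewrite IH. Qed.

Lemma cop_cons x z m y w :
  cop (x :: z) m (y :: w) =
    cop z (strip x m) (y :: w) + cop (x :: z) (strip y m) w.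
Proof. by []. Qed.

Lemma strip_cop x z m y : strip y (cop (x :: z) m) =
  strip y (cop z (strip x m)) + cop (x :: z) (strip y m).
Proof. by []. Qed.

Lemma cop_linear z r m n : cop z (r *: m + n) = r *: cop z m + cop z n.
Proof.
apply/funext => w; rewrite ncsE ncsZ.
elim: z w m n => [|x z IHz] w m n //.
elim: w m n => [|y w IHw] m n; first by rewrite !cop_nilr.
rewrite !cop_cons (_ : strip x (_ + _) = r *: strip x m + strip x n) // IHz.
rewrite (_ : strip y (_ + _) = r *: strip y m + strip y n) // IHw.
by rewrite mulrDr addrACA.
Qed.

HB.instance Definition _ z :=
  GRing.isLinear.Build R (ncs R) (ncs R) *:%R (cop z) (@cop_linear z).

Lemma cop_local z m w :
  (forall v, size v = (size z + size w)%N -> m v = 0) -> cop z m w = 0.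
Proof.
elim: z m w => [|x z IHz] m w; first by apply.
elim: w m => [|y w IHw] m mP; first by rewrite cop_nilr mP //= addn0.
by rewrite cop_cons IHz ?IHw ?addr0 // => v sv; apply: mP;
  rewrite /= sv /= ?addSn ?addnS.
Qed.

Lemma cop_deg (N : nat) z m : (forall w, (N <= size w)%N -> m w = 0) ->
  forall w, (N <= size z + size w)%N -> cop z m w = 0.
Proof. by move=> mN w len; apply: cop_local => v sv; apply: mN; rewrite sv. Qed.

(** Primitive for the coproduct above: [m] goes to [m (x) 1 + 1 (x) m]. All Lie
    elements are primitive, and the independence results below need only this. *)
Definition prim a := a [::] = 0 /\
  forall x z y w, cop (x :: z) a (y :: w) = 0.

(** The coproduct is multiplicative; for a primitive right factor only the terms
    [a (x) 1] and [1 (x) a] of its coproduct contribute. *)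
Lemma cop_mul_prim a : prim a -> forall t z w,
  cop z (t * a) w = (cop z t * a) w + (cop w t * a) z.
Proof.
move=> [a0 aP] t z; have [n] := ubnP (size z);
  elim: n t z => // n IHn t z ltz w.
move: ltz; have [l] := ubnP (size w).
elim: l z w t => // l IHl z w t ltw ltz.
case: z ltz => [|x z] ltz; first by rewrite ncsM0 a0 mulr0 addr0.
case: w ltw => [|y w] ltw; first by rewrite cop_nilr ncsM0 a0 mulr0 add0r.
have E x' z' y' w' : (cop (x' :: z') t * a) (y' :: w') =
    (cop z' (strip x' t) * a) (y' :: w') + (cop (x' :: z') (strip y' t) * a) w'.
  by rewrite !ncsMS strip_cop mulrDl ncsE addrAC.
rewrite cop_cons !stripM !(addrC _ (t [::] *: _)) !cop_linear !ncsE !ncsZ.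
rewrite addrACA -mulrDr -cop_cons aP mulr0 add0r !E.
rewrite (IHn _ z) // (IHl (x :: z) w) //.
by rewrite addrACA; congr (_ + _); rewrite addrC.
Qed.

Lemma prim_comm a b : prim a -> prim b -> prim (a * b - b * a).
Proof.
move=> aP bP; split=> [|x z y w].
  by rewrite ncsE ncsN !ncsM0 (proj1 aP) (proj1 bP) !mul0r subrr.
have E c d : prim c -> prim d -> cop (x :: z) (c * d) (y :: w) =
    c (x :: z) * d (y :: w) + c (y :: w) * d (x :: z).
  move=> cP dP; rewrite cop_mul_prim //.
  rewrite !ncsMS !cop_nilr.
  have -> : strip y (cop (x :: z) c) = 0 by apply/funext => v;
    exact: (proj2 cP).
  have -> : strip x (cop (y :: w) c) = 0 by apply/funext => v;
    exact: (proj2 cP).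
  by rewrite !mul0r !add0r.
rewrite addrC -scaleN1r cop_linear ncsE ncsZ !E // mulN1r.
by rewrite [b _ * _]mulrC [b (y :: w) * _]mulrC [a _ * _ + _]addrC addNr.
Qed.

Lemma prim_letter x : prim (letter R x).
Proof.
split=> // u z v w; apply: (@cop_deg 2); last by rewrite /= addSn addnS !ltnS.
by case=> [|s [|t r]] // _; rewrite /letter eqseq_cons andbF.
Qed.

Lemma prim_lin r a b : prim a -> prim b -> prim (r *: a + b).
Proof.
move=> [a0 aP] [b0 bP]; split=> [|x z y w].
  by rewrite ncsE ncsZ a0 b0 mulr0 addr0.
by rewrite cop_linear ncsE ncsZ aP bP mulr0 addr0.
Qed.

Lemma prim0 : prim 0.
Proof. by split=> // x z y w; rewrite linear0. Qed.

End Coproduct.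

(** * Degrees, and left independence of primitive series *)
Section Degree.
Variable R : comNzRingType.
Implicit Types (a b m s t : ncs R) (w z : seq bool) (d p q : nat).

Definition homogen d m := forall w, size w <> d -> m w = 0.
Definition degb d m := forall w, (d <= size w)%N -> m w = 0.

Lemma degbW d d' m : (d <= d')%N -> degb d m -> degb d' m.
Proof. by move=> le md w lew; apply: md; exact: leq_trans lew. Qed.

Lemma homogen_degb d m : homogen d m -> degb d.+1 m.
Proof. by move=> h w le; apply: h => e; rewrite e ltnn in le. Qed.

Lemma degbM p q a b : degb p a -> degb q b ->
  forall w, (p + q <= (size w).+1)%N -> (a * b) w = 0.
Proof.
move=> aP bQ w; elim: w p a aP => [|x w IH] p a aP le.
  rewrite ncsM0; case: p aP le => [|p] aP le; first by rewrite aP // mul0r.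
  by rewrite (bQ [::]) ?mulr0 //; move: le => /=; lia.
case: p aP le => [|p] aP le.
  by have -> : a = 0; [apply/funext => v; exact: aP | rewrite mul0r].
rewrite ncsMS (IH p) ?add0r; last 2 first.
- by move=> v lev; apply: aP.
- by move: le => /=; lia.
by rewrite bQ ?mulr0 //; move: le => /=; lia.
Qed.

Lemma low_mul p a b : (forall w, (size w < p)%N -> b w = 0) ->
  forall w, (size w < p)%N -> (a * b) w = 0.
Proof.
move=> bP w; elim: w a => [|x w IH] a lt; first by rewrite ncsM0 bP ?mulr0.
by rewrite ncsMS IH ?bP ?mulr0 ?addr0 //; apply: ltn_trans lt.
Qed.

Lemma mul_low p a b z : homogen p b -> size z = p -> (a * b) z = a [::] * b z.
Proof.
move=> bP; case: z => [|x z] zp //.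
rewrite ncsMS (@low_mul p) ?add0r //; last by rewrite -zp.
by move=> w lt; apply: bP => e; rewrite e ltnn in lt.
Qed.

Lemma homogen_mul p q a b : homogen p a -> homogen q b ->
  homogen (p + q) (a * b).
Proof.
move=> aP bQ w; case: (ltngtP (size w) (p + q)) => // + _.
  elim: w p a aP => [|x w IH] p a aP.
    rewrite ncsM0; case: p aP => [|p] aP lt.
      by rewrite (bQ [::]) ?mulr0 //; move: lt => /=; lia.
    by rewrite (aP [::]) ?mul0r.
  rewrite ncsMS; case: p aP => [|p] aP lt.
    rewrite (_ : strip x a = 0) ?mul0r ?ncs0 ?add0r; last first.
      by apply/funext => v; apply: aP.
    by rewrite bQ ?mulr0 //; move: lt => /=; lia.
  rewrite (IH p) ?add0r; first by rewrite (aP [::]) ?mul0r.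
    by move=> v ne; apply: aP => -[].
  by move: lt => /=; lia.
move=> lt; apply: (degbM (homogen_degb aP) (homogen_degb bQ)); lia.
Qed.

Lemma homogen_strip p x a : homogen p.+1 a -> homogen p (strip x a).
Proof. by move=> h w ne; apply: h => -[]. Qed.

Lemma homogen_lin p r a b : homogen p a -> homogen p b ->
  homogen p (r *: a + b).
Proof. by move=> aP bP w ne; rewrite ncsE ncsZ aP ?bP ?mulr0 ?addr0. Qed.

Lemma homogenZ p r a : homogen p a -> homogen p (r *: a).
Proof. by move=> aP w ne; rewrite ncsZ aP ?mulr0. Qed.

Lemma homogen_scalar a : homogen 0 a -> a = a [::] *: 1.
Proof.
move=> h; apply/funext => -[|x w]; rewrite ncsZ.
  by rewrite ncs1 mulr1.
by rewrite h // ncs1 mulr0.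
Qed.

Lemma homogen_nz p a : homogen p a -> a != 0 -> exists2 z,
  size z = p & a z != 0.
Proof.
move=> h; apply: contra_neqP => nex; apply/funext => w.
case: (eqVneq (a w) 0) => // ne; case: nex; exists w => //.
by apply: contra_neqP ne => /h.
Qed.

(** [m] has degree at most [d] and [s] is its component of degree [d], which may
    vanish. *)
Definition tops d m s := homogen d s /\ forall w, (d <= size w)%N -> m w = s w.

Lemma tops_degb d m s : tops d m s -> degb d.+1 m.
Proof. by move=> [h e] w lt; rewrite e ?h //; lia. Qed.

Lemma tops_lt d d' m : degb d m -> (d <= d')%N -> tops d' m 0.
Proof. by move=> md le; split=> // w lew; rewrite md //; lia. Qed.

Lemma tops_lin d r m m' s s' : tops d m s -> tops d m' s' ->
  tops d (r *: m + m') (r *: s + s').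
Proof.
move=> [hs es] [hs' es']; split; first exact: homogen_lin.
by move=> w le; rewrite !ncsE !ncsZ es ?es'.
Qed.

Lemma topsD d m m' s s' : tops d m s -> tops d m' s' ->
  tops d (m + m') (s + s').
Proof. by move=> h /(tops_lin 1 h); rewrite !scale1r. Qed.

Lemma tops_mul p q a b s t : tops p a s -> tops q b t ->
  tops (p + q) (a * b) (s * t).
Proof.
move=> /[dup] ha [hs es] /[dup] hb [ht et]; split; first exact: homogen_mul.
move=> w le; apply/eqP; rewrite -subr_eq0 -ncsN -ncsE.
have -> : a * b - s * t = (a - s) * b + s * (b - t).
  by rewrite mulrBl mulrBr addrA addrNK.
have d1 : degb p (a - s) by move=> v lev; rewrite ncsE ncsN es ?subrr.
have d2 : degb q (b - t) by move=> v lev; rewrite ncsE ncsN et ?subrr.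
rewrite ncsE (degbM d1 (tops_degb hb)) ?addnS ?ltnS // add0r.
by rewrite (degbM (homogen_degb hs) d2) ?addSn ?ltnS.
Qed.

Lemma degb_tops d m : degb d.+1 m ->
  tops d m (fun w => if size w == d then m w else 0).
Proof.
move=> md; split=> [w /eqP/negbTE -> //|w le].
by case: eqP => // ne; apply: md; lia.
Qed.

End Degree.

Section LeftIndependence.
Variable K : fieldType.
Hypothesis char0 : [pchar K] =i pred0.
Implicit Types (a b r s t : ncs K).

Lemma mul_homog_eq0 p a t : homogen p a -> a != 0 -> t * a = 0 -> t = 0.
Proof.
move=> ha /(homogen_nz ha)[z zp az] ta; apply/funext => w.
elim: w t ta => [|x w IH] t ta.
  have /eqP := congr1 (fun m => m z) ta.
  by rewrite (mul_low _ ha zp) ncs0 mulf_eq0 (negbTE az) orbF => /eqP.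
have t0 : t [::] = 0.
  have /eqP := congr1 (fun m => m z) ta.
  by rewrite (mul_low _ ha zp) ncs0 mulf_eq0 (negbTE az) orbF => /eqP.
rewrite -[t _]/(strip x t w); apply: IH.
by have := congr1 (strip x) ta; rewrite stripM t0 scale0r addr0.
Qed.

(** The operator [cop z], with [z] a word in the support of [a], acts on multiples
    of [a] as a derivative with respect to [a] (lemma [cop_mul_homog]). *)
Section NoFactor.
Variables (p : nat) (a : ncs K) (z : seq bool).
Hypotheses (aP : prim a) (ha : homogen p a) (p0 : (0 < p)%N).
Hypotheses (zp : size z = p) (az : a z != 0).

Lemma cop_mul_homog t : cop z (t * a) = cop z t * a + a z *: t.
Proof.
apply/funext => w; rewrite cop_mul_prim // ncsE ncsZ; congr (_ + _).
by rewrite (mul_low _ ha zp) cop_nilr mulrC.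
Qed.

(** The equation makes [t] a multiple [t' * a], and then [t'] satisfies the same
    equation with [n + 1] in place of [n] and a smaller degree. Characteristic 0
    keeps the scalar invertible. *)
Lemma cop_eigen_eq0 N n t : degb N t ->
  (n.+1%:R * a z) *: t + cop z t * a = 0 -> t = 0.
Proof.
elim: N n t => [|N IH] n t tN; first by move=> _; apply/funext => w; exact: tN.
move=> E; have nz m : m.+1%:R * a z != 0.
  by rewrite mulf_neq0 // (pcharf0P K).1.
pose t' := - (n.+1%:R * a z)^-1 *: cop z t.
have Et : t = t' * a.
  rewrite /t' -scalerAl; move/eqP: E; rewrite addr_eq0 => /eqP E.
  by rewrite scaleNr -scalerN -E scalerA mulVf // scale1r.
have Ec : cop z t = - (n.+1%:R * a z) *: t'.
  by rewrite /t' scalerA mulNr mulrN opprK mulfV // scale1r.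
have t'0 : t' = 0; last by rewrite Et t'0 mul0r.
apply: (IH n.+1) => [w le|].
  rewrite /t' ncsZ (cop_deg tN) ?mulr0 // zp; lia.
move: Ec; rewrite {1}Et cop_mul_homog => /eqP.
rewrite -subr_eq0 scaleNr opprK -addrA -scalerDl addrC => /eqP E'.
by rewrite -[n.+2%:R]nat1r mulrDl mul1r.
Qed.

(** A primitive [b] is killed by [cop z] when its degree is larger than that of
    [z], so [b = t * a] gives the equation of [cop_eigen_eq0] for [t] with
    [n = 0]. *)
Lemma prim_no_factor q b t N : prim b -> homogen q b -> (p < q)%N -> degb N t ->
  b = t * a -> b = 0.
Proof.
move=> bP hb ltpq tN E; have t0 : t = 0; last by rewrite E t0 mul0r.
apply: (@cop_eigen_eq0 N 0) tN _; rewrite mul1r addrC -cop_mul_homog -E.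
apply/funext => -[|y w]; first by rewrite cop_nilr hb //; lia.
by case Ez: z => [|x z']; [move: p0; rewrite -zp Ez | exact: (proj2 bP)].
Qed.

End NoFactor.

(** A relation can be stripped letter by letter until [s] is a scalar, and then
    [b] is a left multiple of [a]: a scalar multiple if the degrees agree, which
    is excluded, and impossible by [prim_no_factor] otherwise. *)
Lemma left_indep p q a b n r s : (0 < p <= q)%N -> prim a -> prim b ->
  homogen p a -> homogen q b -> a != 0 -> b != 0 -> (forall c, b <> c *: a) ->
  homogen (n + (q - p)) r -> homogen n s -> r * a + s * b = 0 -> r = 0 /\ s = 0.
Proof.
move=> /andP[p0 lepq] aP bP ha hb a0 b0 ba.
elim: n r s => [|n IH] r s hr hs E; last first.
  have r0 : r [::] = 0 by apply: hr; rewrite addSn.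
  have s0 : s [::] = 0 by apply: hs.
  have X x : strip x r = 0 /\ strip x s = 0.
    apply: IH; [exact: homogen_strip|exact: homogen_strip|].
    by have := congr1 (strip x) E; rewrite stripD !stripM r0 s0 !scale0r !addr0.
  split; apply/funext => -[|x w] //;
    first exact: (congr1 (fun m : ncs K => m w) (proj1 (X x))).
  exact: (congr1 (fun m : ncs K => m w) (proj2 (X x))).
have s00 : s [::] = 0.
  case: (eqVneq (s [::]) 0) => // sn0; exfalso.
  have Eb : b = (- (s [::])^-1 *: r) * a.
    have {}E : s [::] *: b = - (r * a).
      apply/eqP; rewrite -addr_eq0 addrC -E; apply/eqP; congr (_ + _).
      by rewrite [in RHS](homogen_scalar hs) -scalerAl mul1r.
    by rewrite -scalerAl scaleNr -scalerN -E scalerA mulVf // scale1r.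
  case: (ltngtP p q) lepq => // [ltpq|eqpq] _.
    have [z zp az] := homogen_nz ha a0.
    case/eqP: b0; apply: (prim_no_factor aP ha p0 zp az bP hb ltpq _ Eb).
    by apply: homogen_degb; apply: homogenZ hr.
  rewrite -eqpq subnn addn0 in hr.
  apply: (ba (- (s [::])^-1 * r [::])).
  by rewrite {1}Eb {1}(homogen_scalar hr) scalerA -scalerAl mul1r.
have s0 : s = 0 by rewrite (homogen_scalar hs) s00 scale0r.
by split=> //; apply: (mul_homog_eq0 ha a0); rewrite s0 mul0r addr0 in E.
Qed.

End LeftIndependence.

(** * Operators with independent leading forms *)
Lemma prim_tops (R : comNzRingType) d (a s : ncs R) :
  (0 < d)%N -> tops d a s -> prim a -> prim s.
Proof.
move=> d0 [hs es] [_ aP]; split=> [|x z y w]; first by apply: hs => /= e; lia.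
case: (eqVneq (size (x :: z) + size (y :: w))%N d) => [e|ne]; last first.
  by apply: cop_local => v sv; apply: hs; rewrite sv; apply/eqP.
rewrite -[RHS](aP x z y w); apply/eqP; rewrite -subr_eq0 -ncsN -ncsE.
rewrite addrC -scaleN1r -cop_linear; apply/eqP; apply: cop_local => v sv.
by rewrite ncsE ncsZ es ?mulN1r ?addNr // sv e.
Qed.

Section Operators.
Variable K : fieldType.

Definition is_deriv (d : K -> K) : Prop :=
  (forall u v, d (u + v) = d u + d v) /\
  (forall u v, d (u * v) = u * d v + v * d u).

Lemma is_deriv0 d : is_deriv d -> d 0 = 0.
Proof. by move=> [dD _]; apply: (addrI (d 0)); rewrite -dD !addr0. Qed.

Lemma is_deriv1 d : is_deriv d -> d 1 = 0.
Proof.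
move=> [_ dM]; apply: (addrI (d 1)); rewrite addr0.
by have := dM 1 1; rewrite !mul1r => <-.
Qed.

Lemma is_deriv_lin d c d' : is_deriv d -> is_deriv d' ->
  is_deriv (fun u => c * d u + d' u).
Proof.
move=> [dD dM] [dD' dM']; split=> u v.
  by rewrite dD dD' mulrDr addrACA.
by rewrite dM dM'; ring.
Qed.

(** The derivation [d] acts on coefficients. If [a] has positive degree, the first
    summand does not affect the leading form, so that [twist d a] behaves like
    multiplication by the leading form of [a]. *)
Definition twist (d : K -> K) (a m : ncs K) : ncs K :=
  ((fun w => d (m w)) : ncs K) + a * m.

Lemma twistE d a m w : twist d a m w = d (m w) + (a * m) w. Proof. by []. Qed.

Lemma twistD d a m n : is_deriv d ->
  twist d a (m + n) = twist d a m + twist d a n.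
Proof.
move=> [dD _]; apply/funext => w; rewrite ncsE !twistE ncsE dD mulrDr ncsE.
by rewrite addrACA.
Qed.

Lemma twistZ d a c m : is_deriv d ->
  twist d a (c *: m) = d c *: m + c *: twist d a m.
Proof.
move=> [_ dM]; apply/funext => w; rewrite ncsE !ncsZ !twistE ncsZ dM -scalerAr.
by rewrite ncsZ mulrDr addrA [d c * _]mulrC [_ + m w * _]addrC.
Qed.

Lemma twist1 d a : is_deriv d -> twist d a 1 = a.
Proof.
move=> dP; apply/funext => w; rewrite twistE mulr1 ncs1.
by case: eqP => _; rewrite ?(is_deriv1 dP) ?(is_deriv0 dP) add0r.
Qed.

Lemma twist_tops d a p s e m t : is_deriv d -> (0 < p)%N -> tops p a s ->
  tops e m t -> tops (p + e) (twist d a m) (s * t).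
Proof.
move=> dP p0 ha hm; rewrite -[s * t]add0r; apply: topsD; last exact: tops_mul.
apply: (@tops_lt _ e.+1); last by rewrite -add1n leq_add2r.
by move=> w le; rewrite (tops_degb hm) ?(is_deriv0 dP).
Qed.

Definition twist_closed (d1 d2 : K -> K) (a1 a2 : ncs K) (S : ncs K -> Prop) :=
  [/\ S a1, S a2, forall c m n, S m -> S n -> S (c *: m + n),
      forall m, S m -> S (twist d1 a1 m) & forall m, S m -> S (twist d2 a2 m)].

Definition twist_span d1 d2 a1 a2 m : Prop :=
  forall S, twist_closed d1 d2 a1 a2 S -> S m.

Section Symbols.
Hypothesis char0 : [pchar K] =i pred0.
Variables (d1 d2 : K -> K) (a1 a2 s1 s2 : ncs K) (p1 p2 : nat).
Hypotheses (dP1 : is_deriv d1) (dP2 : is_deriv d2).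
Hypotheses (aP1 : prim a1) (aP2 : prim a2).
Hypotheses (hs1 : tops p1 a1 s1) (hs2 : tops p2 a2 s2).
Hypotheses (s1n0 : s1 != 0) (s2n0 : s2 != 0) (s12 : forall c, s2 <> c *: s1).
Hypotheses (p10 : (0 < p1)%N) (p12 : (p1 <= p2)%N).

Local Notation K1 := (twist d1 a1).
Local Notation K2 := (twist d2 a2).

(** The operators [sum c_w K_w] over words [w] in [K1] and [K2] with coefficients
    in [K], decomposed along the last letter of the words. They can be computed
    with without a normal form because [K_i (c m) = c (K_i m) + d_i(c) m]. *)
Inductive opr : (ncs K -> ncs K) -> Prop :=
| opr0 : opr (fun=> 0)
| oprS c P Q : opr P -> opr Q -> opr (fun m => c *: m + (P (K1 m) + Q (K2 m))).

(** [P] raises degrees by at most [d], and multiplies forms of top degree by [r]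
    on the left. *)
Definition has_symbol (P : ncs K -> ncs K) d (r : ncs K) := homogen d r /\
  forall e m t, tops e m t -> tops (d + e) (P m) (r * t).

Lemma symbol_lt P d d' r : (d < d')%N -> has_symbol P d r -> has_symbol P d' 0.
Proof.
move=> lt [_ h]; split=> // e m t /h /tops_degb hd; rewrite mul0r.
by apply: tops_lt hd _; rewrite ltn_add2r.
Qed.

Lemma symbol_add P Q d r t : has_symbol P d r -> has_symbol Q d t ->
  has_symbol (fun m => P m + Q m) d (r + t).
Proof.
move=> [hr hP] [ht hQ]; split=> [|e m u hm].
  by have := homogen_lin 1 hr ht; rewrite scale1r.
by rewrite mulrDl; apply: topsD; [exact: hP|exact: hQ].
Qed.

Lemma symbol_zero P d : (forall m, P m = 0) -> has_symbol P d 0.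
Proof. by move=> P0; split=> // e m t _; rewrite P0 mul0r;
  apply: (@tops_lt _ 0). Qed.

Lemma symbol_twist P d p a s f r : is_deriv f -> (0 < p)%N -> tops p a s ->
  has_symbol P d r -> has_symbol (fun m => P (twist f a m)) (d + p) (r * s).
Proof.
move=> fP p0 ha [hr hP]; split=> [|e m t hm].
  by apply: homogen_mul => //; case: ha.
by rewrite -addnA -mulrA; apply: hP; exact: twist_tops.
Qed.

Lemma symbol_id c : has_symbol (fun m => c *: m) 0 (c *: 1).
Proof.
split=> [[|x w] // _|e m t hm]; first by rewrite ncsZ ncs1 mulr0.
rewrite add0n -scalerAl mul1r -[c *: m]addr0 -[c *: t]addr0.
by apply: tops_lin => //; split.
Qed.

(** The last clause is what remains visible in degree 1 when [a2] has degree
    larger than 1: only scalar multiples of the leading form of [a1]. *)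
Definition nonzero_symbol P D t :=
  [/\ t != 0, has_symbol P D t & D = 1 -> (1 < p2)%N -> exists c, t = c *: s1].

Lemma mul_top_neq0 p (s r : ncs K) : homogen p s -> s != 0 -> r != 0 ->
  r * s != 0.
Proof. by move=> hs s0; apply: contra_neq; apply: (mul_homog_eq0 hs). Qed.

(** The symbols of [P \o K1] and [Q \o K2] are [r * s1] and [r' * s2]; they cannot
    cancel each other because [s1] and [s2] are left independent. *)
Lemma combine_symbol P Q :
  (forall m, P m = 0) \/ (exists d r, r != 0 /\ has_symbol P d r) ->
  (forall m, Q m = 0) \/ (exists d r, r != 0 /\ has_symbol Q d r) ->
  (forall m, P (K1 m) + Q (K2 m) = 0) \/
  exists D t, (0 < D)%N /\ nonzero_symbol (fun m => P (K1 m) + Q (K2 m)) D t.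
Proof.
have h1 := proj1 hs1; have h2 := proj1 hs2; have p20 := leq_trans p10 p12.
have scal d r : homogen d r -> d = 0%N -> exists c, r * s1 = c *: s1.
  move=> hr d0; rewrite d0 in hr; exists (r [::]).
  by rewrite {1}(homogen_scalar hr) -scalerAl mul1r.
case=> [P0|[d [r [r0 sP]]]].
  case=> [Q0|[d' [r' [r'0 sQ]]]]; first by left=> m; rewrite P0 Q0 addr0.
  right; exists (d' + p2)%N, (r' * s2); split; first by lia.
  split; [exact: mul_top_neq0 h2 _ _| |by lia].
  rewrite -[r' * s2]add0r; apply: symbol_add; first by apply: symbol_zero.
  exact: symbol_twist.
have sP' := symbol_twist dP1 p10 hs1 sP.
have D1 : d + p1 = 1 -> exists c, r * s1 = c *: s1.
  by move=> e; apply: scal (proj1 sP) _; lia.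
case=> [Q0|[d' [r' [r'0 sQ]]]].
  right; exists (d + p1)%N, (r * s1); split; first by lia.
  split=> [| |/D1 //]; first exact: mul_top_neq0 h1 _ _.
  by rewrite -[r * s1]addr0; apply: symbol_add => //; apply: symbol_zero.
have sQ' := symbol_twist dP2 p20 hs2 sQ.
right; case: (ltngtP (d + p1) (d' + p2)) => [lt|lt|e].
- exists (d' + p2)%N, (r' * s2); split; first by lia.
  split; [exact: mul_top_neq0 h2 _ _| |by lia].
  by rewrite -[r' * s2]add0r; apply: symbol_add => //; exact: symbol_lt sP'.
- exists (d + p1)%N, (r * s1); split; first by lia.
  split=> [| |/D1 //]; first exact: mul_top_neq0 h1 _ _.
  by rewrite -[r * s1]addr0; apply: symbol_add => //; exact: symbol_lt sQ'.
exists (d' + p2)%N, (r * s1 + r' * s2); split; first by lia.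
rewrite e in sP'; split; [|exact: symbol_add|by lia].
apply: contraNN r'0 => /eqP E; apply/eqP.
apply: (proj2 (@left_indep _ char0 p1 p2 s1 s2 d' r r' _ _ _ _ _ _ _ _ _ _ E))
  => //.
- by rewrite p10.
- exact: prim_tops hs1 aP1.
- exact: prim_tops hs2 aP2.
- by move=> w ne; apply: (proj1 sP) => eq; apply: ne; lia.
- exact: (proj1 sQ).
Qed.

Lemma opr_symbol P : opr P ->
  (forall m, P m = 0) \/ exists D t, nonzero_symbol P D t.
Proof.
have weak Q : (forall m, Q m = 0) \/ (exists D t, nonzero_symbol Q D t) ->
    (forall m, Q m = 0) \/ (exists d r, r != 0 /\ has_symbol Q d r).
  by case=> [|[D [t []]]]; [left|right; exists D, t].
elim=> [|c Q1 Q2 _ /weak IH1 _ /weak IH2]; first by left.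
case: (combine_symbol IH1 IH2) => [Q0|[D [t [D0 [t0 st ht]]]]]; last first.
  right; exists D, t; split=> //; rewrite -[t]add0r; apply: symbol_add => //.
  exact: symbol_lt (symbol_id c).
case: (eqVneq c 0) => [-> |c0]; first by left=> m; rewrite Q0 scale0r addr0.
right; exists 0%N, (c *: 1); split=> //.
  by rewrite scaler_eq0 (negbTE c0) oner_eq0.
by rewrite -[c *: 1]addr0; apply: symbol_add;
  [exact: symbol_id|exact: symbol_zero].
Qed.

Lemma opr_lin c P Q : opr P -> opr Q -> opr (fun m => c *: P m + Q m).
Proof.
move=> oP; elim: oP Q => [|e P1 P2 _ IH1 _ IH2] Q oQ.
  by rewrite (_ : (fun m => _) = Q) //; apply/funext => m;
    rewrite scaler0 add0r.
case: oQ => [|f Q1 Q2 o1 o2].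
  rewrite (_ : (fun m => _) = (fun m => (c * e) *: m +
    ((fun n => c *: P1 n + 0) (K1 m) + (fun n => c *: P2 n + 0) (K2 m)))).
    exact: (oprS _ (IH1 _ opr0) (IH2 _ opr0)).
  by apply/funext => m; rewrite !addr0 !scalerDr scalerA.
rewrite (_ : (fun m => _) = (fun m => (c * e + f) *: m +
    ((fun n => c *: P1 n + Q1 n) (K1 m) + (fun n => c *: P2 n + Q2 n) (K2 m)))).
  exact: (oprS _ (IH1 _ o1) (IH2 _ o2)).
apply/funext => m; rewrite !scalerDr scalerDl scalerA addrACA.
by congr (_ + _); rewrite addrACA.
Qed.

Lemma opr_id : opr (fun m => m).
Proof.
have := oprS 1 opr0 opr0; congr opr.
by apply/funext => m; rewrite scale1r !addr0.
Qed.

Lemma opr_K1 : opr K1.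
Proof.
have := oprS 0 opr_id opr0; congr opr.
by apply/funext => m; rewrite scale0r add0r addr0.
Qed.

Lemma opr_K2 : opr K2.
Proof.
have := oprS 0 opr0 opr_id; congr opr.
by apply/funext => m; rewrite scale0r !add0r.
Qed.

Lemma opr_comp d a P : is_deriv d -> opr (twist d a) -> opr P ->
  opr (fun m => twist d a (P m)).
Proof.
move=> dP oK; elim=> [|c P1 P2 _ IH1 _ IH2].
  rewrite (_ : (fun m => _) = (fun=> 0)); first exact: opr0.
  by apply/funext => m;
    rewrite -(scale0r 0) twistZ // (is_deriv0 dP) !scale0r addr0.
have o1 := oprS (d c) IH1 IH2; have := opr_lin c oK o1; congr opr.
apply/funext => m; rewrite !twistD // twistZ //.
by rewrite addrCA [RHS]/= -[RHS]addrA.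
Qed.

Lemma twist_span_opr m : twist_span d1 d2 a1 a2 m -> exists2 P, opr P & m = P 1.
Proof.
move=> h; apply: (h (fun m => exists2 P, opr P & m = P 1)); split.
- by exists K1; [exact: opr_K1|rewrite twist1].
- by exists K2; [exact: opr_K2|rewrite twist1].
- move=> c _ _ [P oP ->] [Q oQ ->].
  by exists (fun m => c *: P m + Q m); [exact: opr_lin|].
- move=> _ [P oP ->]; exists (fun m => K1 (P m)) => //.
  by apply: opr_comp => //; exact: opr_K1.
- move=> _ [P oP ->]; exists (fun m => K2 (P m)) => //.
  by apply: opr_comp => //; exact: opr_K2.
Qed.

(** The span consists of the values at 1 of operators in [opr]. If [p2 > 1] then
    such a value, when it is homogeneous of degree 1, is a multiple of [s1] by
    [opr_symbol], and the two letters are not multiples of one series. *)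
Lemma twist_span_letters : (forall x, twist_span d1 d2 a1 a2 (letter K x)) ->
  p2 = 1%N.
Proof.
move=> span; apply/eqP; rewrite eqn_leq (leq_trans p10 p12) andbT leqNgt.
apply/negP => lt1.
have X x : exists c, c *: s1 = letter K x.
  have [P oP EX] := twist_span_opr (span x).
  have lx : letter K x != 0.
    apply/eqP => /(congr1 (fun m : ncs K => m [:: x])); rewrite /letter eqxx.
    by apply/eqP; exact: oner_neq0.
  case: (opr_symbol oP) => [P0|[D [t [t0 [ht st] hD]]]].
    by rewrite EX P0 eqxx in lx.
  have [_ E] : tops (D + 0) (letter K x) (t * 1).
    by rewrite EX; apply: st; split=> // -[|? ?].
  rewrite addn0 mulr1 in E; have [w sw tw] := homogen_nz ht t0.
  have D1 : (D <= 1)%N.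
    rewrite leqNgt; apply: contraNN tw => ltD; rewrite -E ?sw // /letter.
    by case: (w =P [:: x]) sw => [-> sD|]; [rewrite -sD in ltD|rewrite eqxx].
  have D1' : D = 1%N.
    apply/eqP; rewrite eqn_leq D1 lt0n; apply: contraNN lx => /eqP D0.
    apply/eqP/funext => -[|y v] //.
    by rewrite E ?D0 // ht // D0.
  have [c Ec] := hD D1' lt1; exists c; rewrite -Ec; apply/funext => v.
  case: (leqP D (size v)) => [/E //|ltv].
  by rewrite ht /letter; [case: eqP ltv => // ->; rewrite D1'|lia].
have [c Ec] := X true; have [c' Ec'] := X false.
have := congr1 (fun m : ncs K => m [:: true]) Ec.
have := congr1 (fun m : ncs K => m [:: false]) Ec.
have := congr1 (fun m : ncs K => m [:: false]) Ec'.
rewrite !ncsZ /letter /= => E1 E2 E3.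
have c0 : c != 0.
  by apply/eqP => c0; move/eqP: E3; rewrite c0 mul0r eq_sym oner_eq0.
move/eqP: E2; rewrite mulf_eq0 (negbTE c0) /= => /eqP s0.
by move/eqP: E1; rewrite s0 mulr0 eq_sym oner_eq0.
Qed.

End Symbols.
End Operators.

Section Reduction.
Variable K : fieldType.
Hypothesis char0 : [pchar K] =i pred0.
Implicit Types (a s m : ncs K) (d : K -> K).

Lemma ex_tops N a : degb N a -> a != 0 -> exists p s,
  [/\ tops p a s, s != 0 & (p < N)%N].
Proof.
elim: N => [|N IH] aN a0.
  by case/eqP: a0; apply/funext => w; exact: aN.
pose s : ncs K := fun w => if size w == N then a w else 0.
have h : tops N a s := degb_tops aN.
case: (eqVneq s 0) => [s0|sn0]; last by exists N, s.
have [|//|p [s' [? ? ?]]] := IH; last by exists p, s'; split=> //; lia.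
by move=> w le; case: h => _ ->; rewrite // s0.
Qed.

Lemma prim_tops_gt0 p a s : prim a -> tops p a s -> s != 0 -> (0 < p)%N.
Proof.
move=> [a0 _] [hs es] s0; rewrite lt0n; apply: contraNN s0 => /eqP p0.
apply/eqP/funext => -[|x w]; last by rewrite hs // p0.
by rewrite -es ?p0 // a0.
Qed.

Lemma twist_lin d d' a a' c m : is_deriv d -> is_deriv d' ->
  twist (fun u => c * d u + d' u) (c *: a + a') m =
  c *: twist d a m + twist d' a' m.
Proof.
move=> dP dP'; apply/funext => w; rewrite ncsE ncsZ !twistE mulrDl -scalerAl.
by rewrite ncsE ncsZ; ring.
Qed.

Lemma twist_span_swap d1 d2 a1 a2 m :
  twist_span d1 d2 a1 a2 m -> twist_span d2 d1 a2 a1 m.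
Proof. by move=> h S [? ? ? ? ?]; apply: h; split. Qed.

Lemma twist_span_change c d1 d2 a1 a2 m : is_deriv d1 -> is_deriv d2 ->
  twist_span d1 d2 a1 a2 m ->
  twist_span (fun u => c * d1 u + d2 u) d1 (c *: a1 + a2) a1 m.
Proof.
move=> dP1 dP2 h S [S2 S1 lin K2 K1]; apply: h; split=> // [|n Sn].
  rewrite (_ : a2 = - c *: a1 + (c *: a1 + a2)); first exact: lin.
  by rewrite scaleNr addKr.
have := lin (- c) _ _ (K1 n Sn) (K2 n Sn).
by rewrite twist_lin // scaleNr addKr.
Qed.

(** If the leading forms of [a1] and [a2] are proportional, [a2] is replaced by
    [a2 - c a1], and [d2] accordingly, which lowers its degree and preserves the
    span; then the leading forms have different degrees, so that they are not
    proportional any more. In that case [twist_span_letters] bounds the old degree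
    by 1, which the lower degree of the new element contradicts. *)
Lemma twist_span_degree N d1 d2 a1 a2 : is_deriv d1 -> is_deriv d2 ->
  prim a1 -> prim a2 -> degb N a1 -> degb N a2 ->
  (forall c c', c *: a1 + c' *: a2 = 0 -> c = 0 /\ c' = 0) ->
  (forall x, twist_span d1 d2 a1 a2 (letter K x)) ->
  degb 2 a1 /\ degb 2 a2.
Proof.
move=> dP1 dP2 aP1 aP2 b1 b2 ind.
have a10 : a1 != 0.
  apply/eqP => e; have [|/eqP] := ind 1 0; last by rewrite oner_eq0.
  by rewrite e scale0r scaler0 addr0.
have a20 : a2 != 0.
  apply/eqP => e; have [|_ /eqP] := ind 0 1; last by rewrite oner_eq0.
  by rewrite e scale0r scaler0 addr0.
have [p1 [s1 [t1 n1 _]]] := ex_tops b1 a10.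
have [p2 [s2 [t2 n2 _]]] := ex_tops b2 a20.
wlog le : d1 d2 a1 a2 p1 p2 s1 s2 dP1 dP2 aP1 aP2 b1 b2 ind a10 a20
    t1 n1 t2 n2 / (p1 <= p2)%N.
  move=> W; case: (leqP p1 p2) => [le|/ltnW le] span.
    exact: (W d1 d2 a1 a2 p1 p2 s1 s2).
  apply/and_comm; apply: (W d2 d1 a2 a1 p2 p1 s2 s1) => //; last first.
    by move=> x; exact: twist_span_swap.
  by move=> c c'; rewrite addrC => /ind[].
have p10 := prim_tops_gt0 aP1 t1 n1.
move=> span; have [[c Ec]|nex] := pselect (exists c, s2 = c *: s1); last first.
  (* Independent leading forms: the pair is already in good position. *)
  have p21 : p2 = 1%N.
    apply: (twist_span_letters char0 dP1 dP2 aP1 aP2 t1 t2) => //.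
    by move=> c Ec; apply: nex; exists c.
  split; last by rewrite p21 in t2; exact: tops_degb t2.
  by apply: degbW (tops_degb t1); lia.
have ep : p1 = p2.
  have [z sz] := homogen_nz (proj1 t2) n2; rewrite Ec ncsZ mulf_eq0 => nz.
  apply/eqP; rewrite -sz eq_sym; apply: contraNT nz => /eqP ne.
  by rewrite (proj1 t1) // eqxx orbT.
subst p2; set a' := - c *: a1 + a2.
have a'0 : a' != 0.
  by apply/eqP => e; have [|_ /eqP] := ind (- c) 1; rewrite ?scale1r ?oner_eq0.
have b' : degb p1 a'.
  move=> w lew; have [_ E] := tops_lin (- c) t1 t2.
  by rewrite /a' E // ncsE ncsZ Ec ncsZ mulNr addNr.
have [p' [s' [t' n' lt]]] := ex_tops b' a'0.
have aP' : prim a' by exact: prim_lin.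
have p'0 := prim_tops_gt0 aP' t' n'.
(* Primitive elements have positive degree, so [p' < p1 = 1] is impossible. *)
suff p11 : p1 = 1%N by lia.
apply: (@twist_span_letters K char0 (fun u => - c * d1 u + d2 u) d1
  a' a1 s' s1 p' p1) => //.
- exact: is_deriv_lin dP1 dP2.
- move=> e Ee; move/eqP: n1; apply; apply/funext => w.
  case: (eqVneq (size w) p1) => [sw|/eqP ne]; last by rewrite (proj1 t1).
  by rewrite Ee ncsZ (proj1 t') ?mulr0 // sw; lia.
- by lia.
- by move=> x; exact: twist_span_change.
Qed.

End Reduction.

(** * The polynomial algebra and its field of fractions *)
Lemma cmonom_ind (P : {cmonom nat} -> Prop) : P mone ->
  (forall i m, P m -> P (mmul (ucm i) m)) -> forall m, P m.
Proof.
move=> P1 PU m; have [n] := ubnP (monalg.mdeg m); elim: n m => // n IH m lt.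
have [->//|] := eqVneq m mone.
rewrite -monalg.mdeg_eq0 monalg.mdegE => m0.
have [i im] : exists i, i \in finsupp m.
  apply/fset0Pn; apply: contraNN m0 => /eqP ->.
  by rewrite big_seq_fset0.
have Em : m = mmul (ucm i) (divcm m (ucm i)).
  apply/eqP/cmP => j; rewrite cmM cmU divcmE cmU.
  by case: eqP => [<-|]; rewrite ?subn0 // subnKC // lt0n cmE_neq0.
rewrite Em; apply/PU/IH; move: lt.
by rewrite {1}Em monalg.mdegM monalg.mdegU add1n ltnS.
Qed.

Section Eval.
Variables (k : fieldType) (S : comNzRingType) (f : {rmorphism k -> S}).
Variable c : nat -> S.

Definition cm_eval (m : {cmonom nat}) : S := \prod_(i <- finsupp m) c i ^+ m i.

Lemma cm_evalEw (d : {fset nat}) (m : {cmonom nat}) : (finsupp m `<=` d)%fset ->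
  cm_eval m = \prod_(i <- d) c i ^+ m i.
Proof.
move=> le; rewrite /cm_eval (big_fset_incl _ le) // => i _.
by rewrite -cmE_eq0 => /eqP ->.
Qed.

Fact cm_eval_mmorphism : monalg.mmorphism cm_eval.
Proof.
split=> [m n|]; last by rewrite /cm_eval mdom1 big_seq_fset0.
rewrite (@cm_evalEw (finsupp m `|` finsupp n)%fset (mmul m n)) ?mdomD //.
rewrite (cm_evalEw (fsubsetUl (finsupp m) (finsupp n))).
rewrite (cm_evalEw (fsubsetUr (finsupp m) (finsupp n))) -big_split /=.
by apply: eq_bigr => i _; rewrite cmM exprD.
Qed.

HB.instance Definition _ :=
  monalg.isMultiplicative.Build {cmonom nat} S cm_eval cm_eval_mmorphism.

Lemma cm_evalU i : cm_eval (ucm i) = c i.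
Proof. by rewrite /cm_eval mdomU big_seq_fset1 cmUU expr1. Qed.

Lemma exists_polyN_eval : exists ev : {rmorphism polyN k -> S},
  (forall a : k, ev a%:A = f a) /\ forall i, ev << ucm i >> = c i.
Proof.
exists (monalg.mmap f cm_eval : {rmorphism {malg k[{cmonom nat}]} -> S}).
split=> [a|i].
  rewrite -[RHS]mulr1 -[X in _ * X](@monalg.mmap1 _ _ _ f cm_eval).
  exact: monalg.mmapZ.
rewrite /= mmapU cm_evalU -[RHS]mul1r; congr (_ * _); exact: (rmorph1 f).
Qed.

End Eval.

Section Monomials.
Variable k : fieldType.
Local Notation A := {malg k[{cmonom nat}]}.

Lemma malg_monE (a : k) (m : {cmonom nat}) : << a *g m >> = a%:A * << m >> :> A.
Proof.
rewrite -scalerAl mul1r; apply/monalg.malgP => m'.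
rewrite monalg.mcoeffU. rewrite [RHS]monalg.mcoeffZ. rewrite monalg.mcoeffU.
  by rewrite mulr_natr.
Qed.

Lemma malg_monM (m n : {cmonom nat}) : << mmul m n >> = << m >> * << n >> :> A.
Proof. by rewrite monalg.malgM_def monalg.fgmulUU mulr1. Qed.

Lemma malg_mon1 : << mone >> = 1%:A :> A.
Proof. by rewrite scale1r. Qed.

End Monomials.

Lemma polyN_ind (k : fieldType) (P : polyN k -> Prop) :
  (forall a : k, P a%:A) -> (forall p q, P p -> P q -> P (p + q)) ->
  (forall p q, P p -> P q -> P (p * q)) -> (forall i, P << ucm i >>) ->
  forall p, P p.
Proof.
move=> PC PD PM PU p.
have P0 : P 0 by have := PC 0; rewrite scale0r.
have E1 : << mone >> = 1%:A :> polyN k := malg_mon1 k.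
have EM m n : << mmul m n >> = << m >> * << n >> :> polyN k := malg_monM k m n.
have EC a m : << a *g m >> = a%:A * << m >> :> polyN k := malg_monE a m.
have PX (m : {cmonom nat}) : P << m >>.
  elim/cmonom_ind: m => [|i m IH]; first by rewrite E1; exact: PC.
  rewrite EM. exact: (PM _ _ (PU i) IH).
rewrite [p]monalg.monalgE; apply: (big_ind P) => // m _.
rewrite EC. exact: (PM _ _ (PC _) (PX _)).
Qed.

Lemma fraction_quot (R : idomainType) (f : {fraction R}) : exists p q : R,
  q != 0 /\ f = tofrac p / tofrac q.
Proof.
elim/quotW: f => x; exists \n_x, \d_x.
have d0 := denom_ratioP x; split=> //.
apply: (canRL (mulfK _)); first by rewrite tofrac_eq0.
unlock FracField.tofrac; rewrite -[LHS]FracField.pi_mul.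
apply/eqmodP => /=; rewrite FracField.equivfE /FracField.mulf.
by rewrite !numden_Ratio ?mulr1 ?mul1r ?oner_neq0 // mulrC.
Qed.

(** The field of fractions of the polynomial algebra, known only through its
    characteristic properties: the arguments never look inside a fraction. *)
Record poly_fractions (k : fieldType) := PolyFractions {
  pf_field :> fieldAlgType k;
  pf_frac : {rmorphism polyN k -> pf_field};
  pf_var : nat -> pf_field;
  pf_varE : forall i, pf_frac << ucm i >> = pf_var i;
  pf_C : forall a : k, pf_frac a%:A = a%:A;
  pf_eq0 : forall p, (pf_frac p == 0) = (p == 0);
  pf_quot : forall f, exists p q, pf_frac q != 0 /\ f = pf_frac p / pf_frac q
}.

Section FracN.
Variable k : fieldType.

Lemma polyN_frac_eq0 (p : polyN k) : (polyN_frac p == 0) = (p == 0).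
Proof. by rewrite unlock tofrac_eq0. Qed.

Lemma fracN_quot (f : fracN k) : exists p q : polyN k,
  polyN_frac q != 0 /\ f = polyN_frac p / polyN_frac q.
Proof.
have [p [q [q0 ->]]] := fraction_quot f.
by exists p, q; rewrite polyN_frac_eq0 unlock.
Qed.

Lemma polyN_fracC a : polyN_frac (a%:A : polyN k) = a%:A .
Proof. by rewrite -[LHS]mulr1. Qed.

Definition fracN_fractions : poly_fractions k :=
  @PolyFractions k (fracN k) (@polyN_frac k) (@fracN_var k) (fun=> erefl)
    polyN_fracC polyN_frac_eq0 fracN_quot.

End FracN.

Section Fractions.
Variables (k : fieldType) (F : poly_fractions k).
Local Notation var := (pf_var F).
Local Notation frac := (pf_frac F).

Lemma frac_ind (P : F -> Prop) : (forall a : k, P a%:A) ->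
  (forall u v, P u -> P v -> P (u + v)) ->
  (forall u v, P u -> P v -> P (u * v)) -> (forall u, P u -> P u^-1) ->
  (forall i, P (var i)) -> forall f, P f.
Proof.
move=> PC PD PM PV PU f.
have PF p : P (frac p).
  elim/polyN_ind: p => [a|p q|p q|i]; first by rewrite pf_C.
  - by rewrite rmorphD; exact: PD.
  - by rewrite rmorphM; exact: PM.
  - by rewrite pf_varE; exact: PU.
by have [p [q [_ ->]]] := pf_quot f; apply: PM => //; exact: PV.
Qed.

End Fractions.

(** * Extending derivations and morphisms to fractions *)
Section ExtendDerivation.
Variables (A : comNzRingType) (L : fieldType) (i : {rmorphism A -> L}).
Hypothesis iquot : forall f, exists p q, i q != 0 /\ f = i p / i q.
Variable D0 : A -> L.
Hypothesis D0M : forall p q, D0 (p * q) = i p * D0 q + i q * D0 p.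
Hypothesis D0D : forall p q, D0 (p + q) = D0 p + D0 q.
Hypothesis D0i : forall p q, i p = i q -> D0 p = D0 q.

(** The quotient rule. For [f = p / q] the equation
    [D f * q = D0 p - f * D0 q] does not depend on the choice of [p] and [q]. *)
Lemma extend_deriv : exists D, is_deriv D /\ forall p, D (i p) = D0 p.
Proof.
pose quo f p q := i q != 0 /\ f = i p / i q.
have /choice[D DP] f : exists d, exists p q,
    quo f p q /\ d = (D0 p - f * D0 q) / i q.
  by have [p [q h]] := iquot f; exists ((D0 p - f * D0 q) / i q), p, q.
have DE f p q : i q != 0 -> f * i q = i p -> D f * i q = D0 p - f * D0 q.
  move=> q0 fq; have [p' [q' [[q'0 fE] ->]]] := DP f.
  have fq' : f * i q' = i p' by rewrite fE mulfVK.
  have := D0i (p := p * q') (q := p' * q).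
  rewrite !rmorphM -fq -fq' mulrAC => /(_ erefl).
  rewrite !D0M -fq -fq' => E.
  apply: (mulIf q'0); rewrite mulrAC mulfVK //.
  have -> : (D0 p' - f * D0 q') * i q = i q * D0 p' - f * i q * D0 q' by ring.
  have -> : (D0 p - f * D0 q) * i q' = i q' * D0 p - f * i q' * D0 q by ring.
  apply/eqP; rewrite subr_eq addrAC eq_sym subr_eq [_ * D0 p + _]addrC E.
  by rewrite addrC.
have i1 : i 1 != 0 by rewrite rmorph1 oner_neq0.
have D01 : D0 1 = 0.
  apply: (addrI (D0 1)); rewrite addr0 -{3}[1]mulr1 D0M rmorph1 !mul1r //.
exists D; split; last first.
  move=> p; have := DE (i p) p 1 i1; rewrite rmorph1 !mulr1 => -> //.
  by rewrite D01 mulr0 subr0.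
split=> u v; have [p [q [q0 uE]]] := iquot u;
  have [p' [q' [q'0 vE]]] := iquot v.
  have uq : u * i q = i p by rewrite uE mulfVK.
  have vq : v * i q' = i p' by rewrite vE mulfVK.
  have qq0 : i (q * q') != 0 by rewrite rmorphM mulf_neq0.
  apply: (mulIf qq0); rewrite mulrDl (DE _ (p * q' + p' * q)) //; last first.
    by rewrite rmorphD !rmorphM -uq -vq; ring.
  rewrite rmorphM mulrA [D v * _]mulrCA [D v * _](DE _ _ _ q'0 vq).
  rewrite (DE _ _ _ q0 uq) D0D !D0M -uq -vq; ring.
have uq : u * i q = i p by rewrite uE mulfVK.
have vq : v * i q' = i p' by rewrite vE mulfVK.
have qq0 : i (q * q') != 0 by rewrite rmorphM mulf_neq0.
apply: (mulIf qq0); rewrite mulrDl (DE _ (p * p')) //; last first.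
  by rewrite !rmorphM -uq -vq; ring.
have -> : u * D v * i (q * q') = u * i q * (D v * i q') by rewrite rmorphM;
  ring.
have -> : v * D u * i (q * q') = v * i q' * (D u * i q) by rewrite rmorphM;
  ring.
rewrite (DE _ _ _ q'0 vq) (DE _ _ _ q0 uq) !D0M -uq -vq; ring.
Qed.

End ExtendDerivation.

Section HomGraph.
Variables (A : comNzRingType) (L L' : fieldType) (i : {rmorphism A -> L}).
Variable h : {rmorphism A -> L'}.
Hypothesis ih : forall p q, i p = i q -> h p = h q.

(** The graph of the extension of [h] to the fractions whose denominator is not
    killed by [h]. It is a partial function, total when [h] is injective. *)
Definition hom_graph (f : L) (f' : L') : Prop := exists p q,
  [/\ h q != 0, i q != 0, f * i q = i p & f' * h q = h p].

Lemma hom_graph_fun f f1 f2 : hom_graph f f1 -> hom_graph f f2 -> f1 = f2.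
Proof.
move=> [p [q [hq iq fq f1q]]] [p' [q' [hq' iq' fq' f2q]]].
have E : h (p * q') = h (p' * q).
  by apply: ih; rewrite !rmorphM -fq -fq'; ring.
apply: (mulIf hq); apply: (mulIf hq'); rewrite f1q mulrAC f2q.
by rewrite -!rmorphM.
Qed.

Lemma hom_graph_poly p : hom_graph (i p) (h p).
Proof. by exists p, 1; rewrite !rmorph1 !mulr1 !oner_neq0. Qed.

Lemma hom_graphD f g f' g' : hom_graph f f' -> hom_graph g g' ->
  hom_graph (f + g) (f' + g').
Proof.
move=> [p [q [hq iq fq f1q]]] [p' [q' [hq' iq' fq' f2q]]].
exists (p * q' + p' * q), (q * q'); rewrite !rmorphD !rmorphM !mulf_neq0 //.
by rewrite -fq -fq' -f1q -f2q; split=> //; ring.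
Qed.

Lemma hom_graphM f g f' g' : hom_graph f f' -> hom_graph g g' ->
  hom_graph (f * g) (f' * g').
Proof.
move=> [p [q [hq iq fq f1q]]] [p' [q' [hq' iq' fq' f2q]]].
exists (p * p'), (q * q'); rewrite !rmorphM !mulf_neq0 //.
by rewrite -fq -fq' -f1q -f2q; split=> //; ring.
Qed.

Lemma hom_graphV f f' : f' != 0 -> hom_graph f f' -> hom_graph f^-1 f'^-1.
Proof.
move=> f'0 [p [q [hq iq fq f1q]]].
have hp : h p != 0 by rewrite -f1q mulf_neq0.
have ip : i p != 0.
  apply: contraNneq hp => ip0; rewrite -(rmorph0 h); apply/eqP; apply: ih.
  by rewrite ip0 rmorph0.
have f0 : f != 0 by apply: contraNneq ip => f0; rewrite -fq f0 mul0r.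
by exists q, p; split=> //; rewrite -?fq -?f1q mulKf.
Qed.

End HomGraph.

(** * Derivations of the field of fractions *)
Section KDerivations.
Variable k : fieldType.
Variable F : poly_fractions k.
Local Notation var := (pf_var F).
Local Notation frac := (pf_frac F).

Definition kderiv (D : F -> F) : Prop := is_deriv D /\ forall a : k, D a%:A = 0.

Lemma is_derivV (D : F -> F) u : is_deriv D -> D u^-1 = - (u^-1 ^+ 2 * D u).
Proof.
move=> dD; case: (eqVneq u 0) => [->|u0].
  by rewrite invr0 (is_deriv0 dD) mulr0 oppr0.
apply: (mulfI u0); apply/eqP; rewrite -subr_eq0 mulrN opprK mulrA exprS expr1.
by rewrite mulVKf // -(proj2 dD) mulfV // (is_deriv1 dD).
Qed.

Lemma kderiv_ext D D' : kderiv D -> kderiv D' ->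
  (forall i, D (var i) = D' (var i)) -> forall f, D f = D' f.
Proof.
move=> [dD cD] [dD' cD'] E; apply: frac_ind => //.
- by move=> a; rewrite cD cD'.
- by move=> u v Eu Ev; rewrite (proj1 dD) (proj1 dD') Eu Ev.
- by move=> u v Eu Ev; rewrite (proj2 dD) (proj2 dD') Eu Ev.
- by move=> u Eu; rewrite !is_derivV // Eu.
Qed.

Lemma kderiv_zero : kderiv (fun=> 0).
Proof. by split=> //; split=> *; rewrite ?mulr0 addr0. Qed.

Lemma kderiv_lin c D D' : kderiv D -> kderiv D' ->
  kderiv (fun f => c * D f + D' f).
Proof.
move=> [dD cD] [dD' cD']; split; first exact: is_deriv_lin.
by move=> a; rewrite cD cD' mulr0 addr0.
Qed.

Lemma kderivZ D (a : k) f : kderiv D -> D (a *: f) = a *: D f.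
Proof.
move=> [[_ dM] dC]; by rewrite -mulr_algl dM dC mulr0 addr0 mulr_algl.
Qed.

Lemma kderiv_sum D (I : Type) (r : seq I) (G : I -> F) : kderiv D ->
  D (\sum_(i <- r) G i) = \sum_(i <- r) D (G i).
Proof.
move=> [dD _]; elim/big_rec2: _ => [|i u v _ <-]; first exact: is_deriv0.
by rewrite (proj1 dD).
Qed.

(** The derivation on polynomials is read off the coefficient of ['X] in the
    substitution [e_i |-> e_i + c_i 'X]. *)
Lemma exists_kderiv (c : nat -> F) :
  exists D, kderiv D /\ forall i, D (var i) = c i.
Proof.
pose f0 : {rmorphism k -> {poly F}} := polyC \o in_alg F.
have [psi [psiC psiU]] :=
  exists_polyN_eval f0 (fun i => (var i)%:P + (c i)%:P * 'X).
have {}psiC a : psi a%:A = (a%:A)%:P by rewrite psiC.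
have psi0 p : (psi p)`_0 = frac p.
  elim/polyN_ind: p => [a|p q Ep Eq|p q Ep Eq|i].
  - by rewrite psiC coefC /= pf_C.
  - by rewrite (rmorphD psi) coefD Ep Eq -(rmorphD frac).
  - by rewrite (rmorphM psi) coef0M Ep Eq -(rmorphM frac).
  - by rewrite pf_varE psiU coefD coefC coefCM coefX mulr0 addr0.
have [|||D [dD DE]] := @extend_deriv _ _ frac
    (@pf_quot k F) (fun p => (psi p)`_1).
- move=> p q; rewrite (rmorphM psi) coefM !big_ord_recl big_ord0 addr0 !psi0 /=.
  by rewrite [X in _ + X = _]mulrC.
- by move=> p q; rewrite (rmorphD psi) coefD.
- move=> p q E; congr (psi _)`_1; apply/eqP.
  by rewrite -subr_eq0 -(pf_eq0 F) rmorphB E subrr.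
exists D; split; first split=> // a.
  by rewrite -pf_C DE psiC coefC.
by move=> i; rewrite -pf_varE DE psiU coefD coefC coefCM coefX mulr1 add0r.
Qed.

Lemma exists_pderiv : exists pd : nat -> F -> F,
  forall i, kderiv (pd i) /\ forall j, pd i (var j) = (i == j)%:R.
Proof.
have /choice[pd pdP] i : exists D, kderiv D /\ forall j,
  D (var j) = (i == j)%:R.
  exact: exists_kderiv.
by exists pd.
Qed.

Definition pd : nat -> F -> F := sval (cid exists_pderiv).

Lemma pd_kderiv i : kderiv (pd i).
Proof. by rewrite /pd; case: cid => pd /= /(_ i)[]. Qed.

Lemma pd_var i j : pd i (var j) = (i == j)%:R.
Proof. by rewrite /pd; case: cid => pd /= /(_ i)[]. Qed.

(** The chain rule. The bound [n] must not depend on the derivation: it is applied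
    to all coefficients of a series at once. *)
Lemma kderiv_expand f : exists n, forall D, kderiv D -> forall n',
  (n <= n')%N ->
  D f = \sum_(i < n') pd i f * D (var i).
Proof.
elim/frac_ind: f => [a|u v [n Eu] [n' Ev]|u v [n Eu] [n' Ev]|u [n Eu]|j].
- exists 0%N => D [_ dC] n' _; rewrite dC big1 // => i _.
  by rewrite (proj2 (pd_kderiv i)) mul0r.
- exists (maxn n n') => D dD N; rewrite geq_max => /andP[le le'].
  rewrite (proj1 (proj1 dD)) (Eu D dD N) // (Ev D dD N) // -big_split /=.
  by apply: eq_bigr => i _; rewrite (proj1 (proj1 (pd_kderiv i))) mulrDl.
- exists (maxn n n') => D dD N; rewrite geq_max => /andP[le le'].
  rewrite (proj2 (proj1 dD)) (Eu D dD N) // (Ev D dD N) // !mulr_sumr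
    -big_split /=.
  apply: eq_bigr => i _.
  by rewrite (proj2 (proj1 (pd_kderiv i))) mulrDl !mulrA.
- exists n => D dD N le; rewrite (is_derivV _ (proj1 dD)) (Eu D dD N) //.
  rewrite mulr_sumr -sumrN; apply: eq_bigr => i _.
  by rewrite (is_derivV _ (proj1 (pd_kderiv i))) mulrA mulNr.
- exists j.+1 => D dD N ltN;
  rewrite (bigD1 (Ordinal ltN)) //= pd_var eqxx mul1r.
  rewrite big1 ?addr0 // => i ne;
    rewrite pd_var (_ : (_ == _) = false) ?mul0r //.
  exact: negbTE.
Qed.

Lemma gen_subfieldP (u v z : F) : z \in gen_subfield u v <->
  forall S : {pred F}, GRing.divring_closed S -> (forall a : k, a%:A \in S) ->
    u \in S -> v \in S -> z \in S.
Proof. by split=> [/asboolP|h]; last exact/asboolP. Qed.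

Lemma gen_subfield_l (u v : F) : u \in gen_subfield u v.
Proof. by apply/gen_subfieldP. Qed.

Lemma gen_subfield_r (u v : F) : v \in gen_subfield u v.
Proof. by apply/gen_subfieldP. Qed.

End KDerivations.

Lemma char0_natr_inj (K : fieldType) (m n : nat) : [pchar K] =i pred0 ->
  m%:R = n%:R :> K -> m = n.
Proof.
move=> /pcharf0P ch; wlog le : m n / (m <= n)%N.
  by move=> W E; case: (leqP m n) => [|/ltnW] le; [|symmetry]; apply: W.
move=> /eqP; rewrite eq_sym -subr_eq0 -natrB // ch subn_eq0 => ge.
by apply/eqP; rewrite eqn_leq le.
Qed.

Section Rescale.
Variable k : fieldType.
Local Notation A := {malg k[{cmonom nat}]}.
Implicit Types (q : A) (c : {cmonom nat} -> k).

(** With [c m = m i] this is the Euler operator [e_i d/de_i]. *)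
Definition rescale c q : A :=
  [malg m in monalg.msupp q => c m * monalg.mcoeff m q].

Lemma mcoeff_rescale c q m :
  monalg.mcoeff m (rescale c q) = c m * monalg.mcoeff m q.
Proof.
rewrite /rescale monalg.mcoeffE; case: ifPn => // mq.
by rewrite monalg.mcoeff_outdom // mulr0.
Qed.

End Rescale.

HB.lock Definition mon (k : fieldType) (F : poly_fractions k)
    (m : {cmonom nat}) : F :=
  pf_frac F << m >>.

Section Kernel.
Variable k : fieldType.
Hypothesis char0 : [pchar k] =i pred0.
Variable F : poly_fractions k.
Local Notation var := (pf_var F).
Local Notation frac := (pf_frac F).
Local Notation mon := (@mon k F).

Lemma char0F : [pchar F] =i pred0.
Proof.
by move=> p; rewrite -char0; exact: (fmorph_pchar (in_alg F)).
Qed.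

Lemma mon1 : mon mone = 1.
Proof. by rewrite mon.unlock; exact: (rmorph1 frac). Qed.

Lemma monU i : mon (ucm i) = var i.
Proof. by rewrite mon.unlock pf_varE. Qed.

Lemma mon_neq0 m : mon m != 0.
Proof. by rewrite mon.unlock pf_eq0 monalg.monalgU_eq0 oner_eq0. Qed.

Lemma monM m n : mon (mmul m n) = mon m * mon n.
Proof.
have E : << mmul m n >> = << m >> * << n >> :> polyN k := malg_monM k m n.
by rewrite mon.unlock E rmorphM.
Qed.

Lemma monE m : mon m = cm_eval var m.
Proof.
elim/cmonom_ind: m => [|i m IH].
  by rewrite mon1 (cm_eval_mmorphism var).2.
by rewrite monM IH (cm_eval_mmorphism var).1 cm_evalU monU.
Qed.

Lemma frac_sum (q : polyN k) :
  frac q = \sum_(m <- monalg.msupp q) (monalg.mcoeff m q) *: mon m.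
Proof.
have EC a m : << a *g m >> = a%:A * << m >> :> polyN k := malg_monE a m.
rewrite {1}[q]monalg.monalgE rmorph_sum /=; apply: eq_bigr => m _.
by rewrite EC rmorphM pf_C mulr_algl mon.unlock.
Qed.

Lemma pd_mon i m : var i * pd i (mon m) = (m i)%:R * mon m.
Proof.
have [[_ dM] dC] := pd_kderiv F i.
elim/cmonom_ind: m => [|j m IH].
  by rewrite mon1 (is_deriv1 (proj1 (pd_kderiv F i))) cm1 mulr0 mul0r.
rewrite monM monU dM pd_var cmM cmU natrD mulrDr.
rewrite [var i * (var j * _)]mulrCA IH [j == i]eq_sym.
by case: eqP => [->|_] /=; ring.
Qed.

Lemma pd_rescale i (q : polyN k) :
  var i * pd i (frac q) = frac (rescale (fun m => (m i)%:R) q).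
Proof.
rewrite [RHS]frac_sum (frac_sum q).
rewrite kderiv_sum ?mulr_sumr; last exact: pd_kderiv.
have sub : (monalg.msupp (rescale (fun m =>
  (m i)%:R) q) `<=` monalg.msupp q)%fset.
  apply/fsubsetP => m; rewrite -!monalg.mcoeff_neq0 mcoeff_rescale.
  by apply: contraNN => /eqP ->; rewrite mulr0.
rewrite [RHS](big_fset_incl _ sub) /=; last first.
  by move=> m _; rewrite -monalg.mcoeff_eq0 => /eqP ->; rewrite scale0r.
apply: eq_bigr => m _; rewrite kderivZ; last exact: pd_kderiv.
rewrite mcoeff_rescale -scalerAr pd_mon [in RHS]mulrC -scalerA.
by rewrite scaler_nat mulr_natl.
Qed.

Lemma rescaleB c (q : polyN k) i :
  frac (rescale (fun m => (m i)%:R - c) q) =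
  var i * pd i (frac q) - c *: frac q.
Proof.
rewrite pd_rescale -mulr_algl -pf_C -rmorphM -rmorphB; congr (frac _).
have EZ : c%:A * q = c *: (q : {malg k[{cmonom nat}]}) := mulr_algl c q.
rewrite EZ; apply/monalg.malgP => m.
by rewrite monalg.mcoeffB monalg.mcoeffZ !mcoeff_rescale mulrBl.
Qed.

Variables ix iy : nat.
Local Notation G := (gen_subfield (var ix) (var iy)).

Lemma mon_ratio (m n : {cmonom nat}) :
  (forall i, i != ix -> i != iy -> m i = n i) -> mon m / mon n \in G.
Proof.
move=> mn; rewrite !monE.
rewrite (cm_evalEw _ (fsubsetUl (finsupp m) (finsupp n))).
rewrite (cm_evalEw _ (fsubsetUr (finsupp m) (finsupp n))) -prodf_div.
have xG : var ix \in G := gen_subfield_l _ _.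
have yG : var iy \in G := gen_subfield_r _ _.
apply: rpred_prod => i _.
case: (eqVneq i ix) => [->|nx]; first by rewrite rpred_div ?rpredX.
case: (eqVneq i iy) => [->|ny]; first by rewrite rpred_div ?rpredX.
by rewrite mn // divff ?rpred1 // expf_neq0 // -monU mon_neq0.
Qed.

Lemma agree_ratio (q : polyN k) (m0 : {cmonom nat}) :
  (forall m, m \in monalg.msupp q ->
     forall i, i != ix -> i != iy -> m i = m0 i) ->
  frac q / mon m0 \in G.
Proof.
move=> ag; rewrite frac_sum mulr_suml big_seq.
by apply: rpred_sum => m mq; rewrite -scalerAl rpredZ // mon_ratio //;
  exact: ag.
Qed.

(** Write [f = p / q] with as few monomials as possible in [q]. As [f] is a
    constant for the Euler operators of the other variables, these operators,
    shifted by an exponent of one monomial of [q], applied to [p] and [q] give a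
    shorter denominator, unless all monomials of [q] have the same exponents in
    the other variables. Then the same holds for [p], and the common factor
    cancels. Characteristic 0 makes exponents distinguishable as scalars. *)
Lemma pd_kernel f : (forall i, i != ix -> i != iy -> pd i f = 0) -> f \in G.
Proof.
move=> fP; have [p [q [q0 fE]]] := pf_quot f.
have {}fE : f * frac q = frac p by rewrite fE mulfVK.
have [n] := ubnP #|` monalg.msupp q|; elim: n p q q0 fE => // n IH p q q0 fE lt.
have step i c : i != ix -> i != iy ->
    f * frac (rescale (fun m => (m i)%:R - c) q) =
    frac (rescale (fun m => (m i)%:R - c) p).
  move=> nx ny; rewrite !rescaleB -fE (proj2 (proj1 (pd_kderiv F i))) fP //.
  by rewrite mulr0 addr0 mulrBr scalerAr mulrCA.
case: (pselect (exists m m' i, [/\ m \in monalg.msupp q, m' \in monalg.msupp q,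
    i != ix, i != iy & m i != m' i])) => [[m [m' [i [mq m'q nx ny ne]]]]|nex].
  (* The shift by [m i] removes [m] from the denominator and keeps [m']. *)
  apply: (IH _ _ _ (step i (m i)%:R nx ny)).
    rewrite pf_eq0; apply/eqP.
    move=> /(congr1 (monalg.mcoeff m')); rewrite mcoeff_rescale monalg.mcoeff0.
    apply/eqP; rewrite mulf_neq0 ?monalg.mcoeff_neq0 //.
    apply: contraNN ne; rewrite subr_eq0 => /eqP E.
    by rewrite (char0_natr_inj char0 E).
  apply: leq_trans (_ : #|` (monalg.msupp q `\ m)%fset| < n)%N.
    apply: fsubset_leq_card; apply/fsubsetP => m2.
    rewrite !inE -!monalg.mcoeff_neq0 mcoeff_rescale mulf_eq0 negb_or.
    by case/andP => h ->; rewrite andbT; apply: contraNN h => /eqP ->;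
      rewrite subrr.
  by move: lt; rewrite (cardfsD1 m) mq add1n ltnS.
have [m0 m0q] : exists m, m \in monalg.msupp q.
  by apply/fset0Pn; rewrite monalg.msupp_eq0 -(pf_eq0 F).
have agq m : m \in monalg.msupp q ->
    forall i, i != ix -> i != iy -> m i = m0 i.
  move=> mq i nx ny; apply/eqP/negPn/negP => ne; apply: nex.
  by exists m, m0, i.
have agp m : m \in monalg.msupp p ->
    forall i, i != ix -> i != iy -> m i = m0 i.
  move=> mp i nx ny.
  have /eqP : frac (rescale (fun m => (m i)%:R - (m0 i)%:R) p) = 0.
    rewrite -step // (_ : rescale _ q = 0) ?rmorph0 ?mulr0 //.
    apply/monalg.malgP => m2; rewrite mcoeff_rescale monalg.mcoeff0.
    case: (boolP (m2 \in monalg.msupp q)) => m2q.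
      by rewrite (agq _ m2q) // subrr mul0r.
    by rewrite monalg.mcoeff_outdom // mulr0.
  rewrite pf_eq0 => /eqP /(congr1 (monalg.mcoeff m)).
  rewrite mcoeff_rescale monalg.mcoeff0 => /eqP.
  rewrite mulf_eq0 (negbTE (_ : monalg.mcoeff m p != 0)) ?monalg.mcoeff_neq0 //.
  rewrite orbF subr_eq0 => /eqP E.
  exact: (char0_natr_inj char0 E).
have -> : f = frac p / mon m0 / (frac q / mon m0).
  by rewrite -fE -[f * _ / _]mulrA mulfK // mulf_neq0 // invr_neq0 // mon_neq0.
by rewrite rpred_div // agree_ratio.
Qed.

End Kernel.

(** * The free Lie algebra inside the free associative algebra *)
Section LieBracket.
Variables (k : fieldType) (V : lmodType k) (br : V -> V -> V).
Hypothesis brP : is_lie_bracket br.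

Lemma lieDl u v w : br (u + v) w = br u w + br v w.
Proof. by have := lie_linearl brP 1 u v w; rewrite !scale1r. Qed.
Lemma lieDr u v w : br w (u + v) = br w u + br w v.
Proof. by have := lie_linearr brP 1 u v w; rewrite !scale1r. Qed.
Lemma lie0l w : br 0 w = 0.
Proof. by have := lie_linearl brP (-1) 0 0 w;
  rewrite scaler0 addr0 scaleN1r addNr. Qed.
Lemma lie0r w : br w 0 = 0.
Proof. by have := lie_linearr brP (-1) 0 0 w;
  rewrite scaler0 addr0 scaleN1r addNr. Qed.
Lemma lieZl a u w : br (a *: u) w = a *: br u w.
Proof. by have := lie_linearl brP a u 0 w; rewrite lie0l !addr0. Qed.
Lemma lieZr a u w : br w (a *: u) = a *: br w u.
Proof. by have := lie_linearr brP a u 0 w; rewrite lie0r !addr0. Qed.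
Lemma lieC u v : br u v = - br v u.
Proof.
have := lie_alt brP (u + v); rewrite lieDl !lieDr !(lie_alt brP) add0r addr0.
by move=> /eqP; rewrite addr_eq0 => /eqP.
Qed.
Lemma lie_suml (I : Type) (r : seq I) (G : I -> V) w :
  br (\sum_(i <- r) G i) w = \sum_(i <- r) br (G i) w.
Proof. by elim/big_rec2: _ => [|i u v _ <-]; rewrite ?lie0l ?lieDl. Qed.
Lemma lie_sumr (I : Type) (r : seq I) (G : I -> V) w :
  br w (\sum_(i <- r) G i) = \sum_(i <- r) br w (G i).
Proof. by elim/big_rec2: _ => [|i u v _ <-]; rewrite ?lie0r ?lieDr. Qed.
Lemma lieJ u v w : br (br u v) w = br u (br v w) - br v (br u w).
Proof.
have /eqP := lie_jacobi brP u v w; rewrite addr_eq0 => /eqP E.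
by rewrite [br (br u v) w]lieC -E [br w u]lieC -scaleN1r lieZr scaleN1r.
Qed.

End LieBracket.

Lemma commutator_lie (R : fieldType) (A : algType R) :
  is_lie_bracket (fun a b : A => a * b - b * a).
Proof.
split=> [r u v w|r u v w|u|u v w].
- by rewrite mulrDl mulrDr -scalerAl -scalerAr opprD addrACA scalerBr.
- by rewrite mulrDl mulrDr -scalerAl -scalerAr opprD addrACA scalerBr.
- by rewrite subrr.
rewrite !mulrBl !mulrBr !mulrA !opprB.
rewrite !addrA.
rewrite [LHS](ACl ((1*12)*(7*2)*(3*10)*(5*4)*(11*6)*(9*8)))/=.
by rewrite !subrr !addr0.
Qed.

Section Basis.
Variables (k : fieldType) (V : lmodType k) (e : nat -> V).
Hypothesis eP : is_linear_basis e.

Lemma basis_neq0 i : e i != 0.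
Proof.
apply/eqP => ei0; have := proj2 eP i.+1 (fun l => (l == i)%:R).
rewrite big_ord_recr /= eqxx scale1r ei0 addr0 big1 => [/(_ erefl i)|l _].
  by rewrite eqxx => /(_ (ltnSn i)) /eqP; rewrite oner_eq0.
by rewrite ltn_eqF // scale0r.
Qed.

Lemma basis_linear (W : lmodType k) (w : nat -> W) : exists L : V -> W,
  (forall a u v, L (a *: u + v) = a *: L u + L v) /\ forall i, L (e i) = w i.
Proof.
have /choice[n /choice[c cP]] v := proj1 eP v.
pose L v := \sum_(l < n v) c v l *: w l.
pose cut (f : nat -> k) m l := if (l < m)%N then f l else 0.
have ext (U : lmodType k) (z : nat -> U) (f : nat -> k) m M : (m <= M)%N ->
    \sum_(l < m) f l *: z l = \sum_(l < M) cut f m l *: z l.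
  move=> le; rewrite (big_ord_widen M (fun l => f l *: z l) le).
  rewrite big_mkcond; apply: eq_bigr => l _; rewrite /cut.
  by case: ifP => // _; rewrite scale0r.
have LE v N (d : nat -> k) : v = \sum_(l < N) d l *: e l ->
    L v = \sum_(l < N) d l *: w l.
  move=> vE; pose M := maxn (n v) N.
  have [le1 le2] : (n v <= M)%N /\ (N <= M)%N by rewrite leq_maxl leq_maxr.
  rewrite /L (ext W w _ _ M) // (ext W w _ N M) //.
  apply: eq_bigr => l _; congr (_ *: _).
  apply/eqP; rewrite -subr_eq0; apply/eqP.
  apply: (proj2 eP M (fun l => cut (c v) (n v) l - cut d N l)) => //.
  under eq_bigr do rewrite scalerBl.
  by rewrite sumrB -!(ext V e) // -vE -cP subrr.
exists L; split=> [a u v|i]; last first.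
  have one (U : lmodType k) (z : nat -> U) :
      \sum_(l < i.+1) (l == i :> nat)%:R *: z l = z i.
    rewrite big_ord_recr /= eqxx scale1r big1 ?add0r // => l _.
    by rewrite ltn_eqF ?scale0r.
  by rewrite (LE _ i.+1 (fun l => (l == i)%:R)) one.
pose M := maxn (n u) (n v).
have [le1 le2] : (n u <= M)%N /\ (n v <= M)%N by rewrite leq_maxl leq_maxr.
have cE z : (n z <= M)%N -> z = \sum_(l < M) cut (c z) (n z) l *: e l.
  by move=> le; rewrite -(ext V e) // -cP.
rewrite (LE u M _ (cE u le1)) (LE v M _ (cE v le2)).
rewrite (LE _ M (fun l => a * cut (c u) (n u) l + cut (c v) (n v) l)).
  rewrite scaler_sumr -big_split /=; apply: eq_bigr => l _.
  by rewrite scalerA -scalerDl.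
rewrite {1}(cE u le1) {1}(cE v le2) scaler_sumr -big_split /=.
by apply: eq_bigr => l _; rewrite scalerA -scalerDl.
Qed.

End Basis.

Fixpoint words (d : nat) : seq (seq bool) :=
  if d is d'.+1 then map (cons true) (words d') ++ map (cons false) (words d')
  else [:: [::]].

Lemma words_size d w : w \in words d -> size w = d.
Proof.
elim: d w => [|d IH] w /=; first by rewrite inE => /eqP ->.
by rewrite mem_cat => /orP[] /mapP[v /IH <- ->].
Qed.

Lemma sum_words (V : nmodType) d (G : seq bool -> V) :
  \sum_(w <- words d.+1) G w =
  \sum_(w <- words d) G (true :: w) + \sum_(w <- words d) G (false :: w).
Proof. by rewrite big_cat !big_map. Qed.

Section Dynkin.
Variables (k : fieldType) (g : lmodType k) (lie : g -> g -> g) (x y : g).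
Hypothesis lieP : is_lie_bracket lie.
Implicit Types (s t : ncs k).

Definition gen (b : bool) : g := if b then x else y.

Fixpoint ad_word (w : seq bool) (z : g) : g :=
  if w is b :: w' then lie (gen b) (ad_word w' z) else z.

Fixpoint bracket_word (w : seq bool) : g :=
  if w is b :: w' then
    if w' is [::] then gen b else lie (gen b) (bracket_word w')
  else 0.

(** The action of the component of degree [d] of [m], a noncommutative polynomial
    in [x] and [y], on [g] by the adjoint representation. *)
Definition ad_sum d (m : ncs k) z : g := \sum_(w <- words d) m w *: ad_word w z.
(** The Dynkin map: words go to right-normed brackets. *)
Definition bracket_sum d (m : ncs k) : g :=
  \sum_(w <- words d) m w *: bracket_word w.

Lemma ad_sumS d m z : ad_sum d.+1 m z =
  lie x (ad_sum d (strip true m) z) + lie y (ad_sum d (strip false m) z).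
Proof.
rewrite /ad_sum sum_words !(lie_sumr lieP); congr (_ + _);
  by apply: eq_bigr => w _; rewrite (lieZr lieP).
Qed.

Lemma ad_sum_lin d a m s z :
  ad_sum d (a *: m + s) z = a *: ad_sum d m z + ad_sum d s z.
Proof.
rewrite /ad_sum scaler_sumr -big_split; apply: eq_bigr => w _ /=.
by rewrite ncsE ncsZ scalerDl scalerA.
Qed.

Lemma bracket_sum_lin d a m s :
  bracket_sum d (a *: m + s) = a *: bracket_sum d m + bracket_sum d s.
Proof.
rewrite /bracket_sum scaler_sumr -big_split; apply: eq_bigr => w _ /=.
by rewrite ncsE ncsZ scalerDl scalerA.
Qed.

Lemma strip_mul0 b t s : t [::] = 0 -> strip b (t * s) = strip b t * s.
Proof. by move=> t0; rewrite stripM t0 scale0r addr0. Qed.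

Lemma ad_sum_mul d d' t s z : homogen d t ->
  ad_sum (d + d') (t * s) z = ad_sum d t (ad_sum d' s z).
Proof.
elim: d t => [|d IH] t ht; last first.
  rewrite addSn !ad_sumS !strip_mul0; [|exact: ht|exact: ht].
  by rewrite !IH //; apply: homogen_strip.
rewrite (homogen_scalar ht) add0n -scalerAl mul1r /ad_sum big_seq1 /=.
rewrite ncsZ ncs1 mulr1 scaler_sumr; apply: eq_bigr => w _.
by rewrite ncsZ scalerA.
Qed.

Lemma bracket_sumS d m : bracket_sum d.+1 m =
  lie x (bracket_sum d (strip true m)) + lie y (bracket_sum d (strip false m)) +
  (if d is 0 then m [:: true] *: x + m [:: false] *: y else 0).
Proof.
rewrite /bracket_sum sum_words; case: d => [|d].
  by rewrite !big_seq1 /= !scaler0 !(lie0r lieP) !add0r.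
rewrite addr0 !(lie_sumr lieP); congr (_ + _); apply: eq_big_seq => w;
  by move=> /words_size; case: w => // b w _; rewrite (lieZr lieP).
Qed.

Lemma bracket_sum_mul d d' t s : homogen d t -> s [::] = 0 ->
  bracket_sum (d + d') (t * s) = ad_sum d t (bracket_sum d' s).
Proof.
move=> + s0; elim: d t => [|d IH] t ht; last first.
  have t0 : t [::] = 0 by exact: ht.
  rewrite addSn bracket_sumS ad_sumS !strip_mul0 //.
  rewrite !IH; try exact: homogen_strip.
  case: (d + d')%N => [|n]; last by rewrite addr0.
  by rewrite !ncsMS !ncsM0 s0 t0 !mulr0 !mul0r !addr0 !scale0r !addr0.
rewrite (homogen_scalar ht) add0n -scalerAl mul1r /ad_sum big_seq1 /=.
rewrite ncsZ ncs1 mulr1 /bracket_sum scaler_sumr; apply: eq_bigr => w _.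
by rewrite ncsZ scalerA.
Qed.

Variable iota : g -> ncs k.
Hypothesis iota_lie :
  is_lie_morphism lie (fun a b : ncs k => a * b - b * a) iota.
Hypothesis iota_x : iota x = letter k true.
Hypothesis iota_y : iota y = letter k false.

Local Notation mh := (multihomogeneous lie x y).

Lemma iota0 : iota 0 = 0.
Proof. by have := proj1 iota_lie (-1) 0 0;
  rewrite scaler0 addr0 scaleN1r addNr. Qed.

Lemma iota_prim m n v : mh m n v -> prim (iota v).
Proof.
elim=> [||m1 n1 m2 n2 u1 u2 _ p1 _ p2|m1 n1|m1 n1 a u1 u2 _ p1 _ p2].
- by rewrite iota_x; exact: prim_letter.
- by rewrite iota_y; exact: prim_letter.
- by rewrite (proj2 iota_lie); exact: prim_comm.
- by rewrite iota0; exact: prim0.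
- by rewrite (proj1 iota_lie); exact: prim_lin.
Qed.

Lemma homogen_letter b : homogen 1 (letter k b).
Proof. by move=> w ne; rewrite /letter; case: eqP => // E; rewrite E in ne. Qed.

Lemma homogen_commutator d d' (a b : ncs k) : homogen d a -> homogen d' b ->
  homogen (d + d') (a * b - b * a).
Proof.
move=> ha hb; rewrite addrC -scaleN1r; apply: homogen_lin.
  by rewrite addnC; exact: homogen_mul.
exact: homogen_mul.
Qed.

Lemma iota_homogen m n v : mh m n v -> homogen (m + n) (iota v).
Proof.
elim=> [||m1 n1 m2 n2 u1 u2 _ p1 _ p2|m1 n1|m1 n1 a u1 u2 _ p1 _ p2].
- by rewrite iota_x; exact: homogen_letter.
- by rewrite iota_y; exact: homogen_letter.
- by rewrite (proj2 iota_lie) addnACA; exact: homogen_commutator.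
- by rewrite iota0.
- by rewrite (proj1 iota_lie); exact: homogen_lin.
Qed.

Lemma mh_degree0 m n v : mh m n v -> (m + n = 0)%N -> v = 0.
Proof.
elim=> // [m1 n1 m2 n2 u1 u2 _ e1 _ _ E|m1 n1 a u1 u2 _ e1 _ e2 E].
  by rewrite e1 ?(lie0l lieP) //; lia.
by rewrite e1 // e2 // scaler0 addr0.
Qed.

Lemma ad_sum_iota m n v : mh m n v -> forall z,
  ad_sum (m + n) (iota v) z = lie v z.
Proof.
elim=> [||m1 n1 m2 n2 u1 u2 h1 e1 h2 e2|m1 n1|m1 n1 a u1 u2 _ e1 _ e2] z.
- rewrite iota_x ad_sumS /ad_sum !big_seq1 /strip /letter eqxx scale1r scale0r.
  by rewrite (lie0r lieP) addr0.
- rewrite iota_y ad_sumS /ad_sum !big_seq1 /strip /letter eqxx scale1r scale0r.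
  by rewrite (lie0r lieP) add0r.
- rewrite (proj2 iota_lie) addrC -scaleN1r ad_sum_lin addnACA.
  rewrite {1}[(m1 + n1 + _)%N]addnC !ad_sum_mul; try exact: iota_homogen.
  by rewrite !e1 !e2 scaleN1r addrC (lieJ lieP).
- by rewrite iota0 (lie0l lieP) /ad_sum big1 // => w _; rewrite scale0r.
- by rewrite (proj1 iota_lie) ad_sum_lin e1 e2 (lieDl lieP) (lieZl lieP).
Qed.

(** The Dynkin-Specht-Wever identity: the Dynkin map multiplies a Lie element of
    degree [d] by [d]. In characteristic 0 it shows that [iota] is injective,
    without any basis theorem for enveloping algebras. *)
Lemma dynkin m n v : mh m n v -> bracket_sum (m + n) (iota v) = (m + n)%:R *: v.
Proof.
elim=> [||m1 n1 m2 n2 u1 u2 h1 e1 h2 e2|m1 n1|m1 n1 a u1 u2 _ e1 _ e2].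
- rewrite iota_x bracket_sumS /bracket_sum !big_seq1 /letter eqxx !scaler0.
  by rewrite !(lie0r lieP) !scale1r scale0r !add0r addr0.
- rewrite iota_y bracket_sumS /bracket_sum !big_seq1 /letter eqxx !scaler0.
  by rewrite !(lie0r lieP) !scale1r scale0r !add0r.
- rewrite (proj2 iota_lie) addrC -scaleN1r bracket_sum_lin addnACA.
  have [p1 p2] := (proj1 (iota_prim h1), proj1 (iota_prim h2)).
  rewrite {1}[(m1 + n1 + _)%N]addnC !bracket_sum_mul //;
    try exact: iota_homogen.
  rewrite e1 e2 !(ad_sum_iota h1) !(ad_sum_iota h2) !(lieZr lieP).
  rewrite scaleN1r [lie u2 u1](lieC lieP) scalerN opprK -scalerDl.
  by rewrite -natrD.
- by rewrite iota0 scaler0 /bracket_sum big1 // => w _; rewrite scale0r.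
- by rewrite (proj1 iota_lie) bracket_sum_lin e1 e2 scalerDr !scalerA mulrC.
Qed.

End Dynkin.

Section DualWords.
Variables (k : fieldType) (g : lmodType k) (lie : g -> g -> g) (x y : g).
Hypothesis char0 : [pchar k] =i pred0.
Hypothesis lieP : is_lie_bracket lie.
Variables (e : nat -> g) (deg : nat -> nat).
Hypothesis eP : is_linear_basis e.
Hypothesis e_homog : forall i, exists m n,
  multihomogeneous lie x y m n (e i) /\ (m + n = deg i)%N.
Variables (ix iy : nat).
Hypotheses (e_x : e ix = x) (e_y : e iy = y).
Variable iota : g -> ncs k.
Hypothesis iota_lie :
  is_lie_morphism lie (fun a b : ncs k => a * b - b * a) iota.
Hypothesis iota_x : iota x = letter k true.
Hypothesis iota_y : iota y = letter k false.

Lemma deg_gt0 i : (0 < deg i)%N.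
Proof.
have [m [n [h <-]]] := e_homog i; rewrite lt0n; apply: contraTN isT => /eqP E.
by have := basis_neq0 eP i; rewrite (mh_degree0 lieP h E) eqxx.
Qed.

(** Functionals dual to the series [iota (e i)], with finitely many coefficients
    and values in [k]: the coordinate on [e j] of the Dynkin map, divided by the
    degree of [e j]. They are defined over every field containing [k]. The second
    clause says that they ignore the letters unless [e j] is [x] or [y]. *)
Lemma dual_words j : exists kappa : seq bool -> k,
  (forall i, \sum_(w <- words (deg j)) kappa w * iota (e i) w = (i == j)%:R) /\
  (deg j = 1%N -> j != ix -> j != iy -> forall w, size w = 1%N -> kappa w = 0).
Proof.
have [c [cL cE]] := basis_linear eP (fun i => (i == j)%:R : k^o).
have c0 : c 0 = 0.
  by have := cL (-1) 0 0; rewrite scaler0 addr0 scaleN1r addNr.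
have cS d (a : seq bool -> k) (v : seq bool -> g) :
    c (\sum_(w <- words d) a w *: v w) = \sum_(w <- words d) a w * c (v w).
  by elim/big_rec2: _ => // w u z _ <-; rewrite cL.
have dn0 : (deg j)%:R != 0 :> k.
  by rewrite (pcharf0P k).1 // -lt0n deg_gt0.
exists (fun w => (deg j)%:R^-1 * c (bracket_word lie x y w));
  split=> [i|d1 nx ny w].
  have [m [n [h E]]] := e_homog i.
  have -> : \sum_(w <- words (deg j))
        (deg j)%:R^-1 * c (bracket_word lie x y w) * iota (e i) w =
      (deg j)%:R^-1 * c (bracket_sum lie x y (deg j) (iota (e i))).
    rewrite cS mulr_sumr; apply: eq_bigr => w _; rewrite -mulrA; congr (_ * _).
    exact: mulrC.
  have [Ed|nd] := eqVneq (deg i) (deg j).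
    rewrite -Ed -E (dynkin lieP iota_lie iota_x iota_y h) -[_ *: _]addr0 cL c0
      addr0 cE.
    by rewrite E Ed [_ *: _]/(_ * _) mulKf.
  rewrite (_ : bracket_sum _ _ _ _ _ = 0) ?c0 ?mulr0.
    by case: eqP => // ij; rewrite ij eqxx in nd.
  rewrite /bracket_sum big_seq big1 // => w /words_size sw.
  rewrite (iota_homogen iota_lie iota_x iota_y h) ?scale0r // sw E.
  by apply/eqP; rewrite eq_sym.
case: w => // b [|//] _ /=; rewrite /gen.
by case: b; rewrite -?e_x -?e_y cE eq_sym ?(negbTE nx) ?(negbTE ny) mulr0.
Qed.

End DualWords.

(** * Poisson automorphisms preserve k(x, y) *)
Section Coefwise.
Variables (K : fieldType) (d : K -> K).
Hypothesis dP : is_deriv d.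
Implicit Types a b m : ncs K.

Definition nab m : ncs K := fun w => d (m w).

Lemma nabM a b : nab (a * b) = nab a * b + a * nab b.
Proof.
apply/funext => w; rewrite ncsE -[LHS]/(d ((a * b) w)).
have nabE m v : nab m v = d (m v) by [].
elim: w a => [|x w IH] a.
  by rewrite !ncsM0 (proj2 dP) !nabE addrC mulrC.
rewrite !ncsMS (proj1 dP) IH (proj2 dP) (_ :
  strip x (nab a) = nab (strip x a)) //.
by rewrite !nabE; ring.
Qed.

End Coefwise.

Section Embedding.
Variables (k : fieldType) (F : fieldAlgType k).

Definition emb (m : ncs k) : ncs F := fun w => (m w)%:A.

Lemma embM m n : emb (m * n) = emb m * emb n.
Proof.
apply/funext => w; rewrite /emb; elim: w m => [|x w IH] m.
  by rewrite !ncsM0 -[LHS]mulr_algl mulr1 -(rmorphM (in_alg F)).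
rewrite !ncsMS scalerDl IH; congr (_ + _).
by rewrite -(rmorphM (in_alg F)).
Qed.

Lemma emb_lin a m n : emb (a *: m + n) = a%:A *: emb m + emb n.
Proof.
apply/funext => w; rewrite /emb ncsE ncsE !ncsZ scalerDl -scalerA.
by rewrite mulr_algl.
Qed.

Lemma emb_letter x : emb (letter k x) = letter F x.
Proof.
by apply/funext => w; rewrite /emb /letter; case: eqP;
  rewrite ?scale1r ?scale0r.
Qed.

Lemma cop_emb z m w : cop z (emb m) w = (cop z m w)%:A.
Proof.
elim: z w m => [|x z IHz] w m //.
elim: w m => [|y w IHw] m; first by rewrite !cop_nilr.
by rewrite !cop_cons scalerDl -IHz -IHw.
Qed.

Lemma prim_emb m : prim m -> prim (emb m).
Proof.
move=> [m0 mP]; split=> [|x z y w]; first by rewrite /emb m0 scale0r.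
by rewrite cop_emb mP scale0r.
Qed.

End Embedding.

Section PoissonField.
Variables (k : fieldType) (F : poly_fractions k).
Hypothesis char0 : [pchar k] =i pred0.
Variables (g : lmodType k) (lie : g -> g -> g) (x y : g).
Hypothesis lieP : is_lie_bracket lie.
Variables (e : nat -> g) (deg : nat -> nat).
Hypothesis eP : is_linear_basis e.
Hypothesis e_homog : forall i, exists m n,
  multihomogeneous lie x y m n (e i) /\ (m + n = deg i)%N.
Variables (ix iy : nat).
Hypotheses (e_x : e ix = x) (e_y : e iy = y).
Variable br : F -> F -> F.
Local Notation var := (pf_var F).
Hypothesis brP : is_poisson_bracket br.
Hypothesis br_var : forall i j n (c : nat -> k),
  lie (e i) (e j) = \sum_(l < n) c l *: e l ->
  br (var i) (var j) = \sum_(l < n) c l *: var l.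

Let brL := poisson_lie brP.

Lemma kderiv_brr f : kderiv (br f).
Proof.
have D : is_deriv (br f).
  split=> u v; first exact: (lieDr brL).
  by rewrite (poisson_leibniz brP) addrC [br f u * v]mulrC.
by split=> // a; rewrite (lieZr brL) (is_deriv1 D) scaler0.
Qed.

Lemma kderiv_brl h : kderiv (br^~ h).
Proof.
have := kderiv_lin (-1) (kderiv_brr h) (kderiv_zero F).
congr kderiv; apply/funext => f.
by rewrite mulN1r addr0 -(lieC brL).
Qed.

Lemma exists_lie_var : exists E : g -> F,
  [/\ forall a u v, E (a *: u + v) = a *: E u + E v, forall i, E (e i) = var i &
      forall u v, E (lie u v) = br (E u) (E v)].
Proof.
have [E [EL EE]] := basis_linear eP var.
have lie_var0 : E 0 = 0 by have := EL (-1) 0 0;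
  rewrite scaler0 addr0 scaleN1r addNr.
have ES n (c : nat -> k) (v : nat -> g) :
    E (\sum_(l < n) c l *: v l) = \sum_(l < n) c l *: E (v l).
  by elim/big_rec2: _ => // l u z _ <-; rewrite EL.
exists E; split=> // u v.
have [n [c ->]] := proj1 eP u; have [n' [c' ->]] := proj1 eP v.
rewrite (lie_suml lieP) !ES (lie_suml brL).
have -> : \sum_(i < n) lie (c i *: e i) (\sum_(l < n') c' l *: e l) =
    \sum_(i < n) c i *: lie (e i) (\sum_(l < n') c' l *: e l).
  by apply: eq_bigr => i _; rewrite (lieZl lieP).
rewrite (ES n c (fun i => lie (e i) _)); apply: eq_bigr => i _.
rewrite (lieZl brL) (lie_sumr lieP) (lie_sumr brL); congr (_ *: _).
have -> : \sum_(l < n') lie (e i) (c' l *: e l) =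
    \sum_(l < n') c' l *: lie (e i) (e l).
  by apply: eq_bigr => l _; rewrite (lieZr lieP).
rewrite (ES n' c' (fun l => lie (e i) (e l))); apply: eq_bigr => l _.
rewrite (lieZr brL) !EE; congr (_ *: _).
have [N [b Eb]] := proj1 eP (lie (e i) (e l)).
by rewrite (br_var Eb) Eb ES; apply: eq_bigr => j _; rewrite EE.
Qed.

Variable E : g -> F.
Hypothesis EL : forall a u v, E (a *: u + v) = a *: E u + E v.
Hypothesis Ee : forall i, E (e i) = var i.
Hypothesis Elie : forall u v, E (lie u v) = br (E u) (E v).

Lemma lie_var0 : E 0 = 0.
Proof. by have := EL (-1) 0 0; rewrite scaler0 addr0 scaleN1r addNr. Qed.

(** [F] is generated by [x] and [y] as a field with a Poisson bracket, because the
    basis of [g] consists of linear combinations of Lie monomials. *)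
Lemma poisson_ind (P : F -> Prop) : (forall a : k, P a%:A) ->
  (forall u v, P u -> P v -> P (u + v)) ->
  (forall u v, P u -> P v -> P (u * v)) -> (forall u, P u -> P u^-1) ->
  (forall u v, P u -> P v -> P (br u v)) -> P (var ix) -> P (var iy) ->
  forall f, P f.
Proof.
move=> PC PD PM PV PB Px Py; apply: frac_ind => // i.
have [m [n [h _]]] := e_homog i; rewrite -Ee.
elim: h => [||m1 n1 m2 n2 u1 u2 _ p1 _ p2|m1 n1|m1 n1 a u1 u2 _ p1 _ p2].
- by rewrite -e_x Ee.
- by rewrite -e_y Ee.
- by rewrite Elie; exact: PB.
- by rewrite lie_var0 -(scale0r 1).
- by rewrite EL -mulr_algl; apply: PD => //; exact: PM.
Qed.

Variable iota : g -> ncs k.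
Hypothesis iota_lie :
  is_lie_morphism lie (fun a b : ncs k => a * b - b * a) iota.
Hypothesis iota_x : iota x = letter k true.
Hypothesis iota_y : iota y = letter k false.

(** The universal derivation: [delta f] is the sum of [df/de_i * iota (e i)]. *)
Lemma exists_delta : exists delta : F -> ncs F,
  (forall w, kderiv (fun f => delta f w)) /\
  forall i, delta (var i) = emb F (iota (e i)).
Proof.
have /choice[D DP] w : exists D : F -> F, kderiv D /\
    forall i, D (var i) = (iota (e i) w)%:A.
  exact: (exists_kderiv (fun i => (iota (e i) w)%:A)).
exists (fun f w => D w f); split=> [w|i]; first exact: (proj1 (DP w)).
by apply/funext => w; rewrite (proj2 (DP w)).
Qed.

Variable delta : F -> ncs F.
Hypothesis dK : forall w, kderiv (fun f => delta f w).
Hypothesis dV : forall i, delta (var i) = emb F (iota (e i)).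

Lemma deltaD f h : delta (f + h) = delta f + delta h.
Proof. by apply/funext => w; rewrite ncsE (proj1 (proj1 (dK w))). Qed.

Lemma deltaM f h : delta (f * h) = f *: delta h + h *: delta f.
Proof. by apply/funext => w; rewrite ncsE !ncsZ (proj2 (proj1 (dK w))). Qed.

Lemma deltaC a : delta a%:A = 0.
Proof. by apply/funext => w; rewrite (proj2 (dK w)). Qed.

Lemma deltaZ (a : k) f : delta (a *: f) = a%:A *: delta f.
Proof. by rewrite -[a *: f]mulr_algl deltaM deltaC scaler0 addr0. Qed.

Lemma delta_var v : delta (E v) = emb F (iota v).
Proof.
have iL := proj1 iota_lie.
have [n [c ->]] := proj1 eP v; elim: n => [|n IH].
  rewrite !big_ord0 lie_var0 (iota0 iota_lie) -(scale0r 1) deltaC.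
  by apply/funext => w; rewrite /emb scale0r.
by rewrite !big_ord_recr /= addrC EL iL emb_lin deltaD deltaZ IH Ee dV.
Qed.

(** The Hamiltonian operators: the action of the Poisson enveloping algebra of [F]
    on series, in which the letters are the differentials of [x] and [y]. *)
Definition ham f := twist (br f) (delta f).

Lemma hamEw f m w : ham f m w = br f (m w) + (delta f * m) w.
Proof. by []. Qed.

Lemma hamE f m : ham f m = nab (br f) m + delta f * m. Proof. by []. Qed.

Lemma nabD f m n : nab (br f) (m + n) = nab (br f) m + nab (br f) n.
Proof. by apply/funext => w; rewrite /nab !ncsE (lieDr brL). Qed.

Lemma ham_addl f h m : ham (f + h) m = ham f m + ham h m.
Proof.
apply/funext => w; rewrite ncsE !hamEw deltaD mulrDl ncsE (lieDl brL).
by rewrite addrACA.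
Qed.

Lemma ham_mull f h m : ham (f * h) m = f *: ham h m + h *: ham f m.
Proof.
apply/funext => w; rewrite ncsE !ncsZ !hamEw deltaM mulrDl ncsE.
have [[_ ->] _] := kderiv_brl (m w).
by rewrite -!scalerAl !ncsZ !mulrDr addrACA.
Qed.

Lemma ham_const a m : ham a%:A m = 0.
Proof.
apply/funext => w; rewrite hamEw deltaC mul0r addr0.
by have [_ ->] := kderiv_brl (m w).
Qed.

Lemma ham_addr f m n : ham f (m + n) = ham f m + ham f n.
Proof. exact: twistD (proj1 (kderiv_brr f)). Qed.

Lemma ham_scale f c m : ham f (c *: m) = br f c *: m + c *: ham f m.
Proof. exact: twistZ (proj1 (kderiv_brr f)). Qed.

(** The defect of the cocycle identity for [delta]. It is a derivation in each
    argument, so it is enough to check that it vanishes on the variables. *)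
Definition defect f h := delta (br f h) - (ham f (delta h) - ham h (delta f)).

Lemma defectD f f' h : defect (f + f') h = defect f h + defect f' h.
Proof.
rewrite /defect (lieDl brL) !deltaD ham_addl ham_addr.
by apply/funext => w; rewrite !(ncsE, ncsN); ring.
Qed.

Lemma defectM f f' h : defect (f * f') h = f *: defect f' h + f' *: defect f h.
Proof.
rewrite /defect (proj2 (proj1 (kderiv_brl h))) deltaD !deltaM ham_mull.
rewrite ham_addr !ham_scale ![br h _](lieC brL) !scalerBr !scaleNr.
apply/funext => w; rewrite !(ncsE, ncsN, ncsZ); ring.
Qed.

Lemma defectC a h : defect a%:A h = 0.
Proof.
rewrite /defect (proj2 (kderiv_brl h)) deltaC ham_const.
have -> : ham h 0 = 0 by rewrite -(scale0r 0) ham_scale (lie0r brL) !scale0r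
  addr0.
by rewrite !subr0 -(scale0r 1) deltaC.
Qed.

Lemma defect_anti f h : defect f h = - defect h f.
Proof.
have dN : delta (br f h) = - delta (br h f).
  by rewrite (lieC brL) -scaleN1r deltaZ !scaleN1r.
by rewrite /defect dN; apply/funext => w; rewrite !(ncsE, ncsN); ring.
Qed.

Lemma defect_kderiv h w : kderiv (fun f => defect f h w).
Proof.
split; last by move=> a; rewrite defectC.
split=> u v; first by rewrite defectD.
by rewrite defectM ncsE !ncsZ.
Qed.

Lemma defect_var i j : defect (var i) (var j) = 0.
Proof.
rewrite /defect -!Ee -Elie !delta_var (proj2 iota_lie).
have hE u v : ham (E u) (emb F (iota v)) = emb F (iota u) * emb F (iota v).
  apply/funext => w; rewrite hamEw delta_var /emb.
  by rewrite (proj2 (kderiv_brr _)) add0r.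
rewrite !hE -!embM; apply/funext => w.
by rewrite !(ncsE, ncsN) /emb !(ncsE, ncsN) scalerBl subrr.
Qed.

(** On the variables the identity says that [iota] is a Lie morphism. *)
Lemma delta_br f h : delta (br f h) = ham f (delta h) - ham h (delta f).
Proof.
apply/eqP; rewrite -subr_eq0 -/(defect f h); apply/eqP/funext => w.
have V j f' : defect f' (var j) w = 0.
  apply: (kderiv_ext (defect_kderiv (var j) w) (kderiv_zero F)) => i.
  by rewrite defect_var.
apply: (kderiv_ext (defect_kderiv h w) (kderiv_zero F)) => i.
by rewrite defect_anti ncsN V oppr0.
Qed.

Lemma ham_br f h m : ham (br f h) m = ham f (ham h m) - ham h (ham f m).
Proof.
have J : nab (br (br f h)) m =
    nab (br f) (nab (br h) m) - nab (br h) (nab (br f) m).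
  by apply/funext => w; rewrite /nab (lieJ brL).
rewrite !hamE !nabD !nabM; try exact: (proj1 (kderiv_brr _)).
rewrite J delta_br !hamE !mulrDr !mulrBl !mulrDl !mulrA.
apply/funext => w; rewrite !(ncsE, ncsN); ring.
Qed.

Lemma pd_dual j : exists kappa : seq bool -> k,
  (forall f, pd j f = \sum_(w <- words (deg j)) (kappa w)%:A * delta f w) /\
  (deg j = 1%N -> j != ix -> j != iy -> forall w, size w = 1%N -> kappa w = 0).
Proof.
have [kappa [kE k1]] :=
  dual_words char0 lieP eP e_homog e_x e_y iota_lie iota_x iota_y j.
exists kappa; split=> //; apply: (@kderiv_ext _ F (pd j)
  (fun f => \sum_(w <- words (deg j)) (kappa w)%:A * delta f w)).
  exact: pd_kderiv.
  elim: (words _) => [|w s [[IHD IHM] IHC]].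
    split=> [|a]; [split=> u v|]; rewrite !big_nil ?mulr0 ?addr0 //.
  have [[dD dM] dC] := dK w; split=> [|a]; [split=> u v|]; rewrite !big_cons.
  - by rewrite dD IHD mulrDr addrACA.
  - by rewrite dM IHM; ring.
  - by rewrite dC IHC mulr0 addr0.
move=> i; rewrite pd_var dV [j == i]eq_sym -[RHS]mulr1.
rewrite -[LHS](rmorph_nat (in_alg F)) -kE /= scaler_suml mulr1.
by apply: eq_bigr => w _; rewrite /emb mulr_algl scalerA.
Qed.

Lemma delta_expand f : exists n,
  delta f = \sum_(i < n) pd i f *: emb F (iota (e i)).
Proof.
have [n nP] := kderiv_expand f; exists n; apply/funext => w.
rewrite (nP _ (dK w) n) // ncs_sum; apply: eq_bigr => i _.
by rewrite ncsZ dV.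
Qed.

Lemma delta_prim f : prim (delta f).
Proof.
have [n ->] := delta_expand f.
elim/big_rec: _ => [|i m _ mP]; first exact: prim0.
apply: prim_lin => //; apply: prim_emb.
by have [m1 [n1 [h _]]] := e_homog i;
  exact: iota_prim iota_lie iota_x iota_y _ _ _ h.
Qed.

Lemma delta_degb f : exists N, degb N (delta f).
Proof.
have [n ->] := delta_expand f; exists (\max_(i < n) (deg i).+1)%N => w le.
rewrite ncs_sum big1 // => i _; rewrite ncsZ /emb.
have [m1 [n1 [h E1]]] := e_homog i.
rewrite (iota_homogen iota_lie iota_x iota_y h) ?scale0r ?mulr0 // E1 => sw.
by have := leq_bigmax i (F := fun i : 'I_n => (deg i).+1);
  rewrite -sw ltnNge le.
Qed.

(** A relation between [delta u] and [delta v] is one between all partial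
    derivatives of [u] and [v], and hence holds for every derivation, in
    particular for the brackets with [u] and with [v]. *)
Lemma delta_dep a b u v : a *: delta u + b *: delta v = 0 ->
  a * br u v = 0 /\ b * br u v = 0.
Proof.
move=> dep.
have pdep j : a * pd j u + b * pd j v = 0.
  have [kappa [kE _]] := pd_dual j;
    rewrite !kE !mulr_sumr -big_split big1 //= => w _.
  have := congr1 (fun m : ncs F => m w) dep; rewrite ncsE !ncsZ ncs0 => {}dep.
  by rewrite mulrCA [b * _]mulrCA -mulrDr dep mulr0.
have [n nP] := kderiv_expand u; have [n' nP'] := kderiv_expand v.
have B h : a * br u h + b * br v h = 0.
  have hD := kderiv_brl h.
  rewrite (nP _ hD (maxn n n')) ?leq_maxl // (nP' _ hD (maxn n n')) ?leq_maxr
    //.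
  rewrite !mulr_sumr -big_split big1 //= => i _.
  by rewrite !mulrA -mulrDl pdep mul0r.
split; first by have := B v; rewrite (lie_alt brL) mulr0 addr0.
by have := B u; rewrite (lie_alt brL) mulr0 add0r (lieC brL) mulrN => /eqP;
  rewrite oppr_eq0 => /eqP.
Qed.

Lemma br_xy_neq0 : br (var ix) (var iy) != 0.
Proof.
apply/eqP => b0; have := delta_br (var ix) (var iy);
  rewrite b0 -(scale0r 1) deltaC.
move=> /(congr1 (fun m : ncs F => m [:: true; false])).
rewrite ncsE ncsN !hamEw !dV e_x e_y iota_x iota_y !emb_letter !ncsMS !ncsM0.
rewrite /strip /letter /= !mulr0n !mulr1n !(lie0r brL).
rewrite !(mulr0, mul0r, add0r, addr0, mulr1, subr0) => /eqP.
by rewrite eq_sym oner_eq0.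
Qed.

Section Automorphism.
Variables phi psi : F -> F.
Hypotheses (phiK : cancel phi psi) (psiK : cancel psi phi).
Hypothesis phiL : forall (a : k) u v, phi (a *: u + v) = a *: phi u + phi v.
Hypothesis phiM : forall u v, phi (u * v) = phi u * phi v.
Hypothesis phiB : forall u v, phi (br u v) = br (phi u) (phi v).

Lemma aut0 : phi 0 = 0.
Proof. by have := phiL (-1) 0 0; rewrite scaler0 addr0 scaleN1r addNr. Qed.

Lemma autD u v : phi (u + v) = phi u + phi v.
Proof. by have := phiL 1 u v; rewrite !scale1r. Qed.

Lemma aut1 : phi 1 = 1.
Proof.
have p1 : phi 1 != 0.
  apply/eqP => e1; have := oner_neq0 F; rewrite -[1 : F]phiK e1 -{1}aut0 phiK.
  by rewrite eqxx.
by apply: (mulIf p1); rewrite -phiM !mul1r.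
Qed.

Lemma autC a : phi a%:A = a%:A.
Proof. by have := phiL a 1 0; rewrite aut0 !addr0 aut1. Qed.

Lemma autV u : phi u^-1 = (phi u)^-1.
Proof.
case: (eqVneq u 0) => [->|u0]; first by rewrite invr0 aut0 invr0.
have pu : phi u != 0.
  by apply: contraNneq u0 => e1; rewrite -[u]phiK e1 -{1}aut0 phiK.
by apply: (mulIf pu); rewrite -phiM !mulVf // aut1.
Qed.

Local Notation u := (phi (var ix)).
Local Notation v := (phi (var iy)).
Local Notation N := (twist_span (br u) (br v) (delta u) (delta v)).

(** The elements [f] with these two properties form a field closed under the
    bracket that contains [x] and [y]. *)
Lemma span_delta f : N (delta (phi f)) /\ forall m, N m -> N (ham (phi f) m).
Proof.
have Nlin c m n : N m -> N n -> N (c *: m + n).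
  move=> hm hn S /[dup] hS [_ _ lin _ _]; apply: lin; [exact: hm|exact: hn].
have Nu : N (delta u) by move=> S [].
have Nv : N (delta v) by move=> S [].
have N0 : N 0 by have := Nlin (-1) _ _ Nu Nu; rewrite scaleN1r addNr.
have ND m n : N m -> N n -> N (m + n).
  by move=> hm hn; have := Nlin 1 _ _ hm hn; rewrite scale1r.
have NZ c m : N m -> N (c *: m).
  by move=> hm; have := Nlin c _ _ hm N0; rewrite addr0.
elim/poisson_ind: f => [a|f h [f1 f2] [h1 h2]|f h [f1 f2] [h1 h2]|f [f1 f2]|
    f h [f1 f2] [h1 h2]||].
- by rewrite autC deltaC; split=> // m _; rewrite ham_const.
- rewrite autD deltaD; split=> [|m Nm]; first exact: ND.
  by rewrite ham_addl; apply: ND; [exact: f2|exact: h2].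
- rewrite phiM deltaM; split=> [|m Nm]; first by apply: ND; exact: NZ.
  by rewrite ham_mull; apply: ND; apply: NZ; [exact: h2|exact: f2].
- rewrite autV; set p := phi f in f1 f2 *.
  split=> [|m Nm].
    have -> : delta p^-1 = - (p^-1 ^+ 2) *: delta p.
      apply/funext => w; rewrite (is_derivV _ (proj1 (dK w))) ncsZ.
      by rewrite mulNr.
    exact: NZ.
  have -> : ham p^-1 m = - (p^-1 ^+ 2) *: ham p m; last by apply: NZ; exact: f2.
  apply/funext => w; rewrite ncsZ !hamEw.
  have -> : br p^-1 (m w) = - (p^-1 ^+ 2 * br p (m w)) :=
    is_derivV _ (proj1 (kderiv_brl (m w))).
  have -> : delta p^-1 = - (p^-1 ^+ 2) *: delta p.
    apply/funext => w'; rewrite (is_derivV _ (proj1 (dK w'))) ncsZ.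
    by rewrite mulNr.
  by rewrite -scalerAl ncsZ; ring.
- rewrite phiB; split=> [|m Nm].
    by rewrite delta_br -scaleN1r addrC; apply: Nlin; [exact: h2|exact: f2].
  rewrite ham_br -scaleN1r addrC; apply: Nlin; first by apply: h2; exact: f2.
  by apply: f2; exact: h2.
- split=> // m Nm S /[dup] hS [_ _ _ K1 _]; apply: K1; exact: Nm.
- split=> // m Nm S /[dup] hS [_ _ _ _ K2]; apply: K2; exact: Nm.
Qed.

(** Both letters are in the span, being the differentials of the images of
    [psi x] and [psi y]; hence [twist_span_degree] bounds the degrees of the
    differentials of [u] and [v] by 1, so that [u] and [v] do not depend on the
    variables [e_i] of higher Lie degree. *)
Lemma aut_var : u \in gen_subfield (var ix) (var iy) /\
  v \in gen_subfield (var ix) (var iy).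
Proof.
have [Nu du] := delta_degb u; have [Nv dv] := delta_degb v.
have [bu bv] : degb 2 (delta u) /\ degb 2 (delta v).
  apply: (@twist_span_degree F _ (maxn Nu Nv) (br u) (br v)).
  - exact: char0F.
  - exact: (proj1 (kderiv_brr u)).
  - exact: (proj1 (kderiv_brr v)).
  - exact: delta_prim.
  - exact: delta_prim.
  - exact: degbW (leq_maxl _ _) du.
  - exact: degbW (leq_maxr _ _) dv.
  - move=> c c' /delta_dep; rewrite -phiB.
    have bn : phi (br (var ix) (var iy)) != 0.
      by apply: contraNneq br_xy_neq0 => e0;
        rewrite -[br _ _]phiK e0 -{1}aut0 phiK.
    by move=> [/eqP + /eqP];
      rewrite !mulf_eq0 (negbTE bn) !orbF => /eqP -> /eqP ->.
  - case.
      have := proj1 (span_delta (psi (var ix))).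
      by rewrite psiK dV e_x iota_x emb_letter.
    have := proj1 (span_delta (psi (var iy))).
    by rewrite psiK dV e_y iota_y emb_letter.
(* The functional dual to [e j] reads [pd j f] off [delta f] in degree [deg j]:
   there [delta f] vanishes if [deg j > 1], and the functional vanishes if
   [deg j = 1]. *)
have ker f : degb 2 (delta f) -> f \in gen_subfield (var ix) (var iy).
  move=> bf; apply: pd_kernel => // j nx ny.
  have [kappa [kE k1]] := pd_dual j;
    rewrite kE big_seq big1 // => w /words_size sw.
  have [d1|d1] := eqVneq (deg j) 1%N.
    by rewrite k1 ?scale0r ?mul0r // sw.
  have dp := deg_gt0 lieP eP e_homog j.
  by rewrite bf ?mulr0 // sw; lia.
by split; exact: ker.
Qed.

End Automorphism.
End PoissonField.

(** * Automorphisms of k(x, y) extend to the free Poisson field *)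
Section Substitution.
Variables (k : fieldType) (F : poly_fractions k).
Local Notation var := (pf_var F).
Local Notation frac := (pf_frac F).

Lemma frac_inj p q : frac p = frac q -> p = q.
Proof.
by move=> E; apply/eqP; rewrite -subr_eq0 -(pf_eq0 F) rmorphB E subrr.
Qed.

Variable phi : {rmorphism polyN k -> F}.
Hypothesis phiC : forall a : k, phi a%:A = a%:A.
Local Notation gr := (hom_graph frac phi).

Lemma frac_phi p q : frac p = frac q -> phi p = phi q.
Proof. by move=> /frac_inj ->. Qed.

Definition gr_fun := hom_graph_fun frac_phi.

Lemma grC (a : k) : gr a%:A a%:A.
Proof. by rewrite -{1}(pf_C F) -phiC; exact: hom_graph_poly. Qed.

Lemma gr0 : gr 0 0.
Proof. by have := grC 0; rewrite scale0r. Qed.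

Lemma grN f f' : gr f f' -> gr (- f) (- f').
Proof.
move=> h; rewrite -mulN1r -[- f']mulN1r; apply: hom_graphM => //.
by have := grC (-1); rewrite scaleN1r.
Qed.

Lemma grB f f' h h' : gr f f' -> gr h h' -> gr (f - h) (f' - h').
Proof. by move=> hf hh; apply: hom_graphD => //; exact: grN. Qed.

Lemma gr_div f f' h h' : gr f f' -> gr h h' -> h' != 0 -> gr (f / h) (f' / h').
Proof.
by move=> hf hh h'0; apply: hom_graphM => //; apply: hom_graphV => //;
  exact: frac_phi.
Qed.

(** A substitution agrees with a field morphism [s] of k(X, Y) as soon as it does
    on [X] and [Y]; denominators cause no trouble because [s] is injective. *)
Lemma gr_sub (X Y : F) (s : subfield_of X Y -> subfield_of X Y) :
  injective s ->
  (forall a b, s (a + b) = s a + s b) -> (forall a b, s (a * b) = s a * s b) ->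
  (forall a : k, s a%:A = a%:A) ->
  (forall z, val z = X -> gr X (val (s z))) ->
  (forall z, val z = Y -> gr Y (val (s z))) ->
  forall z, gr (val z) (val (s z)).
Proof.
move=> sI sD sM sC sX sY.
pose S : {pred F} := fun f => `[< exists z : subfield_of X Y,
  val z = f /\ gr f (val (s z)) >].
have s0 : s 0 = 0 by have := sC 0; rewrite scale0r.
have s1 : s 1 = 1 by have := sC 1; rewrite scale1r.
have sN z : s (- z) = - s z.
  by apply/eqP; rewrite -addr_eq0 -sD addNr s0.
have sV z : s z^-1 = (s z)^-1.
  have [->|z0] := eqVneq z 0; first by rewrite invr0 s0 invr0.
  have sz0 : s z != 0 by apply: contraNneq z0 => e; apply/eqP/sI; rewrite e s0.
  by apply: (mulIf sz0); rewrite -sM !mulVf.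
have inS f : (f \in S) <-> exists z : subfield_of X Y,
  val z = f /\ gr f (val (s z)).
  by split=> [/asboolP|h]; last exact/asboolP.
suff H (z : subfield_of X Y) : val z \in S by move=> z;
  have /inS[z' [/val_inj ->]] := H z.
have /gen_subfieldP zG := valP z; apply: zG.
- split=> [|_ _ /inS[a [<- ga]] /inS[b [<- gb]]|_ _ /inS[a [<- ga]] /inS[b [<-
  gb]]];
    apply/inS.
  + by exists 1; rewrite s1 rmorph1; split=> //; have := grC 1; rewrite scale1r.
  + exists (a - b); rewrite rmorphB; split=> //.
    by rewrite sD sN rmorphB; exact: grB.
  + exists (a / b); rewrite rmorphM fmorphV; split=> //.
    rewrite sM sV rmorphM fmorphV; have [->|b0] := eqVneq b 0.
      by rewrite s0 rmorph0 invr0 !mulr0; exact: gr0.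
    apply: gr_div => //; rewrite fmorph_eq0.
    by apply: contraNneq b0 => e; apply/eqP/sI; rewrite e s0.
- by move=> a; apply/inS; exists a%:A; rewrite sC linearZ rmorph1; split=> //;
  exact: grC.
- apply/inS; exists (Sub X (gen_subfield_l X Y)).
  by split; [exact: SubK|apply: sX; exact: SubK].
- apply/inS; exists (Sub Y (gen_subfield_r X Y)).
  by split; [exact: SubK|apply: sY; exact: SubK].
Qed.

Section Bracket.
Variable br : F -> F -> F.
Hypothesis brP : is_poisson_bracket br.
Let brL := poisson_lie brP.
Variable pv : nat -> F.
Hypothesis phiU : forall i, phi << ucm i >> = pv i.
Hypothesis gr_var : forall i j,
  gr (br (var i) (var j)) (br (pv i) (pv j)).

Lemma gr_brl h h' : gr h h' ->
  (forall i, gr (br (var i) h) (br (pv i) h')) ->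
  forall f f', gr f f' -> gr (br f h) (br f' h').
Proof.
move=> hh hv f f' ff'.
have [[lD lM] lC] := kderiv_brl brP h;
  have [[lD' lM'] lC'] := kderiv_brl brP h'.
have P p : gr (br (frac p) h) (br (phi p) h').
  elim/polyN_ind: p => [a|p q gp gq|p q gp gq|i].
  - by rewrite pf_C phiC lC lC'; exact: gr0.
  - by rewrite !rmorphD lD lD'; exact: hom_graphD.
  - rewrite !rmorphM lM lM'.
    by apply: hom_graphD; apply: hom_graphM => //; exact: hom_graph_poly.
  - by rewrite pf_varE phiU.
have [p [q [hq iq fq f'q]]] := ff'.
have -> : br f h = (br (frac p) h - f * br (frac q) h) / frac q.
  by apply: (mulIf iq); rewrite mulfVK // -fq lM addrC addKr mulrC.
have -> : br f' h' = (br (phi p) h' - f' * br (phi q) h') / phi q.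
  by apply: (mulIf hq); rewrite mulfVK // -f'q lM' addrC addKr mulrC.
apply: gr_div => //; last exact: hom_graph_poly.
by apply: grB => //; apply: hom_graphM.
Qed.

Lemma gr_br f f' h h' : gr f f' -> gr h h' -> gr (br f h) (br f' h').
Proof.
have V j f1 f1' : gr f1 f1' -> gr (br f1 (var j)) (br f1' (pv j)).
  by apply: gr_brl => //; rewrite -pf_varE -phiU; exact: hom_graph_poly.
move=> gf gh; apply: gr_brl => // i.
by rewrite [br (var i) h](lieC brL) [br _ h'](lieC brL); apply/grN/V.
Qed.

End Bracket.
End Substitution.

Section Extension.
Variables (k : fieldType) (F : poly_fractions k).
Hypothesis char0 : [pchar k] =i pred0.
Variables (g : lmodType k) (lie : g -> g -> g) (x y : g).
Hypothesis g_free : is_free_lie lie x y.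
Let lieP := proj1 g_free.
Variables (e : nat -> g) (deg : nat -> nat).
Hypothesis eP : is_linear_basis e.
Hypothesis e_homog : forall i, exists m n,
  multihomogeneous lie x y m n (e i) /\ (m + n = deg i)%N.
Variables (ix iy : nat).
Hypotheses (e_x : e ix = x) (e_y : e iy = y).
Variable br : F -> F -> F.
Local Notation var := (pf_var F).
Local Notation frac := (pf_frac F).
Hypothesis brP : is_poisson_bracket br.
Let brL := poisson_lie brP.
Variable E : g -> F.
Hypothesis EL : forall a u v, E (a *: u + v) = a *: E u + E v.
Hypothesis Ee : forall i, E (e i) = var i.
Hypothesis Elie : forall u v, E (lie u v) = br (E u) (E v).

Local Notation X := (var ix).
Local Notation Y := (var iy).
Local Notation Kxy := (subfield_of X Y).

Definition sub_x : Kxy := Sub X (gen_subfield_l X Y).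
Definition sub_y : Kxy := Sub Y (gen_subfield_r X Y).

(** Any two elements can be substituted for [x] and [y]: the Lie morphism given by
    freeness determines a morphism of polynomial algebras, whose extension to
    fractions respects brackets wherever it is defined. *)
Lemma exists_poisson_subst (u v : F) :
  exists (th : g -> F) (phi : {rmorphism polyN k -> F}),
  [/\ is_lie_morphism lie br th, th x = u /\ th y = v,
      forall a : k, phi a%:A = a%:A, forall i, phi << ucm i >> = th (e i) &
      forall f f' h h', hom_graph frac phi f f' -> hom_graph frac phi h h' ->
        hom_graph frac phi (br f h) (br f' h')].
Proof.
have [th [thL thx thy _]] := proj2 g_free F br brL u v.
have [phi [phiC phiU]] := exists_polyN_eval (in_alg F) (fun i => th (e i)).
exists th, phi; split=> // f f' h h'; apply: (gr_br phiC brP phiU) => i j.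
rewrite -!Ee -Elie -(proj2 thL).
have [n [c ->]] := proj1 eP (lie (e i) (e j)).
have th0 : th 0 = 0.
  by have := proj1 thL (-1) 0 0; rewrite scaler0 addr0 scaleN1r addNr.
elim: n => [|n IH]; first by rewrite !big_ord0 (lie_var0 EL) th0; exact: gr0.
rewrite !big_ord_recr /= addrC EL (proj1 thL).
apply: hom_graphD => //; rewrite -[_ *: E _]mulr_algl -[_ *: th _]mulr_algl.
apply: hom_graphM; first exact: grC.
by rewrite Ee -phiU -pf_varE; exact: hom_graph_poly.
Qed.

Section OneAut.
Variables s t : Kxy -> Kxy.
Hypotheses (sK : cancel s t).
Hypotheses (sD : forall a b, s (a + b) = s a + s b)
  (sM : forall a b, s (a * b) = s a * s b) (sC : forall a : k, s a%:A = a%:A).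
Hypotheses (tD : forall a b, t (a + b) = t a + t b)
  (tM : forall a b, t (a * b) = t a * t b) (tC : forall a : k, t a%:A = a%:A).
Hypothesis tI : injective t.

(** The substitution [phi] attached to [s] is defined on all fractions because it
    is injective: the partial substitution attached to the inverse [t] maps
    [s x] to [x] and [s y] to [y], hence [phi p] to [p] for every polynomial
    [p]. *)
Lemma exists_extension : exists Phi : F -> F,
  [/\ forall (a : k) u v, Phi (a *: u + v) = a *: Phi u + Phi v,
      forall u v, Phi (u * v) = Phi u * Phi v,
      forall u v, Phi (br u v) = br (Phi u) (Phi v) &
      forall z, Phi (val z) = val (s z)].
Proof.
have [th [phi [thL [thx thy] phiC phiU phiB]]] :=
  exists_poisson_subst (val (s sub_x)) (val (s sub_y)).
have [th' [psi [_ [thx' thy'] psiC psiU psiB]]] :=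
  exists_poisson_subst (val (t sub_x)) (val (t sub_y)).
have phix : phi << ucm ix >> = val (s sub_x) by rewrite phiU e_x.
have phiy : phi << ucm iy >> = val (s sub_y) by rewrite phiU e_y.
have psix : psi << ucm ix >> = val (t sub_x) by rewrite psiU e_x.
have psiy : psi << ucm iy >> = val (t sub_y) by rewrite psiU e_y.
have sI : injective s := can_inj sK.
have gX (r : Kxy -> Kxy) (rho : {rmorphism polyN k -> F}) :
    rho << ucm ix >> = val (r sub_x) ->
    forall z, val z = X -> hom_graph frac rho X (val (r z)).
  move=> rx z zX; have -> : z = sub_x by apply: val_inj; rewrite zX SubK.
  by rewrite -rx -pf_varE; exact: hom_graph_poly.
have gY (r : Kxy -> Kxy) (rho : {rmorphism polyN k -> F}) :
    rho << ucm iy >> = val (r sub_y) ->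
    forall z, val z = Y -> hom_graph frac rho Y (val (r z)).
  move=> ry z zY; have -> : z = sub_y by apply: val_inj; rewrite zY SubK.
  by rewrite -ry -pf_varE; exact: hom_graph_poly.
have gs := gr_sub phiC sI sD sM sC (gX s phi phix) (gY s phi phiy).
have gt := gr_sub psiC tI tD tM tC (gX t psi psix) (gY t psi psiy).
have inv p : hom_graph frac psi (phi p) (frac p).
  elim/polyN_ind: p => [a|p q gp gq|p q gp gq|i].
  - by rewrite phiC pf_C; exact: grC.
  - by rewrite !rmorphD; exact: hom_graphD.
  - by rewrite !rmorphM; exact: hom_graphM.
  - rewrite phiU pf_varE -Ee; have [m [n [h _]]] := e_homog i.
    elim: h => [||m1 n1 m2 n2 u1 u2 _ p1 _ p2|m1 n1|m1 n1 a u1 u2 _ p1 _ p2].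
    + by have := gt (s sub_x); rewrite sK SubK thx -[E x](congr1 E e_x) Ee.
    + by have := gt (s sub_y); rewrite sK SubK thy -[E y](congr1 E e_y) Ee.
    + by rewrite (proj2 thL) Elie; exact: psiB.
    + rewrite (lie_var0 EL) (_ : th 0 = 0); first exact: gr0.
      by have := proj1 thL (-1) 0 0; rewrite scaler0 addr0 scaleN1r addNr.
    + rewrite (proj1 thL) EL; apply: hom_graphD => //.
      rewrite -[_ *: E _]mulr_algl -[_ *: th _]mulr_algl.
      by apply: hom_graphM => //; exact: grC.
have phi0 q : frac q != 0 -> phi q != 0.
  apply: contraNneq => q0; have := inv q; rewrite q0 => gq.
  by rewrite (gr_fun gq (gr0 psiC)).
have /choice[Phi PhiP] f : exists f', hom_graph frac phi f f'.
  have [p [q [q0 ->]]] := pf_quot f; exists (phi p / phi q).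
  by apply: gr_div => //;
    [exact: hom_graph_poly|exact: hom_graph_poly|exact: phi0].
exists Phi; split=> [a u v|u v|u v|z]; apply: (gr_fun (PhiP _)).
- apply: hom_graphD => //; rewrite -[a *: u]mulr_algl -[a *: Phi u]mulr_algl.
  by apply: hom_graphM => //; exact: grC.
- exact: hom_graphM.
- exact: phiB.
- exact: gs.
Qed.

End OneAut.
End Extension.

(** * Rational maps and pairs of rational functions *)
Section MpolyEval.
Variables (k : fieldType) (n : nat).

Lemma mpoly_ring_ind (P : mpoly n k -> Prop) : (forall a : k, P a%:MP_[n]) ->
  (forall p q, P p -> P q -> P (p + q)) ->
  (forall p q, P p -> P q -> P (p * q)) -> (forall i : 'I_n, P 'X_i) ->
  forall p, P p.
Proof.
move=> PC PD PM PX p; rewrite [p]mpolyE.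
apply: (big_ind P) => // [|m _]; first by rewrite -mpolyC0.
rewrite -mul_mpolyC; apply: (PM) => //; rewrite mpolyXE_id.
apply: (big_ind P) => [|p1 p2|i _]; [by rewrite -mpolyC1|exact: PM|].
elim: (m i) => [|l IH]; first by rewrite expr0 -mpolyC1.
by rewrite exprS; exact: PM.
Qed.

Definition evm (A : comAlgType k) (c : 'I_n -> A) (p : mpoly n k) : A :=
  mpoly.mmap (in_alg A) c p.

Section Eval.
Variables (A : comAlgType k) (c : 'I_n -> A).

Lemma evmD p q : evm c (p + q) = evm c p + evm c q.
Proof. exact: mpoly.mmapD. Qed.
Lemma evmB p q : evm c (p - q) = evm c p - evm c q.
Proof. exact: mpoly.mmapB. Qed.
Lemma evmM p q : evm c (p * q) = evm c p * evm c q.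
Proof. exact: (rmorphM (mpoly.mmap (in_alg A) c)). Qed.
Lemma evmC a : evm c a%:MP = a%:A.
Proof. exact: mpoly.mmapC. Qed.
Lemma evmZ a p : evm c (a *: p) = a *: evm c p.
Proof. by rewrite -mul_mpolyC evmM evmC mulr_algl. Qed.
Lemma evm0 : evm c 0 = 0.
Proof. exact: mpoly.mmap0. Qed.
Lemma evmX i : evm c 'X_i = c i.
Proof. by rewrite /evm mpoly.mmapX mmap1U. Qed.

Lemma evm_scale d a p : p \is d.-homog ->
  evm (fun i => a * c i) p = a ^+ d * evm c p.
Proof.
move=> /dhomogP hp; rewrite /evm /mpoly.mmap mulr_sumr big_seq [RHS]big_seq.
apply: eq_bigr => m mp; rewrite mulrCA; congr (_ * _).
have <- : mpoly.mdeg m = d := hp m mp.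
rewrite /mmap1 mpoly.mdegE.
rewrite -prodrXr -big_split /=.
by apply: eq_bigr => i _; exact: exprMn.
Qed.

End Eval.

Lemma evm_hom (A B : comAlgType k) (r : A -> B) (c : 'I_n -> A) :
  (forall a b, r (a + b) = r a + r b) -> (forall a b, r (a * b) = r a * r b) ->
  (forall a : k, r a%:A = a%:A) ->
  forall p, r (evm c p) = evm (fun i => r (c i)) p.
Proof.
move=> rD rM rC; elim/mpoly_ring_ind => [a|p q Ep Eq|p q Ep Eq|i].
- by rewrite !evmC.
- by rewrite !evmD rD Ep Eq.
- by rewrite !evmM rM Ep Eq.
- by rewrite !evmX.
Qed.

Lemma comp_mpolyM m (f : n.-tuple (mpoly m k)) p q :
  (p * q) \mPo f = (p \mPo f) * (q \mPo f).
Proof. exact: (rmorphM (comp_mpoly f)). Qed.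

End MpolyEval.

Lemma evm_comp (k : fieldType) n m (A : comAlgType k)
    (f : n.-tuple (mpoly m k)) (c : 'I_m -> A) p :
  evm c (p \mPo f) = evm (fun i => evm c (tnth f i)) p.
Proof.
elim/mpoly_ring_ind: p => [a|p q Ep Eq|p q Ep Eq|i].
- by rewrite comp_mpolyC !evmC.
- by rewrite comp_mpolyD !evmD Ep Eq.
- by rewrite comp_mpolyM !evmM Ep Eq.
- by rewrite comp_mpolyXU evmX (tnth_nth 0).
Qed.

Section HomogComp.
Variable k : fieldType.

Lemma dhomog_comp n m (f : n.-tuple (mpoly m k)) (d d' : nat) (p : mpoly n k) :
  p \is d.-homog -> (forall i, tnth f i \is d'.-homog) ->
  (p \mPo f) \is (d' * d).-homog.
Proof.
move=> /dhomogP hp hf; rewrite comp_mpolyEX big_seq; apply: rpred_sum => l lp.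
have <- : mpoly.mdeg l = d := hp l lp.
apply: rpredZ; rewrite comp_mpolyX mpoly.mdegE big_distrr /=.
elim/big_rec2: _ => [|i a b _ h]; first exact: dhomog1.
by apply: dhomogM => //; exact: dhomogMn.
Qed.

End HomogComp.

Section RationalFunctions.
Variables (k : fieldType) (F : poly_fractions k).
Hypothesis char0 : [pchar k] =i pred0.
Variables (ix iy : nat).
Hypothesis ixy : ix != iy.
Local Notation var := (pf_var F).
Local Notation frac := (pf_frac F).
Local Notation X := (var ix).
Local Notation Y := (var iy).
Local Notation G := (gen_subfield X Y).
Local Notation Kxy := (subfield_of X Y).
Local Notation P3 := (mpoly 3 k).

(** The affine chart where the last homogeneous coordinate is 1. *)
Definition affine (A : comAlgType k) (a b : A) : 'I_3 -> A :=
  tnth [tuple a; b; 1].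

Local Notation ev := (evm (affine X Y)).

Lemma mderiv_var (i j : 'I_3) : ('X_j : P3)^`M(i) = (j == i)%:R%:MP.
Proof.
rewrite mderivX mnm1E; case: eqVneq => [->|_]; last by rewrite scale0r mpolyC0.
rewrite scale1r (_ : (U_(i) - U_(i))%MM = 0%MM) ?mpolyX0 ?mpolyC1 //.
by apply/mnmP => l; rewrite mnmBE subnn mnm0E.
Qed.

Lemma pd_ev i (p : P3) :
  pd i (ev p) = ev p^`M(0) * (i == ix)%:R + ev p^`M(1) * (i == iy)%:R.
Proof.
have [[dD dM] dC] := pd_kderiv F i.
elim/mpoly_ring_ind: p => [a|p q Ep Eq|p q Ep Eq|j].
- by rewrite evmC dC !mderivC !evm0 !mul0r addr0.
- by rewrite evmD dD Ep Eq !mderivD !evmD; ring.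
- by rewrite evmM dM Ep Eq !mderivM !evmD !evmM; ring.
rewrite evmX !mderiv_var !evmC; case: j => [[|[|[|//]]] ltj];
  rewrite /affine /tnth /= ?pd_var ?scale1r ?scale0r ?mul1r ?mul0r ?addr0
    ?add0r //.
exact: is_deriv1 (proj1 (pd_kderiv F i)).
Qed.

Lemma mderiv_homog d i (p : P3) : p \is d.+1.-homog -> p^`M(i) \is d.-homog.
Proof.
move=> hp; apply/dhomogP => m; rewrite mcoeff_msupp mcoeff_deriv => nz.
apply/eqP; rewrite -eqSS; apply: contraNT nz => ne.
rewrite (dhomog_nemf_coeff hp) ?mul0rn //=.
by rewrite mpoly.mdegD mpoly.mdeg1 addn1.
Qed.

Lemma mderiv_eq0 i (p : P3) (m : 'X_{1..3}) : p^`M(i) = 0 -> (0 < m i)%N ->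
  p@_m = 0.
Proof.
move=> p0 mi; have := mcoeff_deriv i (m - U_(i))%MM p; rewrite p0 mcoeff0.
have -> : (m - U_(i) + U_(i))%MM = m.
  apply: submK; apply/mnm_lepP => l; rewrite mnm1E.
  by case: eqP => // <-.
by move/esym/eqP; rewrite -mulr_natl mulf_eq0 (pcharf0P k).1 //= => /eqP.
Qed.

(** Dehomogenization is injective on forms of a given degree, since x and y are
    algebraically independent. The proof differentiates: by induction on [d] the
    derivatives of [p] in the first two coordinates vanish, and only a multiple of
    a power of the last coordinate is left. *)
Lemma ev_homog_eq0 d (p : P3) : p \is d.-homog -> ev p = 0 -> p = 0.
Proof.
elim: d p => [|d IH] p hp p0.
  have Ep : p = (p@_0)%:MP.
    apply/mpolyP => m; rewrite mcoeffC; case: eqVneq => [<-|m0].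
      by rewrite mulr1.
    by rewrite mulr0 (dhomog_nemf_coeff hp) //= mpoly.mdeg_eq0.
  move/eqP: p0; rewrite Ep evmC scaler_eq0 oner_eq0 orbF => /eqP ->.
  exact: mpolyC0.
have D (i : 'I_3) : ev p^`M(i) = 0 -> p^`M(i) = 0.
  exact: IH (mderiv_homog i hp).
have dp0 i : pd i (ev p) = 0 by rewrite p0 (is_deriv0 (proj1 (pd_kderiv F i))).
have D0 : p^`M(0) = 0.
  apply: D; have := pd_ev ix p.
  by rewrite dp0 (negbTE ixy) eqxx mulr0 addr0 mulr1 => <-.
have D1 : p^`M(1) = 0.
  apply: D; have := pd_ev iy p.
  by rewrite dp0 eq_sym (negbTE ixy) eqxx mulr0 add0r mulr1 => <-.
pose m2 : 'X_{1..3} := (U_(2%:R : 'I_3) *+ d.+1)%MM.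
have Ep : p = p@_m2 *: 'X_[m2].
  apply/mpolyP => m; rewrite mcoeffZ mcoeffX; case: eqVneq => [<-|ne].
    by rewrite mulr1.
  rewrite mulr0; case: (posnP (m 0)) => [m0|]; last exact: mderiv_eq0 D0.
  case: (posnP (m 1)) => [m1|]; last exact: mderiv_eq0 D1.
  apply: (dhomog_nemf_coeff hp) => /=; apply: contraNneq ne => dm.
  apply/eqP/mnmP => i;
    rewrite mulmnE mnm1E -dm mpoly.mdegE !big_ord_recl big_ord0.
  have -> : lift ord0 ord0 = 1 :> 'I_3 by exact: val_inj.
  have -> : lift ord0 (lift ord0 ord0) = 2%:R :> 'I_3 by exact: val_inj.
  have -> : ord0 = 0 :> 'I_3 by exact: val_inj.
  rewrite m0 m1 addn0 !add0n.
  case: i => [[|[|[|//]]] lti].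
  - by rewrite (_ : Ordinal lti = 0) ?m0 //; exact: val_inj.
  - by rewrite (_ : Ordinal lti = 1) ?m1 //; exact: val_inj.
  - by rewrite (_ : Ordinal lti = 2%:R) ?eqxx ?mul1n //; exact: val_inj.
move/eqP: p0; rewrite Ep evmZ -mpolyXn /m2.
have -> : evm (affine X Y) ('X_(2%:R : 'I_3) ^+ d.+1 : P3) = 1.
  elim: d.+1 => [|l IHl]; first by rewrite expr0 -mpolyC1 evmC scale1r.
  by rewrite exprS evmM IHl evmX mulr1.
by rewrite scaler_eq0 oner_eq0 orbF => /eqP ->; rewrite scale0r.
Qed.

Lemma ev_in (u v : F) p : u \in G -> v \in G -> evm (affine u v) p \in G.
Proof.
move=> uG vG; elim/mpoly_ring_ind: p => [a|p q Ep Eq|p q Ep Eq|i].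
- by rewrite evmC rpredZ ?rpred1.
- by rewrite evmD rpredD.
- by rewrite evmM rpredM.
- by rewrite evmX /affine; case: i => [[|[|[|//]]] lti];
  rewrite /tnth /= ?rpred1.
Qed.

Lemma G_quot z : z \in G -> exists d p q,
  [/\ p \is d.-homog, q \is d.-homog, ev q != 0 & z * ev q = ev p].
Proof.
pose S : {pred F} := fun z => `[< exists d p q,
  [/\ p \is d.-homog, q \is d.-homog, ev q != 0 & z * ev q = ev p] >].
have inS u : (u \in S) <-> exists d p q,
    [/\ p \is d.-homog, q \is d.-homog, ev q != 0 & u * ev q = ev p].
  by split=> [/asboolP|h]; last exact/asboolP.
have ev1 : ev 1 = 1 by rewrite -mpolyC1 evmC scale1r.
have evc : affine X Y 0 = X /\ affine X Y 1 = Y /\ affine X Y 2%:R = 1.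
  by rewrite /affine /tnth.
have hX (i : 'I_3) : ('X_i : P3) \is 1.-homog by rewrite dhomogX /= mpoly.mdeg1.
suff H : z \in G -> z \in S by move=> /H /inS.
move=> /gen_subfieldP; apply.
- split=> [|_u _v /inS[d [p [q [hp hq q0 E]]]] /inS[d' [p' [q' [hp' hq' q0'
  E']]]]|
    _u _v /inS[d [p [q [hp hq q0 E]]]] /inS[d' [p' [q' [hp' hq' q0' E']]]]];
      apply/inS.
  + exists 0%N, 1, 1; rewrite mul1r ev1 oner_neq0; split=> //; exact: dhomog1.
  + exists (d + d')%N, (p * q' - p' * q), (q * q').
    rewrite evmB !evmM mulf_neq0 // -E -E'; split=> //; last by ring.
      by apply: rpredB; [|rewrite addnC]; exact: dhomogM.
    exact: dhomogM.
  + have [p'0|p'0] := eqVneq (ev p') 0.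
      move/eqP: E'; rewrite p'0 mulf_eq0 (negbTE q0') orbF => /eqP ->.
      exists 0%N, 0, 1; rewrite invr0 mulr0 mul0r ev1 evm0 oner_neq0.
      by split=> //; [exact: rpred0|exact: dhomog1].
    exists (d + d')%N, (p * q'), (q * p').
    rewrite !evmM mulf_neq0 // -E -E'; split=> //; try exact: dhomogM.
    have v0 : _v != 0 by apply: contraNneq p'0 => v0; rewrite -E' v0 mul0r.
    by field.
- move=> a; apply/inS; exists 0%N, a%:MP, 1; rewrite evmC ev1 mulr1 oner_neq0.
  split=> //; last exact: dhomog1.
  by rewrite -[a%:MP]mulr1 mul_mpolyC; exact/dhomogZ/dhomog1.
- apply/inS; exists 1%N, 'X_0, 'X_(2%:R); rewrite !evmX.
  by have [-> [_ ->]] := evc; rewrite mulr1 oner_neq0.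
- apply/inS; exists 1%N, 'X_1, 'X_(2%:R); rewrite !evmX.
  by have [_ [-> ->]] := evc; rewrite mulr1 oner_neq0.
Qed.

End RationalFunctions.

Lemma ord3_ind (P : 'I_3 -> Prop) : P 0 -> P 1 -> P 2%:R -> forall i, P i.
Proof.
move=> P0 P1 P2 [[|[|[|//]]] lti].
- by rewrite (_ : Ordinal lti = 0) //; exact: val_inj.
- by rewrite (_ : Ordinal lti = 1) //; exact: val_inj.
- by rewrite (_ : Ordinal lti = 2%:R) //; exact: val_inj.
Qed.

Section Coord.
Variables (k : fieldType) (A : comAlgType k) (a b : A).
Lemma affine0 : affine a b 0 = a. Proof. by []. Qed.
Lemma affine1 : affine a b 1 = b. Proof. by []. Qed.
Lemma affine2 : affine a b 2%:R = 1. Proof. by []. Qed.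
End Coord.

Section Cremona.
Variables (k : fieldType) (F : poly_fractions k).
Hypothesis char0 : [pchar k] =i pred0.
Variables (ix iy : nat).
Hypothesis ixy : ix != iy.
Local Notation var := (pf_var F).
Local Notation frac := (pf_frac F).
Local Notation X := (var ix).
Local Notation Y := (var iy).
Local Notation G := (gen_subfield X Y).
Local Notation Kxy := (subfield_of X Y).
Local Notation P3 := (mpoly 3 k).
Local Notation ev := (evm (affine X Y)).
Local Notation Xs := (sub_x F ix iy).
Local Notation Ys := (sub_y F ix iy).

(** In the affine chart the map [f] is the point with coordinates [u] and [v]. *)
Definition represents (f : 3.-tuple P3) (u v : F) : Prop := exists d,
  [/\ forall i, tnth f i \is d.-homog, ev (tnth f 2%:R) != 0 &
      forall i, ev (tnth f i) = ev (tnth f 2%:R) * affine u v i].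

Lemma represents_ratmap f u v : represents f u v -> is_ratmap f.
Proof.
move=> [d [hf f2 _]]; split; first by exists d.
by exists 2%:R; apply: contraNneq f2 => ->; rewrite evm0.
Qed.

Lemma represents_eq f g u v : represents f u v -> represents g u v ->
  ratmap_eq f g.
Proof.
move=> [d [hf f2 ef]] [d' [hg g2 eg]] i j; apply/eqP; rewrite -subr_eq0;
  apply/eqP.
apply: (ev_homog_eq0 (F := F) char0 ixy (d := d + d')).
  by apply: rpredB; apply: dhomogM.
by rewrite evmB !evmM (ef i) (ef j) (eg i) (eg j); ring.
Qed.

Lemma represents_inj f g u v u' v' : represents f u v -> represents g u' v' ->
  ratmap_eq f g -> u = u' /\ v = v'.
Proof.
move=> [d [hf f2 ef]] [d' [hg g2 eg]] fg.
have C i : affine u v i = affine u' v' i.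
  have := congr1 ev (fg i 2%:R); rewrite !evmM (ef i) (eg i) => E.
  by apply: (mulfI f2); apply: (mulIf g2); rewrite E; ring.
by split; [exact: (C 0)|exact: (C 1)].
Qed.

Lemma exists_represents u v : u \in G -> v \in G -> exists f, represents f u v.
Proof.
move=> /G_quot[d [p [q [hp hq q0 E]]]] /G_quot[d' [p' [q' [hp' hq' q0' E']]]].
exists [tuple p * q'; p' * q; q * q'], (d + d')%N; split.
- elim/ord3_ind; rewrite /tnth /=; [exact: dhomogM| |exact: dhomogM].
  by rewrite addnC; exact: dhomogM.
- by rewrite /tnth /= evmM mulf_neq0.
- by elim/ord3_ind; rewrite /tnth /= ?affine0 ?affine1 ?affine2 !evmM -?E -?E';
  ring.
Qed.

Lemma represents_id : represents (ratmap_id k) X Y.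
Proof.
exists 1%N; split.
- by move=> i; rewrite tnth_mktuple dhomogX /= mpoly.mdeg1.
- by rewrite tnth_mktuple evmX affine2 oner_neq0.
- by move=> i; rewrite !tnth_mktuple !evmX affine2 mul1r.
Qed.

Definition is_field_hom (s : Kxy -> Kxy) : Prop :=
  [/\ forall a b, s (a + b) = s a + s b, forall a b, s (a * b) = s a * s b &
      forall a : k, s a%:A = a%:A].

Lemma sub_valM (a b : Kxy) : val (a * b) = val a * val b. Proof. by []. Qed.
Lemma sub_valD (a b : Kxy) : val (a + b) = val a + val b. Proof. by []. Qed.
Lemma sub_val0 : val (0 : Kxy) = 0. Proof. by []. Qed.
Lemma sub_val1 : val (1 : Kxy) = 1. Proof. by []. Qed.
Lemma sub_valC (c : k) : val (c%:A : Kxy) = c%:A. Proof. by []. Qed.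
Lemma sub_val_eq0 (a : Kxy) : (val a == 0) = (a == 0). Proof. by []. Qed.

Lemma val_evm (a b : Kxy) (p : P3) :
  val (evm (affine a b) p) = evm (affine (val a) (val b)) p.
Proof.
rewrite (evm_hom (A := Kxy) (B := F) (r := fun z : Kxy => val z : F)).
- congr evm; apply/funext; elim/ord3_ind; rewrite ?affine0 ?affine1 ?affine2 //.
- by move=> *; exact: rmorphD.
- by move=> *; exact: rmorphM.
- by move=> c; rewrite linearZ rmorph1.
Qed.

Lemma val_Xs : val Xs = X. Proof. exact: SubK. Qed.
Lemma val_Ys : val Ys = Y. Proof. exact: SubK. Qed.

Lemma hom_evm s : is_field_hom s -> forall p : P3,
  val (s (evm (affine Xs Ys) p)) = evm (affine (val (s Xs)) (val (s Ys))) p.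
Proof.
move=> [sD sM sC] p;
  rewrite (evm_hom (A := Kxy) (B := Kxy) (r := s)) // -val_evm.
congr val; congr evm; apply/funext; elim/ord3_ind;
  rewrite ?affine0 ?affine1 ?affine2 //.
by have := sC 1; rewrite !scale1r.
Qed.

Lemma hom_eq0 s : is_field_hom s -> forall a, s a = 0 -> a = 0.
Proof.
move=> [sD sM sC] a sa0; apply/eqP; apply: contraTT (oner_neq0 Kxy) => a0.
have := sC 1; rewrite !scale1r -(mulVf a0) sM sa0 mulr0 => /eqP.
by rewrite mulVf // negbK eq_sym.
Qed.

Lemma ev_scale f u v q d : represents f u v -> q \is d.-homog ->
  ev (q \mPo f) = ev (tnth f 2%:R) ^+ d * evm (affine u v) q.
Proof.
move=> [d' [hf f2 ef]] hq; rewrite evm_comp -(evm_scale _ _ hq).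
by congr evm; apply/funext => i; exact: ef.
Qed.

(** If [g] is the point [(s x, s y)] then composing with [g] is applying [s] to
    coordinates: composition of maps reverses the order of the morphisms. *)
Lemma represents_comp s f g (a b : Kxy) : is_field_hom s ->
  represents f (val a) (val b) -> represents g (val (s Xs)) (val (s Ys)) ->
  represents (ratmap_comp f g) (val (s a)) (val (s b)).
Proof.
move=> sP /[dup] rf [d [hf f2 ef]] /[dup] rg [d' [hg g2 eg]].
pose K3 := evm (affine Xs Ys) : P3 -> Kxy.
have evK p : val (K3 p) = ev p by rewrite val_evm val_Xs val_Ys.
have E i : ev (tnth (ratmap_comp f g) i) =
    ev (tnth g 2%:R) ^+ d * val (s (K3 (tnth f i))).
  by rewrite tnth_mktuple (ev_scale rg (hf i)) hom_evm.
have [sD sM sC] := sP.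
exists (d' * d)%N; split.
- by move=> i; rewrite tnth_mktuple; exact: dhomog_comp.
- rewrite E mulf_neq0 ?expf_neq0 // sub_val_eq0;
  apply: contraNneq f2 => /(hom_eq0 sP) e0.
  by rewrite -evK e0 sub_val0.
- move=> i; rewrite !E -mulrA; congr (_ * _).
  have -> : K3 (tnth f i) = K3 (tnth f 2%:R) * affine a b i.
    apply: val_inj; rewrite sub_valM !evK ef; congr (_ * _).
    by move: i; elim/ord3_ind => //; rewrite !affine2 sub_val1.
  rewrite sM sub_valM; congr (_ * _); move: i; elim/ord3_ind => //.
  by rewrite affine2; have := sC 1; rewrite !scale1r => ->; rewrite sub_val1.
Qed.

Lemma hom_ext s t : is_field_hom s -> is_field_hom t -> s Xs = t Xs ->
  s Ys = t Ys ->
  forall z, s z = t z.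
Proof.
move=> sP tP EX EY z; apply: val_inj.
have [d [p [q [_ _ q0 E]]]] := G_quot (valP z).
pose K3 := evm (affine Xs Ys) : P3 -> Kxy.
have evK r : val (K3 r) = ev r by rewrite val_evm val_Xs val_Ys.
have Ez : z * K3 q = K3 p by apply: val_inj; rewrite sub_valM !evK.
have Kq0 : K3 q != 0 by apply: contraNneq q0 => e0; rewrite -evK e0 sub_val0.
have H r : val (s (K3 r)) = val (t (K3 r)) by rewrite !hom_evm // EX EY.
have [_ sM _] := sP; have [_ tM _] := tP.
have nz : val (s (K3 q)) != 0.
  by rewrite sub_val_eq0; apply: contraNneq Kq0 => /(hom_eq0 sP) ->.
by apply: (mulIf nz); rewrite {2}H -!sub_valM -sM -tM Ez H.
Qed.

(** The hypothesis says that the rational map with coordinates [u], [v] is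
    dominant, so that no denominator becomes zero. *)
Lemma exists_hom (u v : F) : u \in G -> v \in G ->
  (forall d (q : P3), q \is d.-homog -> ev q != 0 -> evm (affine u v) q != 0) ->
  exists s, [/\ is_field_hom s, val (s Xs) = u & val (s Ys) = v].
Proof.
move=> uG vG dom.
have [phi [phiC phiU]] := exists_polyN_eval (in_alg F)
  (fun i => if i == ix then u else if i == iy then v else 0).
have [px [fx phix]] : exists p, frac p = X /\ phi p = u.
  by exists << ucm ix >>; rewrite pf_varE phiU eqxx.
have [py [fy phiy]] : exists p, frac p = Y /\ phi p = v.
  by exists << ucm iy >>; rewrite pf_varE phiU eq_sym (negbTE ixy) eqxx.
have [pe fracE phiE] : exists2 pe : P3 -> polyN k,
    forall p, frac (pe p) = ev p & forall p, phi (pe p) = evm (affine u v) p.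
  exists (evm (affine px py)) => p.
    rewrite (evm_hom (r := frac)).
    - by congr evm; apply/funext; elim/ord3_ind => //; exact: rmorph1.
    - by move=> *; exact: rmorphD.
    - by move=> *; exact: rmorphM.
    - by move=> a; rewrite pf_C.
  rewrite (evm_hom (r := phi)) //.
  - by congr evm; apply/funext; elim/ord3_ind => //; exact: rmorph1.
  - by move=> *; exact: rmorphD.
  - by move=> *; exact: rmorphM.
have /choice[s sP] (z : Kxy) : exists z' : Kxy,
  hom_graph frac phi (val z) (val z').
  have [d [p [q [_ hq q0 E]]]] := G_quot (valP z).
  have zG : evm (affine u v) p / evm (affine u v) q \in G.
    by rewrite rpred_div ?ev_in.
  exists (Sub (evm (affine u v) p / evm (affine u v) q) zG); rewrite SubK.
  have -> : val z = frac (pe p) / frac (pe q) by rewrite !fracE -E mulfK.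
  rewrite -!phiE; apply: gr_div => //; try exact: hom_graph_poly.
  by rewrite phiE (dom _ _ hq).
exists s; split; first split.
- move=> a b; apply: val_inj; apply: (gr_fun (sP _)).
  by rewrite !sub_valD; exact: hom_graphD.
- move=> a b; apply: val_inj; apply: (gr_fun (sP _)).
  by rewrite !sub_valM; exact: hom_graphM.
- move=> a; apply: val_inj; apply: (gr_fun (sP _)).
  by rewrite !sub_valC; exact: grC.
- by apply: (gr_fun (sP _)); rewrite val_Xs -phix -fx; exact: hom_graph_poly.
- by apply: (gr_fun (sP _)); rewrite val_Ys -phiy -fy; exact: hom_graph_poly.
Qed.

Lemma ratmap_comp_id f g : is_ratmap f -> is_ratmap (ratmap_comp f g) ->
  ratmap_eq (ratmap_comp f g) (ratmap_id k) ->
  represents (ratmap_comp f g) X Y /\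
  exists d, (forall i, tnth f i \is d.-homog) /\ ev (tnth f 2%:R) != 0.
Proof.
move=> [[df hf] _] [[dh hh] [i0 hi0]] E.
have h2 : tnth (ratmap_comp f g) 2%:R != 0.
  apply: contraNneq hi0 => h2; have := E i0 2%:R;
    rewrite h2 mul0r !tnth_mktuple.
  move/eqP; rewrite mulf_eq0 => /orP[//|].
  by move=> /eqP /(congr1 (fun p : P3 => p@_U_(2%:R))) /eqP;
    rewrite mcoeffX eqxx mcoeff0 oner_eq0.
have ev0 (p : P3) d : p \is d.-homog -> p != 0 -> ev p != 0.
  by move=> hp; apply: contraNneq => /(ev_homog_eq0 (F := F) char0 ixy hp) ->.
split.
  exists dh; split=> [//| |i]; first exact: ev0 h2.
  have := congr1 ev (E i 2%:R);
    rewrite !tnth_mktuple !evmM !evmX affine2 mulr1 => ->.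
  by [].
exists df; split=> //; apply: ev0 (hf _) _; apply: contraNneq h2 => f2.
by rewrite tnth_mktuple f2 comp_mpoly0.
Qed.

Lemma comp_mpolyA (f g : 3.-tuple P3) (q : P3) :
  (q \mPo f) \mPo g = q \mPo ratmap_comp f g.
Proof.
elim/mpoly_ring_ind: q => [a|p q Ep Eq|p q Ep Eq|i].
- by rewrite !comp_mpolyC.
- by rewrite !comp_mpolyD Ep Eq.
- by rewrite !comp_mpolyM Ep Eq.
- by rewrite !comp_mpolyXU -!tnth_nth tnth_mktuple.
Qed.

(** A map with a right inverse [g] is dominant: a form that vanishes on the image
    of [f] would vanish on that of [f \o g], which is the identity. *)
Lemma ratmap_hom f g : is_ratmap f -> is_ratmap g ->
  is_ratmap (ratmap_comp f g) ->
  ratmap_eq (ratmap_comp f g) (ratmap_id k) ->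
  exists s, is_field_hom s /\ represents f (val (s Xs)) (val (s Ys)).
Proof.
move=> rf rg rfg E; have [rh [d [hf f2]]] := ratmap_comp_id rf rfg E.
pose u i := ev (tnth f i) / ev (tnth f 2%:R).
have uG i : u i \in G by rewrite rpred_div ?ev_in ?gen_subfield_l
  ?gen_subfield_r.
have ruv : represents f (u 0) (u 1).
  exists d; split=> //; elim/ord3_ind;
    rewrite ?affine0 ?affine1 ?affine2 ?mulr1 //.
    by rewrite mulrCA mulfV ?mulr1.
  by rewrite mulrCA mulfV ?mulr1.
have [s [sP sX sY]] : exists s, [/\ is_field_hom s,
  val (s Xs) = u 0 & val (s Ys) = u 1].
  apply: exists_hom => // e q hq q0.
  have := ev_scale ruv hq; apply: contra_eq_neq => u0; rewrite u0 mulr0.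
  have qf : q \mPo f != 0.
    apply: contraNneq q0 => qf; have := comp_mpolyA f g q;
      rewrite qf comp_mpoly0.
    move=> /esym/(congr1 ev); rewrite evm0 (ev_scale rh hq) => /eqP.
    have [_ [_ h2 _]] := rh.
    by rewrite mulf_eq0 expf_eq0 (negbTE h2) andbF.
  by apply: contraNneq qf => /(ev_homog_eq0 (F :=
    F) char0 ixy (dhomog_comp hq hf)) ->.
by exists s; rewrite sX sY.
Qed.

End Cremona.

(** * The two isomorphisms *)
Section CremonaGroup.
Variables (k : fieldType) (F : poly_fractions k).
Hypothesis char0 : [pchar k] =i pred0.
Variables (ix iy : nat).
Hypothesis ixy : ix != iy.
Local Notation var := (pf_var F).
Local Notation X := (var ix).
Local Notation Y := (var iy).
Local Notation Kxy := (subfield_of X Y).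
Local Notation Xs := (sub_x F ix iy).
Local Notation Ys := (sub_y F ix iy).

Lemma field_autP (s : field_aut Kxy) : is_field_hom (val s : sym Kxy).
Proof. exact: (asboolP _ (valP s)). Qed.

Lemma field_autVP (s : field_aut Kxy) : is_field_hom (sym_inv (val s)).
Proof. exact: field_autP (s^-1)%g. Qed.

Lemma field_aut_eq (s t : field_aut Kxy) :
  sym_inv (val s) Xs = sym_inv (val t) Xs ->
  sym_inv (val s) Ys = sym_inv (val t) Ys -> s = t.
Proof.
move=> EX EY; apply: val_inj; apply: sym_eqP => z.
have E := hom_ext (field_autVP s) (field_autVP t) EX EY.
by rewrite -{1}[z](symK (val t)) -E symVK.
Qed.

(** The automorphism [s] corresponds to the map whose coordinates are the images
    of x and y under the inverse of [s]; the inverse compensates for the reversal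
    of order in [represents_comp]. *)
Lemma cremona_iso : exists b : field_aut Kxy -> 3.-tuple (mpoly 3 k),
  is_cremona_isomorphism b.
Proof.
have /choice[b bP] (s : field_aut Kxy) : exists f,
    represents (F :=
      F) ix iy f (val (sym_inv (val s) Xs)) (val (sym_inv (val s) Ys)).
  by apply: exists_represents; exact: valP.
have comp s t : represents (F := F) ix iy (ratmap_comp (b s) (b t))
    (val (sym_inv (val t) (sym_inv (val s) Xs)))
    (val (sym_inv (val t) (sym_inv (val s) Ys))).
  exact: represents_comp (field_autVP t) (bP s) (bP t).
exists b; split=> [s|s t|s t st|f [fr [g [gr fgr fgE gfr gfE]]]].
- split; first exact: represents_ratmap (bP s).
  have rid := represents_id F ix iy.
  have c1 := comp s (s^-1)%g; have c2 := comp (s^-1)%g s.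
  rewrite /= !symVK val_Xs val_Ys in c1; rewrite /= !symK val_Xs val_Ys in c2.
  exists (b (s^-1)%g); split.
  + exact: represents_ratmap (bP _).
  + exact: represents_ratmap c1.
  + exact: represents_eq c1 rid.
  + exact: represents_ratmap c2.
  + exact: represents_eq c2 rid.
- exact: (represents_eq char0 ixy (bP (s * t)%g) (comp s t)).
- have [/val_inj EX /val_inj EY] := represents_inj (bP s) (bP t) st.
  exact: field_aut_eq.
have [s [sP fs]] := ratmap_hom F char0 ixy fr gr fgr fgE.
have [t [tP gt]] := ratmap_hom F char0 ixy gr fr gfr gfE.
have id_hom : is_field_hom (id : Kxy -> Kxy) by split.
have cancel_hom (s' t' : Kxy -> Kxy) f' g' : is_field_hom s' ->
  is_field_hom t' ->
    is_ratmap f' -> is_ratmap (ratmap_comp f' g') ->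
    ratmap_eq (ratmap_comp f' g') (ratmap_id k) ->
    represents (F := F) ix iy f' (val (s' Xs)) (val (s' Ys)) ->
    represents (F := F) ix iy g' (val (t' Xs)) (val (t' Ys)) -> cancel s' t'.
  move=> sP' tP' fr' fgr' fgE' rf rg.
  have [EX EY] :=
    represents_inj (represents_comp tP' rf rg) (represents_id F ix iy) fgE'.
  have [sD sM sC] := sP'; have [tD tM tC] := tP'.
  apply: (hom_ext (s := t' \o s')) => //=.
  - by split=> *; rewrite /= ?sD ?tD ?sM ?tM ?sC ?tC.
  - by apply: val_inj; rewrite EX val_Xs.
  - by apply: val_inj; rewrite EY val_Ys.
have st := cancel_hom s t f g sP tP fr fgr fgE fs gt.
have ts := cancel_hom t s g f tP sP gr gfr gfE gt fs.
have aP : field_aut_pred (Sym ts st : sym Kxy) by apply/asboolP.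
pose a : field_aut Kxy := exist _ (Sym ts st) aP.
by exists a; exact: (represents_eq char0 ixy (bP a) fs).
Qed.

End CremonaGroup.

Section PoissonAutomorphisms.
Variables (k : fieldType) (F : poly_fractions k).
Hypothesis char0 : [pchar k] =i pred0.
Variables (g : lmodType k) (lie : g -> g -> g) (x y : g).
Hypothesis g_free : is_free_lie lie x y.
Variables (e : nat -> g) (deg : nat -> nat).
Hypothesis eP : is_linear_basis e.
Hypothesis e_homog : forall i, exists m n,
  multihomogeneous lie x y m n (e i) /\ (m + n = deg i)%N.
Variables (ix iy : nat).
Hypotheses (e_x : e ix = x) (e_y : e iy = y).
Variable br : F -> F -> F.
Local Notation var := (pf_var F).
Hypothesis brP : is_poisson_bracket br.
Hypothesis br_var : forall i j n (c : nat -> k),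
  lie (e i) (e j) = \sum_(l < n) c l *: e l ->
  br (var i) (var j) = \sum_(l < n) c l *: var l.
Let lieP := proj1 g_free.
Let brL := poisson_lie brP.

Local Notation X := (var ix).
Local Notation Y := (var iy).
Local Notation G := (gen_subfield X Y).
Local Notation Kxy := (subfield_of X Y).

Lemma xy_not_commuting : br X Y != 0.
Proof.
have [E [EL Ee Elie]] := exists_lie_var lieP eP brP br_var.
have [iota [iL ixE iyE _]] :=
  proj2 g_free (ncs k) _ (commutator_lie (ncs k))
    (letter k true) (letter k false).
have [delta [dK dV]] := exists_delta F e iota.
have B := br_xy_neq0 eP e_x e_y brP EL Ee Elie iL ixE iyE dK dV.
exact: B.
Qed.

Lemma poisson_aut_xy (phi : poisson_aut br) :
  val phi X \in G /\ val phi Y \in G.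
Proof.
have [E [EL Ee Elie]] := exists_lie_var lieP eP brP br_var.
have [iota [iL ixE iyE _]] :=
  proj2 g_free (ncs k) _ (commutator_lie (ncs k))
    (letter k true) (letter k false).
have [delta [dK dV]] := exists_delta F e iota.
have [pL pM pB] : is_poisson_aut br (val phi) := asboolP _ (valP phi).
exact: (aut_var char0 lieP eP e_homog e_x e_y brP EL Ee Elie iL ixE iyE dK dV
  (symK (val phi)) (symVK (val phi)) pL pM pB).
Qed.

Lemma ix_neq_iy : ix != iy.
Proof.
by apply: contraNneq xy_not_commuting => ->; rewrite (lie_alt brL).
Qed.

Lemma poisson_endo_id (theta : F -> F) :
  (forall (a : k) u v, theta (a *: u + v) = a *: theta u + theta v) ->
  (forall u v, theta (u * v) = theta u * theta v) ->
  (forall u v, theta (br u v) = br (theta u) (theta v)) ->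
  theta X = X -> theta Y = Y -> theta =1 id.
Proof.
move=> tL tM tB tX tY.
have [E [EL Ee Elie]] := exists_lie_var lieP eP brP br_var.
have X0 : X != 0 by apply: contraNneq xy_not_commuting => ->;
  rewrite (lie0l brL).
have t1 : theta 1 = 1 by apply: (mulIf X0); rewrite -{1}tX -tM !mul1r.
have t0 : theta 0 = 0 by have := tL (-1) 0 0;
  rewrite scaler0 addr0 scaleN1r addNr.
apply: (poisson_ind e_homog e_x e_y EL Ee Elie) => //.
- by move=> a; have := tL a 1 0; rewrite !addr0 t0 t1 addr0.
- by move=> u v Eu Ev; have := tL 1 u v; rewrite !scale1r Eu Ev.
- by move=> u v Eu Ev; rewrite tM Eu Ev.
- move=> u Eu; have [->|u0] := eqVneq u 0; first by rewrite invr0.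
  by apply: (mulIf u0); rewrite -[X in _ * X = _]Eu -tM !mulVf.
- by move=> u v Eu Ev; rewrite tB Eu Ev.
Qed.

Lemma poisson_autP (phi : poisson_aut br) : is_poisson_aut br (val phi).
Proof. exact: (asboolP _ (valP phi)). Qed.

Lemma poisson_aut_sub (phi : poisson_aut br) z : z \in G -> val phi z \in G.
Proof.
have [pL pM pB] := poisson_autP phi.
have phiK := symK (val phi); have [pX pY] := poisson_aut_xy phi.
pose S : {pred F} := fun z => val phi z \in G.
have inS w : (w \in S) = (val phi w \in G) by [].
move=> /gen_subfieldP zG; apply: (zG S); rewrite ?inS //.
- split=> [|u v|u v]; rewrite !inS.
  + by rewrite (aut1 phiK pL pM) rpred1.
  + move=> uS vS; rewrite -scaleN1r addrC pL scaleN1r addrC.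
    exact: rpredB.
  + by move=> uS vS; rewrite pM (autV phiK pL pM) rpred_div.
- by move=> a; rewrite inS (autC phiK pL pM) rpredZ ?rpred1.
Qed.

Lemma restriction (phi : poisson_aut br) : exists s : field_aut Kxy,
  forall z : Kxy, val (val s z) = val phi (val z).
Proof.
pose r (ph : poisson_aut br) (z : Kxy) : Kxy :=
  Sub (val ph (val z)) (poisson_aut_sub ph (valP z)).
have rE ph z : val (r ph z) = val ph (val z) by exact: SubK.
have K1 : cancel (r phi) (r (phi^-1)%g).
  by move=> z; apply: val_inj; rewrite !rE; exact: symK.
have K2 : cancel (r (phi^-1)%g) (r phi).
  by move=> z; apply: val_inj; rewrite !rE; exact: symVK.
have [pL pM pB] := poisson_autP phi; have phiK := symK (val phi).
have aP : field_aut_pred (Sym K1 K2 : sym Kxy).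
  apply/asboolP; split=> [u v|u v|a]; apply: val_inj; rewrite rE.
  - by rewrite sub_valD (autD pL) sub_valD !rE.
  - by rewrite sub_valM pM sub_valM !rE.
  - by rewrite sub_valC (autC phiK pL pM).
by exists (exist _ (Sym K1 K2) aP : field_aut Kxy) => z; exact: rE.
Qed.

Lemma extension (s : field_aut Kxy) : exists phi : poisson_aut br,
  forall z : Kxy, val phi (val z) = val (val s z).
Proof.
have [E [EL Ee Elie]] := exists_lie_var lieP eP brP br_var.
have [sD sM sC] := field_autP s; have [tD tM tC] := field_autVP s.
have sK := symK (val s); have tK := symVK (val s).
have [Phi [PL PM PB Pv]] :=
  exists_extension g_free eP e_homog e_x e_y brP EL Ee Elie
  sK sD sM sC tD tM tC (can_inj tK).
have [Psi [QL QM QB Qv]] :=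
  exists_extension g_free eP e_homog e_x e_y brP EL Ee Elie
  tK tD tM tC sD sM sC (can_inj sK).
have K1 : cancel Phi Psi.
  apply: (@poisson_endo_id (Psi \o Phi)) => /= *.
  - by rewrite PL QL.
  - by rewrite PM QM.
  - by rewrite PB QB.
  - by rewrite -(val_Xs F ix iy) Pv Qv sK.
  - by rewrite -(val_Ys F ix iy) Pv Qv sK.
have K2 : cancel Psi Phi.
  apply: (@poisson_endo_id (Phi \o Psi)) => /= *.
  - by rewrite QL PL.
  - by rewrite QM PM.
  - by rewrite QB PB.
  - by rewrite -(val_Xs F ix iy) Qv Pv tK.
  - by rewrite -(val_Ys F ix iy) Qv Pv tK.
have aP : poisson_aut_pred br (Sym K1 K2) by apply/asboolP.
by exists (exist _ (Sym K1 K2) aP : poisson_aut br) => z; exact: Pv.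
Qed.

Lemma restriction_iso :
  exists Phi : {multiplicative poisson_aut br -> field_aut Kxy},
    bijective Phi /\
    forall (phi : poisson_aut br) (z : Kxy),
      val (val (Phi phi) z) = val phi (val z).
Proof.
have /choice[R RP] := restriction; have /choice[S SP] := extension.
have RM : {morph R : a b / (a * b)%g}.
  move=> a b; apply: val_inj; apply: sym_eqP => z; apply: val_inj.
  by rewrite RP /= !RP.
exists (HB.pack_for {multiplicative poisson_aut br -> field_aut Kxy} R
  (monoid.isMultiplicative.Build _ _ R RM)).
split=> //=; exists S => [phi|s]; last first.
  by apply: val_inj; apply: sym_eqP => z; apply: val_inj; rewrite RP SP.
have agree z : z \in G -> val (S (R phi)) z = val phi z.
  by move=> zG; rewrite -[z](SubK Kxy zG) SP RP.
have [pL pM pB] := poisson_autP phi.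
have [qL qM qB] := poisson_autP (phi^-1)%g.
have [sL sM sB] := poisson_autP (S (R phi)).
have K := symK (val phi).
apply: val_inj; apply: sym_eqP => z.
have E : sym_inv (val phi) (val (S (R phi)) z) = z.
  apply: (@poisson_endo_id (fun z => val (phi^-1)%g (val (S (R phi)) z))) => *.
  - by rewrite sL qL.
  - by rewrite sM qM.
  - by rewrite sB qB.
  - by rewrite agree ?gen_subfield_l //; exact: K.
  - by rewrite agree ?gen_subfield_r //; exact: K.
by rewrite -{2}E symVK.
Qed.

End PoissonAutomorphisms.

Theorem theorem3 (k : fieldType) (char_k0 : [pchar k] =i pred0)
  (g : lmodType k) (lie : g -> g -> g) (x y : g)
  (g_free : is_free_lie lie x y)
  (e : nat -> g) (e_basis : is_linear_basis e)
  (e_homog : forall i, exists m n, multihomogeneous lie x y m n (e i))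
  (ix iy : nat) (e_x : e ix = x) (e_y : e iy = y)
  (br : fracN k -> fracN k -> fracN k)
  (br_free : is_free_poisson_bracket lie e br) :
  (exists Phi : {multiplicative poisson_aut br ->
                   field_aut (subfield_of (fracN_var k ix) (fracN_var k iy))},
     bijective Phi /\
     forall (phi : poisson_aut br)
            (z : subfield_of (fracN_var k ix) (fracN_var k iy)),
       val (val (Phi phi) z) = val phi (val z)) /\
  (exists b : field_aut (subfield_of (fracN_var k ix) (fracN_var k iy)) ->
              3.-tuple (mpoly 3 k),
     is_cremona_isomorphism b).
Proof.
have [brP br_var] := br_free.
have /choice[deg e_deg] i : exists d, exists m n,
    multihomogeneous lie x y m n (e i) /\ (m + n = d)%N.
  by have [m [n h]] := e_homog i; exists (m + n)%N, m, n.
split; first exact: (@restriction_iso k (fracN_fractions k) char_k0 g lie x y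
  g_free e deg e_basis e_deg ix iy e_x e_y br brP br_var).
apply: (@cremona_iso k (fracN_fractions k) char_k0 ix iy).
exact: (@ix_neq_iy k (fracN_fractions k) g lie x y
  g_free e e_basis ix iy e_x e_y br brP br_var).
Qed.
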